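(* Let $\widetilde{W}$ be the affine Weyl group of type $\widetilde{B}_n$ and $w\in\widetilde{W}^S$. For $n\ge4$, $w$ is palindromic if and only if $\pi(w)$ is a one-row shape $(j)$ with $0\le j<2n$ or a staircase shape $(k,k-1,k-2,\dots,1)$ with $1<k<n$. For $n=3$, $w$ is palindromic if and only if $\pi(w)$ is a one-row shape, or the staircase shape $(2,1)$, or the square $(3,3,3)$.
   Context: $\widetilde{W}$ ($n\ge3$) has generators $s_0,\dots,s_n$ with $m(s_0,s_2)=m(s_1,s_2)=3$, $m(s_i,s_{i+1})=3$ ($2\le i\le n-2$), $m(s_{n-1},s_n)=4$, all other pairs commuting. $S=\{s_1,\dots,s_n\}$, $S'=\{s_0,s_2,\dots,s_n\}$; $\widetilde{W}^S$, $\widetilde{W}^{S'}$ are the sets of minimal length left coset representatives for $W_S$, $W_{S'}$. Segments ($1\le j\le 2n-1$): $\sigma_1(j)=s_j\cdots s_2s_1$ ($j\le n$), $\sigma_1(j)=s_{2n-j}\cdots s_{n-1}s_ns_{n-1}\cdots s_2s_1$ ($n<j$); $\sigma_0(j)$ is obtained from $\sigma_1(j)$ by replacing every $s_1$ by $s_0$. Every $w\in\widetilde{W}^S$, $w\ne\mathrm{id}$, factors uniquely $w=uv$ with $u\in\widetilde{W}^{S'}$, $v\in W_{S'}$, lengths adding, and $v=\sigma_0(\lambda_1)$; if $u\neq\mathrm{id}$, $u=u'v'$ with $u'\in\widetilde{W}^S$, $v'=\sigma_1(\lambda_2)\in W_S$; continuing alternately gives $w=\cdots\sigma_0(\lambda_3)\sigma_1(\lambda_2)\sigma_0(\lambda_1)$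 and $\pi(w)=(\lambda_1,\lambda_2,\dots)$, $\pi(\mathrm{id})=\emptyset=(0)$; $\pi(w)$ is a partition of $\ell(w)$. $P_w(t)=\sum_{v\in\widetilde{W}^S, v\le w}t^{\ell(v)}$ (Bruhat order); $w$ is palindromic if the coefficients satisfy $a_i=a_{\ell(w)-i}$ for all $i$. *)

(* Defs.v *)
From HB Require Import structures.
From mathcomp Require Import all_boot all_order all_algebra.
From mathcomp Require Import boolp classical_sets functions cardinality fsbigop.

Set Implicit Arguments.
Unset Strict Implicit.
Unset Printing Implicit Defensive.

Local Open Scope classical_set_scope.
Local Open Scope group_scope.

(* The Coxeter group < I | (s_i s_j)^(m i j) = 1 >, for a Coxeter matrix m
   (with m i i = 1), as words in I modulo the congruence generated by the
   relations.  As the generators are involutions, reversing a word inverts it;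
   the two hypotheses needed for this are packed with m. *)
Record coxmat (I : Type) := CoxMat {
  cox_m :> I -> I -> nat;
  cox_diag : forall i, cox_m i i = 1%N;
  cox_sym : forall i j, cox_m i j = cox_m j i }.

Inductive cox_eq (I : Type) (m : coxmat I) : seq I -> seq I -> Prop :=
| cox_eq_refl u : cox_eq m u u
| cox_eq_sym u v : cox_eq m u v -> cox_eq m v u
| cox_eq_trans u v w : cox_eq m u v -> cox_eq m v w -> cox_eq m u w
| cox_eq_rel u v i j :
    cox_eq m (u ++ flatten (nseq (m i j) [:: i; j]) ++ v) (u ++ v).

Definition cox_eqb (I : Type) (m : coxmat I) : rel (seq I) :=
  fun u v => `[< cox_eq m u v >].

Lemma cox_eqb_refl (I : Type) (m : coxmat I) : reflexive (cox_eqb m).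
Proof. by move=> u; apply/asboolP; apply: cox_eq_refl. Qed.

Lemma cox_eqb_sym (I : Type) (m : coxmat I) : symmetric (cox_eqb m).
Proof.
by move=> u v; apply/asboolP/asboolP; apply: cox_eq_sym.
Qed.

Lemma cox_eqb_trans (I : Type) (m : coxmat I) : transitive (cox_eqb m).
Proof.
move=> v u w /asboolP uv /asboolP vw; apply/asboolP.
exact: cox_eq_trans uv vw.
Qed.

Canonical cox_equiv (I : Type) (m : coxmat I) :=
  EquivRel (cox_eqb m) (@cox_eqb_refl I m) (@cox_eqb_sym I m)
    (@cox_eqb_trans I m).

Definition coxeter (I : choiceType) (m : coxmat I) : Type :=
  {eq_quot (cox_eqb m)}%qT.

HB.instance Definition _ (I : choiceType) (m : coxmat I) :=
  Choice.on (coxeter m).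
HB.instance Definition _ (I : choiceType) (m : coxmat I) :=
  EqQuotient.on (coxeter m).

Definition cox_class (I : choiceType) (m : coxmat I) (u : seq I) : coxeter m :=
  (\pi_(coxeter m) u)%qT.

Lemma cox_classP (I : choiceType) (m : coxmat I) (u v : seq I) :
  cox_class m u = cox_class m v <-> cox_eq m u v.
Proof.
rewrite /cox_class; split.
  by move/eqP; rewrite eqmodE => /asboolP.
by move=> uv; apply/eqP; rewrite eqmodE; apply/asboolP.
Qed.

Lemma cox_class_repr (I : choiceType) (m : coxmat I) (x : coxeter m) :
  cox_class m (repr x) = x.
Proof. by rewrite /cox_class reprK. Qed.

Lemma cox_eq_catl (I : Type) (m : coxmat I) (w u v : seq I) :
  cox_eq m u v -> cox_eq m (w ++ u) (w ++ v).
Proof.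
elim=> [x|x y _|x y z _ xy _|x y i j].
- exact: cox_eq_refl.
- exact: cox_eq_sym.
- exact: cox_eq_trans xy.
- by rewrite !(catA w); apply: cox_eq_rel.
Qed.

Lemma cox_eq_catr (I : Type) (m : coxmat I) (w u v : seq I) :
  cox_eq m u v -> cox_eq m (u ++ w) (v ++ w).
Proof.
elim=> [x|x y _|x y z _ xy _|x y i j].
- exact: cox_eq_refl.
- exact: cox_eq_sym.
- exact: cox_eq_trans xy.
- by rewrite -!catA; apply: cox_eq_rel.
Qed.

Lemma rev_alternate (T : Type) (k : nat) (i j : T) :
  rev (flatten (nseq k [:: i; j])) = flatten (nseq k [:: j; i]).
Proof.
elim: k => //= k IH; rewrite -cat1s -[j :: _]cat1s !rev_cat IH.
by elim: k {IH} => //= k ->.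
Qed.

Lemma cox_eq_rev (I : Type) (m : coxmat I) (u v : seq I) :
  cox_eq m u v -> cox_eq m (rev u) (rev v).
Proof.
elim=> [x|x y _|x y z _ xy _|x y i j].
- exact: cox_eq_refl.
- exact: cox_eq_sym.
- exact: cox_eq_trans xy.
- by rewrite !rev_cat rev_alternate -catA cox_sym; apply: cox_eq_rel.
Qed.

Lemma cox_eq_revl (I : Type) (m : coxmat I) (u : seq I) :
  cox_eq m (rev u ++ u) [::].
Proof.
elim: u => [|i u IH]; first exact: cox_eq_refl.
apply: cox_eq_trans IH; rewrite rev_cons cat_rcons.
by have := cox_eq_rel m (rev u) u i i; rewrite cox_diag.
Qed.

Definition cox_one (I : choiceType) (m : coxmat I) : coxeter m :=
  cox_class m [::].
Definition cox_mul (I : choiceType) (m : coxmat I) (x y : coxeter m) :=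
  cox_class m (repr x ++ repr y).
Definition cox_inv (I : choiceType) (m : coxmat I) (x : coxeter m) :=
  cox_class m (rev (repr x)).

Lemma cox_repr_class (I : choiceType) (m : coxmat I) (u : seq I) :
  cox_eq m (repr (cox_class m u)) u.
Proof. by apply/cox_classP; rewrite cox_class_repr. Qed.

Lemma cox_mul_class (I : choiceType) (m : coxmat I) (u v : seq I) :
  cox_mul (cox_class m u) (cox_class m v) = cox_class m (u ++ v).
Proof.
apply/cox_classP; apply: (@cox_eq_trans _ _ _ (u ++ repr (cox_class m v))).
  exact/cox_eq_catr/cox_repr_class.
exact/cox_eq_catl/cox_repr_class.
Qed.

Lemma cox_inv_class (I : choiceType) (m : coxmat I) (u : seq I) :
  cox_inv (cox_class m u) = cox_class m (rev u).
Proof. exact/cox_classP/cox_eq_rev/cox_repr_class. Qed.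

Lemma cox_mulA (I : choiceType) (m : coxmat I) : associative (@cox_mul I m).
Proof.
move=> x y z; rewrite -(cox_class_repr x) -(cox_class_repr y).
by rewrite -(cox_class_repr z) !cox_mul_class catA.
Qed.

Lemma cox_mul1 (I : choiceType) (m : coxmat I) :
  left_id (cox_one m) (@cox_mul I m).
Proof. by move=> x; rewrite -(cox_class_repr x) cox_mul_class. Qed.

Lemma cox_mul1r (I : choiceType) (m : coxmat I) :
  right_id (cox_one m) (@cox_mul I m).
Proof. by move=> x; rewrite -(cox_class_repr x) cox_mul_class cats0. Qed.

Lemma cox_mulV (I : choiceType) (m : coxmat I) :
  left_inverse (cox_one m) (@cox_inv I m) (@cox_mul I m).
Proof.
move=> x; rewrite -(cox_class_repr x) cox_inv_class cox_mul_class.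
exact/cox_classP/cox_eq_revl.
Qed.

Lemma cox_mulVr (I : choiceType) (m : coxmat I) :
  right_inverse (cox_one m) (@cox_inv I m) (@cox_mul I m).
Proof.
move=> x; rewrite -(cox_class_repr x) cox_inv_class cox_mul_class.
apply/cox_classP; rewrite -{1}(revK (repr x)); exact: cox_eq_revl.
Qed.

HB.instance Definition _ (I : choiceType) (m : coxmat I) :=
  isGroup.Build (coxeter m) (@cox_mulA I m) (@cox_mul1 I m) (@cox_mul1r I m)
    (@cox_mulV I m) (@cox_mulVr I m).

Definition gen (I : choiceType) (m : coxmat I) (i : I) : coxeter m :=
  cox_class m [:: i].

Definition wprod (I : choiceType) (m : coxmat I) (u : seq I) : coxeter m :=
  \prod_(i <- u) gen m i.

Lemma wprodE (I : choiceType) (m : coxmat I) (u : seq I) :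
  wprod m u = cox_class m u.
Proof.
rewrite /wprod; elim: u => [|i u IH]; first by rewrite big_nil.
by rewrite big_cons IH [LHS]cox_mul_class.
Qed.

Lemma wprod_surj (I : choiceType) (m : coxmat I) (w : coxeter m) :
  exists u, wprod m u = w.
Proof. by exists (repr w); rewrite wprodE cox_class_repr. Qed.

Lemma ell_subproof (I : choiceType) (m : coxmat I) (w : coxeter m) :
  exists k, `[< exists2 u, size u = k & wprod m u = w >].
Proof.
have [u uw] := wprod_surj w.
by exists (size u); apply/asboolP; exists u.
Qed.

Definition ell (I : choiceType) (m : coxmat I) (w : coxeter m) : nat :=
  ex_minn (ell_subproof w).

Definition reflection (I : choiceType) (m : coxmat I) (t : coxeter m) : Prop :=
  exists (x : coxeter m) (i : I), t = x * gen m i * x^-1.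

Inductive bruhat (I : choiceType) (m : coxmat I) (v : coxeter m) :
    coxeter m -> Prop :=
| bruhat_refl : bruhat v v
| bruhat_step w t : bruhat v w -> reflection t -> (ell w < ell (w * t)%g)%N ->
    bruhat v (w * t).

(* No inverses are needed to generate W_J, the generators being involutions. *)
Definition parabolic (I : choiceType) (m : coxmat I) (J : pred I)
    (x : coxeter m) : Prop :=
  exists2 u, all J u & wprod m u = x.

Definition min_rep (I : choiceType) (m : coxmat I) (J : pred I)
    (w : coxeter m) : Prop :=
  forall x, parabolic J x -> (ell w <= ell (w * x)%g)%N.

Definition lower_ideal (I : choiceType) (m : coxmat I) (J : pred I)
    (w : coxeter m) : set (coxeter m) :=
  [set v | min_rep J v /\ bruhat v w].

Definition poincare (I : choiceType) (m : coxmat I) (J : pred I)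
    (w : coxeter m) : {poly int} :=
  (\sum_(v \in lower_ideal J w) ('X^(ell v) : {poly int}))%R.

(* The sum defining poincare would be 0 on an infinite index set; for a finite
   set of generators this does not happen. *)
Lemma finite_lower_ideal (I : finType) (m : coxmat I) (J : pred I)
  (w : coxeter m) : finite_set (lower_ideal J w).
Proof.
have le_ell v : bruhat v w -> (ell v <= ell w)%N.
  by elim=> // x t _ le_vx _ /ltnW; apply: leq_trans.
apply: (@sub_finite_set _ _
  ((fun u : {k : 'I_(ell w).+1 & (k : nat).-tuple I} => wprod m (tagged u))
    @` setT)); last exact/finite_image/finite_finset.
move=> v [_ /le_ell le_vw].
have [u uv uE] : exists2 u, size u = ell v & wprod m u = v.
  by rewrite /ell; case: ex_minnP => k /asboolP.
have lt_u : (size u < (ell w).+1)%N by rewrite uv ltnS.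
by exists (@Tagged _ (Ordinal lt_u) (fun k => (k : nat).-tuple I) (in_tuple u)).
Qed.

Definition palindromic (I : choiceType) (m : coxmat I) (J : pred I)
    (w : coxeter m) : Prop :=
  forall i : nat, (i <= ell w)%N ->
    ((poincare J w)`_i = (poincare J w)`_(ell w - i))%R.

(* Bonds of the affine diagram of type B_n between the nodes i < j. *)
Definition affB_bond (n i j : nat) : nat :=
  (if (j == 2) && (i < 2) then 3
   else if [&& 2 <= i, i <= n - 2 & j == i.+1] then 3
   else if (i == n.-1) && (j == n) then 4
   else 2)%N.

Definition affB_m (n : nat) (i j : 'I_n.+1) : nat :=
  if i == j then 1%N else affB_bond n (minn i j) (maxn i j).

Lemma affB_diag (n : nat) (i : 'I_n.+1) : affB_m i i = 1%N.
Proof. by rewrite /affB_m eqxx. Qed.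

Lemma affB_sym (n : nat) (i j : 'I_n.+1) : affB_m i j = affB_m j i.
Proof. by rewrite /affB_m eq_sym minnC maxnC. Qed.

Definition affB_mat (n : nat) : coxmat 'I_n.+1 :=
  CoxMat (@affB_diag n) (@affB_sym n).

Definition affB (n : nat) := coxeter (affB_mat n).

(* The generators other than s_0 (the set S) for b = false, and the generators
   other than s_1 (the set S') for b = true. *)
Definition omit (n : nat) (b : bool) : pred 'I_n.+1 :=
  fun i => (i : nat) != b.

Definition segment_word (n j : nat) : seq nat :=
  if (j <= n)%N then rev (iota 1 j)
  else iota (2 * n - j)%N (j - n)%N ++ rev (iota 1 n).

(* sigma_1(j) for b = true, sigma_0(j) for b = false. *)
Definition segment (n : nat) (b : bool) (j : nat) : affB n :=
  wprod (affB_mat n)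
    [seq inord (if k == 1%N then b : nat else k) | k <- segment_word n j].

(* affB_shape b w la: la lists the parts read off by the alternating parabolic
   factorization of w, starting with a factorization w = u sigma_b(la_1) for
   w a minimal representative modulo the generators other than s_b. *)
Inductive affB_shape (n : nat) : bool -> affB n -> seq nat -> Prop :=
| affB_shape_nil b : affB_shape b 1 [::]
| affB_shape_cons b (w u : affB n) (j : nat) (la : seq nat) :
    w <> 1 -> min_rep (omit b) w ->
    min_rep (omit (~~ b)) u -> parabolic (omit (~~ b)) (segment n b j) ->
    (1 <= j <= 2 * n - 1)%N ->
    w = u * segment n b j ->
    ell w = (ell u + ell (segment n b j))%N ->
    affB_shape (~~ b) u la ->
    affB_shape b w (j :: la).

(* The default value of xget is irrelevant: every minimal representative modulo
   W_S has exactly one shape. *)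
Definition affB_pi (n : nat) (w : affB n) : seq nat :=
  xget [::] [set la | affB_shape false w la].

(* Partitions are lists of positive parts, so the shape (0) is the empty list. *)
Definition one_row (j : nat) : seq nat := if j == 0%N then [::] else [:: j].

Definition staircase (k : nat) : seq nat := rev (iota 1 k).

(* Main.v *)
(** Write W^S for the minimal coset representatives. An element of W^S is determined
    by the image of the origin under the action of W on Z^n, and firing a wall that is
    positive at that point moves one step up in W^S (the numbers game of Tits and
    Mozes, which needs only the strong exchange condition and a rank two check).
    In these terms the shapes of elements of W^S are the partitions with parts at most
    2n-1 whose parts below n are distinct, and containment of shapes implies Bruhat
    order. W^S has one element of length 1, one of length 2 and, for n >= 4, two of
    length 4, so a palindromic shape has one coatom and one element of corank 2. Lowering
    single parts produces two such elements except for one row shapes, staircases,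
    (n,...,n) and (n,...,n,n-1,...,1). The last two families have a further coatom or
    element of corank 2, obtained by deleting a letter inside the word and read off
    from the point it reaches; only (n^n) escapes, and it has three elements of
    corank 4. Conversely one row shapes have a chain below them, the
    ideal of a staircase consists of the subsets of {1,...,k} and is symmetric under
    complement, and the ideal of (3,3,3) for n = 3 is computed. *)

Require Import Defs.
From mathcomp Require Import all_boot all_order all_algebra.
From mathcomp Require Import boolp classical_sets cardinality fsbigop finmap.
From mathcomp Require Import zify ring.

Set Implicit Arguments.
Unset Strict Implicit.
Unset Printing Implicit Defensive.

Arguments ell {I m} w%_g.

(** One family of actions on Z^n, depending on the height N of wall 0, is used in two ways. For N =
    1 the base point has W_S as stabilizer, so cosets are points and a Bruhat relation follows from
    locating the end point of a subword, reduced or not. For N = 2n the point (n, ..., 1) is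
    interior to the alcove, and its image under w^-1 shows the right ascents of w. Minimality of a
    product of segments thereby becomes a set of inequalities between the entries of one decreasing
    vector; this is where the rule on repeated parts comes from. For non-palindromicity one-sided
    counts suffice: all of W^S in a small rank against a few explicit elements in the same corank.
    The difficulty is that for (n,...,n) and (n,...,n,n-1,...,1) the decisive elements have first
    rows longer than n, so they are not contained in the shape and have to be recognized by their
    points. Since n rows of length n act as a translation, up to the exchange of s_0 and s_1, the
    letters to delete depend on the number of rows modulo n; hence the case distinction in these
    families. *)

Lemma cat_eq_cons_split (T : Type) (a u a1 a2 : seq T) (j : T) :
  a ++ u = a1 ++ j :: a2 ->
  (exists a3, a = a1 ++ j :: a3 /\ a2 = a3 ++ u) \/
  (exists u1, a1 = a ++ u1 /\ u = u1 ++ j :: a2).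
Proof.
elim: a a1 => [|x a IH] [|y a1] /=.
- by move=> ->; right; exists [::].
- by move=> ->; right; exists (y :: a1).
- by case=> <- <-; left; exists a.
- case=> <- /IH[[a3 [-> ->]]|[u1 [-> ->]]]; first by left; exists a3.
  by right; exists u1.
Qed.

(** * Exchange, Bruhat order and minimal coset representatives *)

Section CoxeterGroups.
Local Open Scope group_scope.
Variables (I : choiceType) (m : coxmat I).
Implicit Types (u v a : seq I) (w x y t : coxeter m) (i j : I).
Local Notation s := (gen m).
Local Notation wp := (wprod m).

Lemma wprod_nil : wp [::] = 1.
Proof. by rewrite /wprod big_nil. Qed.

Lemma wprod_cons i u : wp (i :: u) = s i * wp u.
Proof. by rewrite /wprod big_cons. Qed.

Lemma wprod_cat u v : wp (u ++ v) = wp u * wp v.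
Proof. by rewrite /wprod big_cat. Qed.

Lemma wprod1 i : wp [:: i] = s i.
Proof. by rewrite wprodE. Qed.

Lemma wprod_rcons u i : wp (rcons u i) = wp u * s i.
Proof. by rewrite -cats1 wprod_cat wprod1. Qed.

Lemma wprod_eqP u v : wp u = wp v <-> cox_eq m u v.
Proof. by rewrite !wprodE; apply: cox_classP. Qed.

Lemma gen_sq i : s i * s i = 1.
Proof.
rewrite -!wprod1 -wprod_cat -wprod_nil; apply/wprod_eqP.
by have := cox_eq_rel m [::] [::] i i; rewrite cox_diag.
Qed.

Lemma genV i : (s i)^-1 = s i.
Proof. by apply: mulg1_eq; apply: gen_sq. Qed.

Lemma mulg_genK w i : w * s i * s i = w.
Proof. by rewrite -mulgA gen_sq mulg1. Qed.

Lemma gen_mulgK w i : s i * (s i * w) = w.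
Proof. by rewrite mulgA gen_sq mul1g. Qed.

Lemma wprod_rev u : wp (rev u) = (wp u)^-1.
Proof.
elim: u => [|i u IH]; first by rewrite wprod_nil invg1.
by rewrite rev_cons wprod_rcons IH wprod_cons invgM genV.
Qed.

Lemma wprod_relator i j : wp (flatten (nseq (m i j) [:: i; j])) = 1.
Proof.
rewrite -wprod_nil; apply/wprod_eqP.
by have := cox_eq_rel m [::] [::] i j; rewrite cats0.
Qed.

Lemma size_alternate k (T : Type) (p q : T) :
  size (flatten (nseq k [:: p; q])) = k.*2.
Proof. by elim: k => //= k ->; rewrite doubleS. Qed.

Lemma odd_size_wprod u v : wp u = wp v -> odd (size u) = odd (size v).
Proof.
move/wprod_eqP; elim=> // [x y z _ -> _ -> //|x y i j].
by rewrite !size_cat size_alternate !oddD odd_double.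
Qed.

Lemma ell_wprod u : (ell (wp u) <= size u)%N.
Proof.
rewrite /ell; case: ex_minnP => k _; apply.
by apply/asboolP; exists u.
Qed.

Lemma reduced_word w : exists u, wp u = w /\ size u = ell w.
Proof.
rewrite /ell; case: ex_minnP => k /asboolP[u su uw] _.
by exists u.
Qed.

Lemma odd_ell u : odd (ell (wp u)) = odd (size u).
Proof. by have [v [/odd_size_wprod <- <-]] := reduced_word (wp u). Qed.

Lemma ell1 : ell (1 : coxeter m) = 0%N.
Proof. by apply/eqP; rewrite -leqn0 -wprod_nil ell_wprod. Qed.

Lemma ell_eq0 w : ell w = 0%N -> w = 1.
Proof.
by have [[|i u] [<- <-]] := reduced_word w; rewrite ?wprod_nil.
Qed.

Lemma ellM x y : (ell (x * y) <= ell x + ell y)%N.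
Proof.
have [u [<- <-]] := reduced_word x; have [v [<- <-]] := reduced_word y.
by rewrite -wprod_cat -size_cat ell_wprod.
Qed.

Lemma ell_inv w : ell w^-1 = ell w.
Proof.
have le x : (ell x^-1 <= ell x)%N.
  by have [u [<- <-]] := reduced_word x; rewrite -wprod_rev -size_rev ell_wprod.
by apply/eqP; rewrite eqn_leq le /= -{1}(invgK w) le.
Qed.

Lemma ell_gen i : ell (s i) = 1%N.
Proof.
have := odd_ell [:: i]; have := ell_wprod [:: i]; rewrite wprod1 /=.
by case: (ell _) => [|[]].
Qed.

Lemma odd_ellM x y : odd (ell (x * y)) = odd (ell x) (+) odd (ell y).
Proof.
have [u [<- _]] := reduced_word x; have [v [<- _]] := reduced_word y.
by rewrite -wprod_cat !odd_ell size_cat oddD.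
Qed.

Lemma odd_reflection t : reflection t -> odd (ell t).
Proof.
case=> x [i ->]; rewrite !odd_ellM ell_inv ell_gen.
by case: (odd _).
Qed.

Lemma reflectionV t : reflection t -> t^-1 = t.
Proof. by case=> x [i ->]; rewrite !invgM invgK genV !mulgA. Qed.

Lemma reflection_sq t : reflection t -> t * t = 1.
Proof. by move=> Ht; rewrite -{1}(reflectionV Ht) mulVg. Qed.

Lemma reflection_gen i : reflection (s i).
Proof. by exists 1, i; rewrite mul1g invg1 mulg1. Qed.

Lemma ell_neq_reflection w t : reflection t -> ell (w * t) != ell w.
Proof.
move=> /odd_reflection Ht; apply/eqP => /(congr1 odd).
by rewrite odd_ellM Ht; case: (odd _).
Qed.

Lemma ell_mul_gen w i :
  ell (w * s i) = (ell w).+1 \/ ell w = (ell (w * s i)).+1.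
Proof.
have := ell_neq_reflection w (reflection_gen i).
have := ellM w (s i); have := ellM (w * s i) (s i).
by rewrite mulg_genK ell_gen; lia.
Qed.

Lemma ell_gen_mul i w :
  ell (s i * w) = (ell w).+1 \/ ell w = (ell (s i * w)).+1.
Proof.
by have := ell_mul_gen w^-1 i; rewrite -(ell_inv (s i * w)) invgM genV ell_inv.
Qed.

(* The entry of [rrefl u] at position p is the reflection t such that [wp u * t]
   is the product of [u] with its letter p deleted. *)
Fixpoint rrefl u : seq (coxeter m) :=
  if u is i :: v then (wp v)^-1 * s i * wp v :: rrefl v else [::].

Lemma rrefl_cat u v :
  rrefl (u ++ v) = [seq (wp v)^-1 * t * wp v | t <- rrefl u] ++ rrefl v.
Proof.
elim: u => //= i u ->; rewrite wprod_cat invgM; congr (_ :: _).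
by rewrite !mulgA.
Qed.

Lemma rrefl_delete u t : t \in rrefl u ->
  exists u1 i u2, u = u1 ++ i :: u2 /\ wp u * t = wp (u1 ++ u2).
Proof.
elim: u => //= i u IH; rewrite inE => /orP[/eqP->|/IH[u1 [j [u2 [-> E]]]]].
  exists [::], i, u; split=> //=.
  by rewrite wprod_cons !mulgA mulgK gen_sq mul1g.
exists (i :: u1), j, u2; split=> //=.
by rewrite wprod_cons -mulgA E wprod_cons.
Qed.

Definition rodd u t := odd (count_mem t (rrefl u)).

Lemma rodd_cat u v t : rodd (u ++ v) t = rodd u (wp v * t * (wp v)^-1) (+) rodd v t.
Proof.
rewrite /rodd rrefl_cat count_cat oddD; congr (odd _ (+) _).
rewrite count_map; apply: eq_count => r /=.
apply/eqP/eqP => [<-|->]; first by rewrite !mulgA mulgK mulgV mul1g.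
by rewrite !mulgA mulgVK mulVg mul1g.
Qed.

Lemma expg_cycle_add (c : coxeter m) k q : c ^+ k = 1 -> c ^+ (k + q) = c ^+ q.
Proof. by move=> ck; rewrite expgnDr ck mul1g. Qed.

Lemma wprod_alternate i j k : wp (flatten (nseq k [:: i; j])) = (s i * s j) ^+ k.
Proof.
elim: k => [|k IH] /=; first by rewrite wprod_nil.
by rewrite !wprod_cons IH expgS !mulgA.
Qed.

Lemma gen_dihedral i j k :
  ((s i * s j) ^+ k)^-1 * s j * (s i * s j) ^+ k = s j * (s i * s j) ^+ k.*2.
Proof.
elim: k => [|k IH]; first by rewrite !expg0 invg1 mul1g.
rewrite expgSr invgM doubleS -!mulgA (mulgA _ (s j)) (mulgA (_ * s j)) IH.
rewrite invgM !genV -(addn2 k.*2) (addnC _ 2) expgnDr expg2 !mulgA.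
have := expgSr (s i * s j) k.*2; rewrite expgS => E.
by rewrite -!mulgA !(mulgA (s i)) -E !mulgA.
Qed.

Lemma rrefl_alternate i j k :
  rrefl (flatten (nseq k [:: i; j])) =
  rev (mkseq (fun q => s j * (s i * s j) ^+ q) k.*2).
Proof.
elim: k => //= k IH; rewrite doubleS !mkseqS !rev_rcons -IH.
rewrite wprod_cons wprod_alternate invgM genV; congr [:: _, _ & _].
  have E := gen_dihedral i j k.
  transitivity (((s i * s j) ^+ k)^-1 * s j * (s i * s j) ^+ k
                * ((s i * s j) ^+ k)^-1 * (s i * s j * (s i * s j) ^+ k)).
    by rewrite mulgK !mulgA.
  by rewrite E -expgS expgSr !mulgA mulgVK expgSr !mulgA.
exact: gen_dihedral.
Qed.

(** The reflections of the relator are [s j * (s i * s j) ^+ q] for q below 2m, with m = [m i j].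
    This list has period m, so each reflection occurs an even number of times. It makes the parity
    [rodd] a function of the group element. *)
Lemma rodd_relator i j t : rodd (flatten (nseq (m i j) [:: i; j])) t = false.
Proof.
have c1 := wprod_relator i j; rewrite wprod_alternate in c1.
rewrite /rodd rrefl_alternate count_rev -addnn /mkseq iotaD map_cat count_cat.
rewrite add0n -{2}(addn0 (m i j)) iotaDl -map_comp.
rewrite (@eq_map _ _ (_ \o _) (fun q => s j * (s i * s j) ^+ q)) ?addnn ?odd_double //.
by move=> q /=; rewrite expg_cycle_add.
Qed.

Lemma rodd_wprod u v t : wp u = wp v -> rodd u t = rodd v t.
Proof.
move/wprod_eqP => uv; elim: uv t => // [x y z _ IH _ IH' t|x y i j t].
  by rewrite IH.
rewrite !rodd_cat !wprod_cat wprod_relator mul1g.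
by rewrite rodd_relator addFb.
Qed.

(** The middle letter contributes one occurrence of the reflection. The contributions of [u] and of
    [rev u] have equal parity, because [rev u ++ u] represents 1. *)
Lemma rodd_self u i : 
  rodd (u ++ i :: rev u) (wp u * s i * (wp u)^-1).
Proof.
set t := _ * _ * _.
rewrite -cat1s !rodd_cat wprod_cat wprod_rev wprod1 invgM invgK genV.
have -> : s i * (wp u)^-1 * t * (wp u * s i) = s i.
  by rewrite /t !mulgA mulgVK mulgVK -mulgA gen_sq mulg1.
have -> : (wp u)^-1 * t * wp u = s i by rewrite /t !mulgA mulVg mul1g mulgVK.
have : rodd (rev u ++ u) (s i) = false.
  by rewrite (@rodd_wprod _ [::]) // wprod_cat wprod_rev mulVg wprod_nil.
have -> : rodd [:: i] (s i) by rewrite /rodd /= wprod_nil invg1 mul1g mulg1 eqxx.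
rewrite rodd_cat -/t.
by case: rodd; case: rodd.
Qed.

Lemma rodd_reflection u t : reflection t ->
  forall v, wp v = wp u * t -> rodd v t = ~~ rodd u t.
Proof.
case=> x [i Et] v Ev; have [a [Ea _]] := reduced_word x.
rewrite (@rodd_wprod _ (u ++ (a ++ i :: rev a))).
  rewrite rodd_cat wprod_cat wprod_cons wprod_rev mulgA Ea -Et mulgK.
  by rewrite Et -Ea rodd_self addbT.
by rewrite Ev Et wprod_cat wprod_cat wprod_cons wprod_rev Ea !mulgA.
Qed.

Lemma ell_delete u t : t \in rrefl u -> (ell (wp u * t) < size u)%N.
Proof.
case/rrefl_delete=> u1 [i [u2 [-> ->]]].
by apply: leq_ltn_trans (ell_wprod _) _; rewrite !size_cat /= addnS.
Qed.

Lemma rodd_mem u t : rodd u t -> t \in rrefl u.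
Proof. by rewrite /rodd -has_pred1 has_count; case: count. Qed.

(** Multiplication by t changes the parity of t among the reflections of a word. If t were even in
    [u], it would be odd in a reduced word of [wp u * t], and deleting a letter there would make
    [wp u] the shorter of the two elements. *)
Lemma strong_exchange u t : reflection t -> (ell (wp u * t) < ell (wp u))%N ->
  exists u1 i u2, u = u1 ++ i :: u2 /\ wp u * t = wp (u1 ++ u2).
Proof.
move=> Ht lt; apply: rrefl_delete; apply: rodd_mem; apply: contraLR lt => Nt.
have [v [Ev sv]] := reduced_word (wp u * t).
have := rodd_reflection Ht Ev; rewrite Nt => /rodd_mem/ell_delete.
by rewrite Ev -mulgA reflection_sq // mulg1 sv -leqNgt => /ltnW.
Qed.

Lemma exchange u i : (ell (wp u * s i) < ell (wp u))%N ->
  exists u1 j u2, u = u1 ++ j :: u2 /\ wp u * s i = wp (u1 ++ u2).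
Proof. exact: strong_exchange (reflection_gen i). Qed.

Lemma reflection_conj x t : reflection t -> reflection (x * t * x^-1).
Proof. by case=> y [i ->]; exists (x * y), i; rewrite invgM !mulgA. Qed.

Lemma bruhat_trans x y w : bruhat x y -> bruhat y w -> bruhat x w.
Proof. by move=> xy; elim=> // z t _ IH Ht lt; apply: bruhat_step. Qed.

Lemma bruhat_subword (v w : coxeter m) : bruhat v w ->
  forall u, wp u = w -> exists2 u', subseq u' u & wp u' = v.
Proof.
elim=> [u <-|{}w t _ IH Ht lt u Eu]; first by exists u.
have [|u1 [i [u2 [Eu' E]]]] := @strong_exchange u t Ht.
  by rewrite Eu -mulgA reflection_sq // mulg1.
rewrite Eu -mulgA reflection_sq // mulg1 in E.
have [u' su <-] := IH _ (esym E); exists u' => //.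
rewrite Eu'; apply: subseq_trans su _; apply: cat_subseq => //.
exact: subseq_cons.
Qed.

Lemma bruhat_gen w i : (ell w < ell (w * s i))%N -> bruhat w (w * s i).
Proof. by apply: bruhat_step; [apply: bruhat_refl | apply: reflection_gen]. Qed.

Lemma bruhat_gen_descent w i : (ell (w * s i) < ell w)%N -> bruhat (w * s i) w.
Proof. by move=> lt; rewrite -{2}(mulg_genK w i); apply: bruhat_gen; rewrite mulg_genK. Qed.

(** One step of the lifting property. If [w * s i] is longer than w and t is not [s i], then
    [w * t * s i] is [w * s i] times the reflection [s i * t * s i]. This cannot shorten: exchange
    in a reduced word of [w * s i] would delete the last letter, forcing t to be [s i], or an
    earlier one, leaving too short a word for [w * t]. *)
Lemma bruhat_mul_gen_step w t i : reflection t -> (ell w < ell (w * t))%N ->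
  bruhat (w * s i) (w * t) \/ bruhat (w * s i) (w * t * s i).
Proof.
move=> Ht lt.
have [ti|ti] := eqVneq t (s i); first by left; rewrite ti; apply: bruhat_refl.
have [E|E] := ell_mul_gen w i; last first.
  left; apply: (@bruhat_trans _ w); last by apply: bruhat_step => //; apply: bruhat_refl.
  by apply: bruhat_gen_descent; rewrite E.
have Ht' : reflection (s i * t * s i) by rewrite -{2}genV; apply: reflection_conj.
right; have -> : w * t * s i = w * s i * (s i * t * s i).
  by rewrite !mulgA mulg_genK.
apply: bruhat_step => //; first exact: bruhat_refl.
have := ell_neq_reflection (w * s i) Ht'; rewrite neq_ltn => /orP[|//].
have [u [Eu su]] := reduced_word w.
rewrite -{1 2 4}Eu -wprod_rcons => /(strong_exchange Ht')[u1 [j [u2 [Eur]]]].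
rewrite wprod_rcons !mulgA mulg_genK Eu.
case/lastP: u2 Eur => [|u2 k] Eur Ew.
  move: Eur; rewrite cats1 => /rcons_inj[Eu1 _].
  by move: Ew; rewrite cats0 -Eu1 Eu -{2}(mulg_genK w i) => /mulIg/mulgI/eqP; rewrite (negPf ti).
move: Eur; rewrite -rcons_cons -rcons_cat => /rcons_inj[Eu1 Ek].
move: Ew; rewrite -rcons_cat wprod_rcons -Ek => /mulIg Ew.
have := ell_wprod (u1 ++ u2); rewrite -Ew => le.
have := leq_trans lt le; rewrite -su Eu1 !size_cat /=; lia.
Qed.

Lemma bruhat_mul_gen (v w : coxeter m) i : bruhat v w ->
  bruhat (v * s i) w \/ bruhat (v * s i) (w * s i).
Proof.
elim=> [|{}w t vw IH Ht lt]; first by right; apply: bruhat_refl.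
case: IH => H; first by left; apply: bruhat_step.
by have [H'|H'] := bruhat_mul_gen_step i Ht lt; [left|right]; apply: bruhat_trans H H'.
Qed.

Lemma reduced_cat u v : size (u ++ v) = ell (wp (u ++ v)) -> size u = ell (wp u).
Proof.
move=> E; apply/eqP; rewrite eqn_leq ell_wprod andbT.
have := ellM (wp u) (wp v); rewrite -wprod_cat -E size_cat.
by have := ell_wprod v; lia.
Qed.

Lemma subword_bruhat u u' : subseq u' u -> size u = ell (wp u) ->
  bruhat (wp u') (wp u).
Proof.
elim/last_ind: u u' => [|u i IH] u'.
  by rewrite subseq0 => /eqP-> _; apply: bruhat_refl.
move=> su red; have redu : size u = ell (wp u).
  by apply: (@reduced_cat u [:: i]); rewrite cats1.
have up : bruhat (wp u) (wp (rcons u i)).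
  rewrite wprod_rcons; apply: bruhat_gen.
  by rewrite -wprod_rcons -red -redu size_rcons.
case/lastP: u' su => [|u' j]; first by move=> _; apply: bruhat_trans up; apply: IH => //; apply: sub0seq.
rewrite -subseq_rev !rev_rcons /=; case: eqP => [->|_] su.
  rewrite !wprod_rcons; have := IH u'; rewrite -subseq_rev => /(_ su redu) /(bruhat_mul_gen i).
  by case=> // H; apply: bruhat_trans H _; rewrite -wprod_rcons.
apply: bruhat_trans up; apply: IH => //.
by rewrite -subseq_rev rev_rcons.
Qed.

Implicit Types J K : pred I.

Lemma parabolic_wprod J u : all J u -> parabolic J (wp u).
Proof. by exists u. Qed.

Lemma parabolic1 J : parabolic J (1 : coxeter m).
Proof. by exists [::]; rewrite ?wprod_nil. Qed.

Lemma parabolicM J x y : parabolic J x -> parabolic J y -> parabolic J (x * y).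
Proof.
by case=> u Ju <- [v Jv <-]; exists (u ++ v); rewrite ?all_cat ?Ju // wprod_cat.
Qed.

Lemma parabolicV J x : parabolic J x -> parabolic J x^-1.
Proof. by case=> u Ju <-; exists (rev u); rewrite ?all_rev // wprod_rev. Qed.

Lemma parabolic_gen J i : J i -> parabolic J (s i).
Proof. by move=> Ji; exists [:: i]; rewrite /= ?Ji // wprod1. Qed.

Lemma min_rep1 J : min_rep J (1 : coxeter m).
Proof. by move=> x _; rewrite ell1. Qed.

(** The word u is a shortest J-word of x; that it is reduced in the whole group is a consequence. If
    lengths failed to add up, exchange would delete a letter of the word of w, against minimality of
    w in its coset, or a letter of u, against the choice of u. *)
Lemma min_rep_parabolic_word J w x : min_rep J w -> parabolic J x ->
  exists u, [/\ all J u, wp u = x & ell (w * x) = (ell w + size u)%N].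
Proof.
move=> minw [u0 Ju0 <-].
have ex : exists k, `[< exists2 u, all J u /\ size u = k & wp u = wp u0 >].
  by exists (size u0); apply/asboolP; exists u0.
case: (ex_minnP ex) => k /asboolP[u [Ju su] Eu] mink; exists u; split=> //.
have {mink} minu v : all J v -> wp v = wp u -> (size u <= size v)%N.
  by move=> Jv Ev; rewrite su; apply: mink; apply/asboolP; exists v; rewrite ?Ev.
rewrite -Eu {ex k su Eu Ju0 u0}.
have [a [Ea sa]] := reduced_word w.
elim/last_ind: u Ju minu => [|u i IH]; first by rewrite wprod_nil mulg1 addn0.
rewrite all_rcons => /andP[Ji Ju] minu.
have {}IH : ell (w * wp u) = (ell w + size u)%N.
  apply: IH => // v Jv Ev; have := minu (rcons v i).
  by rewrite all_rcons Ji Jv !wprod_rcons Ev !size_rcons ltnS; apply.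
rewrite wprod_rcons mulgA size_rcons addnS -IH.
have [//|E] := ell_mul_gen (w * wp u) i.
have [|a1 [j [a2 [Eau Ew]]]] := @exchange (a ++ u) i.
  by rewrite wprod_cat Ea E.
exfalso; move: Ew; rewrite wprod_cat Ea.
have [[a3 [Ea2 ->]]|[u1 [-> Eu]]] := cat_eq_cons_split Eau; last first.
  rewrite -catA wprod_cat Ea -mulgA => /mulgI E1.
  have := minu (u1 ++ a2); move: Ju; rewrite Eu !all_cat /= => /and3P[-> _ ->].
  rewrite wprod_rcons -Eu E1 => /(_ isT erefl).
  by rewrite Eu size_rcons !size_cat /=; lia.
rewrite catA wprod_cat => E1.
have Jy : parabolic J (wp u * s i * (wp u)^-1).
  apply: parabolicM; last exact/parabolicV/parabolic_wprod.
  by apply: parabolicM; [apply: parabolic_wprod | apply: parabolic_gen].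
have := minw _ Jy; rewrite !mulgA E1 mulgK -sa leqNgt => /negP; apply.
by apply: leq_ltn_trans (ell_wprod _) _; rewrite Ea2 !size_cat /= addnS.
Qed.

Lemma parabolic_reduced J x : parabolic J x ->
  exists u, [/\ all J u, wp u = x & size u = ell x].
Proof.
case/(min_rep_parabolic_word (@min_rep1 J)) => u [Ju Eu E].
by exists u; split=> //; rewrite mul1g ell1 in E.
Qed.

Lemma ell_min_repM J w x : min_rep J w -> parabolic J x ->
  ell (w * x) = (ell w + ell x)%N.
Proof.
move=> minw Jx; have [u [Ju Eu E]] := min_rep_parabolic_word minw Jx.
apply/eqP; rewrite eqn_leq ellM E leq_add2l /=.
by rewrite -Eu ell_wprod.
Qed.

Lemma min_rep_factor J w : exists (u x : coxeter m),
  [/\ min_rep J u, parabolic J x & w = u * x].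
Proof.
have ex : exists k, `[< exists2 x, parabolic J x & ell (w * x) = k >].
  by exists (ell (w * 1)); apply/asboolP; exists 1 => //; apply: parabolic1.
case: (ex_minnP ex) => k /asboolP[x Jx <-] mink.
exists (w * x), x^-1; split; [|exact: parabolicV|by rewrite mulgK].
move=> y Jy; apply: mink; apply/asboolP; exists (x * y); first exact: parabolicM.
by rewrite mulgA.
Qed.

Lemma min_rep_factor_uniq J (u u' x x' : coxeter m) :
  min_rep J u -> min_rep J u' -> parabolic J x -> parabolic J x' ->
  u * x = u' * x' -> u = u' /\ x = x'.
Proof.
move=> m1 m2 Jx Jx' E.
have Jy : parabolic J (x * x'^-1) by apply: parabolicM => //; apply: parabolicV.
have E1 : u' = u * (x * x'^-1) by rewrite mulgA E mulgK.
have E2 := ell_min_repM m1 Jy; rewrite -E1 in E2.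
have := m2 _ (parabolicV Jy); rewrite E1 mulgK -E1 E2 => le.
have /ell_eq0 y1 : ell (x * x'^-1) = 0%N by lia.
have Ex : x = x' by rewrite -[x](mulgVK x') y1 mul1g.
by split=> //; rewrite E1 y1 mulg1.
Qed.

Lemma min_rep_ascent J w i : min_rep J w -> J i -> (ell w < ell (w * s i))%N.
Proof.
by move=> mw Ji; rewrite (ell_min_repM mw (parabolic_gen Ji)) ell_gen addn1.
Qed.

Lemma min_rep_of_ascents J w :
  (forall i, J i -> (ell w < ell (w * s i))%N) -> min_rep J w.
Proof.
move=> up; have [u [x [mu Jx Ew]]] := min_rep_factor J w.
have [a [Ja Ea sa]] := parabolic_reduced Jx.
case/lastP: a Ja Ea sa => [|a i] Ja Ea sa; first by rewrite Ew -Ea wprod_nil mulg1.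
move: Ja; rewrite all_rcons => /andP[Ji Ja].
have := up i Ji; rewrite {1}Ew (ell_min_repM mu Jx) Ew -Ea wprod_rcons mulgA mulg_genK.
rewrite (ell_min_repM mu (parabolic_wprod Ja)).
by rewrite -wprod_rcons Ea -sa size_rcons; have := ell_wprod a; lia.
Qed.

Lemma min_rep_right_factor J x y : min_rep J (x * y) ->
  ell (x * y) = (ell x + ell y)%N -> min_rep J y.
Proof.
move=> mxy E z Jz; have := mxy z Jz; rewrite -mulgA E.
by move=> le; have := leq_trans le (ellM x (y * z)); rewrite leq_add2l.
Qed.

Lemma bruhat_coset J w x : min_rep J w -> parabolic J x -> bruhat w (w * x).
Proof.
move=> mw Jx; have [a [Ea sa]] := reduced_word w.
have [b [Eb sb]] := reduced_word x.
rewrite -Ea -Eb -wprod_cat; apply: subword_bruhat; first exact: prefix_subseq.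
by rewrite size_cat wprod_cat Ea Eb (ell_min_repM mw Jx) sa sb.
Qed.

Lemma min_repW J K w : subpred K J -> min_rep J w -> min_rep K w.
Proof.
by move=> KJ mw; apply: min_rep_of_ascents => i /KJ; apply: min_rep_ascent.
Qed.

(** Each letter of a reduced word is a generator below the element in Bruhat order, hence a subword
    product of the K-word [a], hence an element of length one of W_K. *)
Lemma reduced_word_support K u : injective s -> parabolic K (wp u) ->
  size u = ell (wp u) -> all K u.
Proof.
move=> inj [a Ka Ea] red; apply/allP => i iu.
have [a' sa' Ea'] : exists2 a', subseq a' a & wp a' = s i.
  have sub : bruhat (wp [:: i]) (wp u) by apply: subword_bruhat => //; rewrite sub1seq.
  by have [a' ? E] := bruhat_subword sub Ea; exists a'; rewrite // E wprod1.
have Ka' : parabolic K (s i).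
  by rewrite -Ea'; apply: parabolic_wprod; apply/allP => k /(mem_subseq sa')/(allP Ka).
have [[|k [|l b]] [Kb Eb sb]] := parabolic_reduced Ka'; rewrite ell_gen in sb => //.
by move: Kb; rewrite /= andbT -(inj k i) // -Eb wprod1.
Qed.

(* If [gen a] moves the coset of w upwards, then exchange leaves no room for
   [gen a * w] to have a descent in J, unless [gen a * w = w * gen i]. *)
Lemma min_rep_gen_mul J w (a : I) : min_rep J w -> (ell w < ell (s a * w))%N ->
  (forall i, J i -> s a * w <> w * s i) -> min_rep J (s a * w).
Proof.
move=> mw up ne; apply: min_rep_of_ascents => i Ji; rewrite ltnNge; apply/negP => le.
have [u [Eu su]] := reduced_word w.
have := @exchange (a :: u) i; rewrite wprod_cons Eu.
case=> [|[|b u1] [j [u2 /= [[E1 E2] E]]]].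
- by have [E|->//] := ell_mul_gen (s a * w) i; rewrite E ltnn in le.
- by apply: (ne i Ji); rewrite -(mulg_genK (s a * w) i) E -E2 Eu.
move: E; rewrite -E1 wprod_cons -mulgA => /mulgI E.
have := min_rep_ascent mw Ji; rewrite E -su E2 !size_cat /=.
by have := ell_wprod (u1 ++ u2); rewrite size_cat; lia.
Qed.

End CoxeterGroups.

(** * The numbers game *)

Section NumbersGame.
Import Order.TTheory GRing.Theory Num.Theory.
Local Open Scope group_scope.
Variables (I : choiceType) (m : coxmat I).
Variables (X : Type) (act : I -> X -> X) (f : I -> X -> int) (c : I -> I -> int).
Hypothesis f_act : forall k i x, f k (act i x) = (f k x + c k i * f i x)%R.
Hypothesis c_diag : forall i, c i i = (- 2%:Z)%R.
Hypothesis c_bond : forall i j, i != j ->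
  [\/ [/\ m i j = 2, c i j = 0%R & c j i = 0%R],
      [/\ m i j = 3, c i j = 1%R & c j i = 1%R] |
      [/\ m i j = 4, (0 < c i j)%R, (0 < c j i)%R & (c i j * c j i = 2%:Z)%R]].
Hypothesis act_relator : forall i j x, iter (m i j) (act i \o act j) x = x.
Implicit Types (u v a : seq I) (w : coxeter m) (x : X) (i j : I).
Local Notation s := (gen m).
Local Notation wp := (wprod m).

Lemma foldr_act_wprod u v x : wp u = wp v -> foldr act x u = foldr act x v.
Proof.
move/wprod_eqP => E; elim: E x => // [a b d _ IH1 _ IH2 x|a b i j x].
  by rewrite IH1.
rewrite !foldr_cat; congr foldr; rewrite -[RHS](act_relator i j).
by elim: (m i j) => //= k ->.
Qed.

Definition gact w x := foldr act x (repr w).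

Lemma gact_wprod u x : gact (wp u) x = foldr act x u.
Proof. by apply: foldr_act_wprod; rewrite wprodE cox_class_repr. Qed.

Lemma gactM (w w' : coxeter m) x : gact (w * w') x = gact w (gact w' x).
Proof.
have [u [<- _]] := reduced_word w; have [v [<- _]] := reduced_word w'.
by rewrite -wprod_cat !gact_wprod foldr_cat.
Qed.

Lemma gact1 x : gact 1 x = x.
Proof. by rewrite -(wprod_nil m) gact_wprod. Qed.

Lemma gact_gen i x : gact (s i) x = act i x.
Proof. by rewrite -wprod1 gact_wprod. Qed.

Lemma wprod_cat_eq1 u v : wp (u ++ v) = 1 -> wp u = wp (rev v).
Proof. by rewrite wprod_cat wprod_rev => /eqP; rewrite mulg_eq1 => /eqP. Qed.

Section Positivity.
Variable P : int -> Prop.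
Hypothesis P_add : forall y z, P y -> P z -> P (y + z)%R.

Lemma P_muladd (k y z : int) : P y -> P z -> (0 <= k)%R -> P (y + k * z)%R.
Proof.
case: k => // k Py Pz _; elim: k => [|k IH]; first by rewrite mul0r addr0.
have -> : (y + k.+1%:Z * z = y + k%:Z * z + z)%R by lia.
exact: P_add.
Qed.

(* The rank two case: a is an alternating word of length less than [m i j] that
   starts with j, so only finitely many linear forms have to be inspected. *)
Lemma dihedral_positive i j a x : i != j -> all (pred2 i j) a ->
  size a = ell (wp a) -> (ell (wp a) < ell (s i * wp a))%N ->
  P (f i x) -> P (f j x) -> P (f i (foldr act x a)).
Proof.
move=> ij Ja red up Pi Pj.
have short b : wp b = s i * wp a -> (size b < size a)%N -> False.
  by move=> E lt; have := ell_wprod m b; rewrite E; lia.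
have short2 b : wp b = wp a -> (size b < size a)%N -> False.
  by move=> E lt; have := ell_wprod m b; rewrite E; lia.
have cancel k b : s k * (s k * b) = b by apply: gen_mulgK.
have rel := wprod_relator m i j.
case: a Ja red up short short2 => [|k a] //= /andP[+ Ja] _ _ short short2.
have [Ek|_] := eqVneq k i.
  by move=> _; case: (short a) => //; rewrite Ek wprod_cons cancel.
rewrite /= => /eqP Ek; subst k.
case: a Ja short short2 => [|k a] /= => [_ _ _|/andP[+ Ja] short short2].
  rewrite f_act; apply: P_muladd => //.
  by case: (c_bond ij) => [[_ -> _]|[_ -> _]|[_ /ltW]].
have [Ek|_] /= := eqVneq k i; last first.
  by move=> /eqP Ek; case: (short2 a); rewrite ?Ek ?wprod_cons ?cancel.
move=> _; subst k.
have hyp3 : f i (act j (act i x)) = ((c i j * c j i - 1) * f i x + c i j * f j x)%R.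
  by rewrite !f_act !c_diag; ring.
case: (c_bond ij) => [[Em cij cji]|[Em cij cji]|[Em cij cji cc]]; rewrite Em /= in rel.
- case: (short (j :: a)) => //=; rewrite !wprod_cons.
  have := @wprod_cat_eq1 [:: i; j; i] [:: j] rel.
  rewrite !wprod_cons wprod_nil !mulg1 /= => E.
  by rewrite -{1}E !mulgA.
- case: a Ja short short2 => [|k a] /= => [_ _ _|/andP[+ Ja] short short2].
    by rewrite hyp3 cij cji; have -> : ((1 * 1 - 1) * f i x + 1 * f j x = f j x)%R by ring.
  have [Ek|_] /= := eqVneq k i.
    by move=> _; case: (short2 (j :: a)) => //=; rewrite Ek !wprod_cons cancel.
  move=> /eqP Ek; subst k; case: (short [:: j, i & a]) => //=; rewrite !wprod_cons.
  have := @wprod_cat_eq1 [:: i; j; i; j] [:: i; j] rel.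
  rewrite /= !wprod_cons wprod_nil !mulg1 => E.
  by rewrite mulgA -E !mulgA.
have hyp4 : f i (act j (act i (act j x))) = f i x.
  rewrite !f_act !c_diag.
  transitivity ((c i j * c j i - 1) * f i x + (c i j * c j i - 2%:Z) * c i j * f j x)%R; first by ring.
  by rewrite cc; ring.
case: a Ja short short2 => [|k a] /= => [_ _ _|/andP[+ Ja] short short2].
  rewrite hyp3 cc; have -> : ((2%:Z - 1) * f i x = f i x)%R by ring.
  exact: P_muladd (ltW cij).
have [Ek|_] /= := eqVneq k i.
  by move=> _; case: (short2 (j :: a)) => //=; rewrite Ek !wprod_cons cancel.
move=> /eqP Ek; subst k.
case: a Ja short short2 => [|k a] /= => [_ _ _|/andP[+ Ja] short short2].
  by rewrite hyp4.
have [Ek|_] /= := eqVneq k i; last first.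
  by move=> /eqP Ek; case: (short2 [:: j, i & a]) => //=; rewrite Ek !wprod_cons cancel.
move=> _; subst k; case: (short [:: j, i, j & a]) => //=; rewrite !wprod_cons.
have := @wprod_cat_eq1 [:: i; j; i; j; i] [:: j; i; j] rel.
rewrite /= !wprod_cons wprod_nil !mulg1 => E.
by rewrite (mulgA (s i) (s j)) mulgA -E !mulgA.
Qed.

(** Induction on length. With j the first letter of a reduced word, w is an element of the dihedral
    group of i and j times [v^-1], and both i and j lengthen [v^-1]; so the induction hypothesis
    feeds the rank two case. [P] is instantiated with nonnegativity and with strict positivity. *)
Lemma gact_positive x : (forall i, P (f i x)) ->
  forall w i, (ell w < ell (s i * w))%N -> P (f i (gact w x)).
Proof.
move=> Px w; have [k] := ubnP (ell w); elim: k w => // k IH w; rewrite ltnS => lek i up.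
have [[|j a] [Ew sw]] := reduced_word w.
  by rewrite -Ew wprod_nil gact1.
have lt : (ell (s j * w) < ell w)%N.
  by rewrite -sw -Ew wprod_cons gen_mulgK ltnS ell_wprod.
have ij : i != j by apply: contraTN up => /eqP->; rewrite -leqNgt ltnW.
have [v [y [mv Jy Evy]]] := min_rep_factor (pred2 i j) w^-1.
have [b [Jb Eb sb]] := parabolic_reduced (parabolicV Jy).
have EwE : w = wp b * v^-1 by rewrite Eb -invgM -Evy invgK.
have ellJ z : parabolic (pred2 i j) z -> ell (z * v^-1) = (ell z + ell v)%N.
  move=> Jz; rewrite -ell_inv invgM invgK (ell_min_repM mv (parabolicV Jz)).
  by rewrite ell_inv addnC.
have Pb := parabolic_wprod m Jb.
have Ji : parabolic (pred2 i j) (s i) by apply: parabolic_gen; rewrite /= eqxx.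
have Jj : parabolic (pred2 i j) (s j) by apply: parabolic_gen; rewrite /= eqxx orbT.
have ellw : ell w = (ell (wp b) + ell v)%N by rewrite EwE ellJ.
have ellsi : ell (s i * w) = (ell (s i * wp b) + ell v)%N.
  by rewrite EwE mulgA ellJ //; apply: parabolicM.
(* The dihedral factor is not trivial, since [s j] shortens w but lengthens [v^-1]. *)
have ltv : (ell v^-1 < k)%N.
  rewrite ell_inv; apply: leq_trans lek; rewrite ellw Eb -sb.
  case: b Jb Eb sb EwE {Pb ellw ellsi} => [|b1 b] Jb Eb sb EwE; last by rewrite /=; lia.
  by move: lt; rewrite EwE wprod_nil mul1g ellJ // ell_gen ell_inv; lia.
have upv r : parabolic (pred2 i j) (s r) -> (ell v^-1 < ell (s r * v^-1))%N.
  by move=> Jr; rewrite ellJ // ell_gen ell_inv.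
rewrite EwE gactM gact_wprod; apply: (@dihedral_positive i j) => //.
- by rewrite sb Eb.
- by lia.
- exact: IH ltv _ (upv _ Ji).
- exact: IH ltv _ (upv _ Jj).
Qed.

End Positivity.

Lemma gact_nonneg x : (forall i, 0 <= f i x)%R ->
  forall w i, (ell w < ell (s i * w))%N -> (0 <= f i (gact w x))%R.
Proof.
by move=> x0 w i; apply: (@gact_positive (fun z => 0 <= z)%R) => // y z; apply: addr_ge0.
Qed.

Lemma f_act_self i x : f i (act i x) = (- f i x)%R.
Proof. by rewrite f_act c_diag; ring. Qed.

Lemma gact_nonpos x : (forall i, 0 <= f i x)%R ->
  forall w i, (ell (s i * w) < ell w)%N -> (f i (gact w x) <= 0)%R.
Proof.
move=> x0 w i lt; have := @gact_nonneg x x0 (s i * w) i.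
by rewrite gen_mulgK => /(_ lt); rewrite gactM gact_gen f_act_self oppr_ge0.
Qed.

Lemma gact_regular x : (forall i, 0 < f i x)%R ->
  forall w i, (0 < f i (gact w x))%R = (ell w < ell (s i * w))%N.
Proof.
move=> x0 w i; apply/idP/idP => [|lt]; last first.
  by apply: (@gact_positive (fun z => 0 < z)%R) => // y z; apply: addr_gt0.
case: (ell_gen_mul i w) => [->//|E].
have := gact_nonpos (fun k => ltW (x0 k)) (w := w) (i := i).
by rewrite E ltnS leqnn leNgt => /(_ isT)/negPf->.
Qed.

Lemma gact_regular_right x : (forall i, 0 < f i x)%R ->
  forall w i, (0 < f i (gact w^-1%g x))%R = (ell w < ell (w * s i))%N.
Proof.
by move=> x0 w i; rewrite gact_regular // -(ell_inv (w * s i)) invgM genV ell_inv.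
Qed.

Lemma gen_inj x : (forall i, 0 < f i x)%R -> injective s.
Proof.
move=> x0 i j E; apply/eqP; apply: contraT => ij.
have := congr1 (f i) (congr1 (fun w => gact w x) E).
rewrite !gact_gen f_act_self f_act.
have cx : (0 <= c i j)%R by case: (c_bond ij) => [[_ -> _]|[_ -> _]|[_ /ltW]].
have := mulr_ge0 cx (ltW (x0 j)); have := x0 i; lia.
Qed.

Variable x0 : X.
Hypothesis x0_ge0 : forall i, (0 <= f i x0)%R.
Hypothesis act_fix : forall i x, f i x = 0%R -> act i x = x.
Let J : pred I := fun i => f i x0 == 0%R.

(** The first letter i of a reduced word of w has [f i <= 0] at [gact w x0], which is [x0]. Hence
    [f i x0 = 0], and the letter can be peeled off. *)
Lemma gact_stab w : gact w x0 = x0 -> parabolic J w.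
Proof.
have [k] := ubnP (ell w); elim: k w => // k IH w; rewrite ltnS => lek E.
have [[|i a] [Ew sw]] := reduced_word w; first by rewrite -Ew wprod_nil; apply: parabolic1.
have lt : (ell (s i * w) < ell w)%N.
  by rewrite -sw -Ew wprod_cons gen_mulgK ltnS ell_wprod.
have fi : f i x0 = 0%R.
  apply/eqP; rewrite eq_le x0_ge0 andbT -{1}E.
  exact: gact_nonpos.
rewrite -(gen_mulgK w i); apply: parabolicM.
  by apply: parabolic_gen; apply/eqP.
apply: IH; first exact: leq_trans lt lek.
by rewrite gactM E gact_gen act_fix.
Qed.

Lemma gact_min_rep_inj (w w' : coxeter m) : min_rep J w -> min_rep J w' ->
  gact w x0 = gact w' x0 -> w = w'.
Proof.
move=> mw mw' E; have Jz : parabolic J (w^-1 * w').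
  by apply: gact_stab; rewrite gactM -E -gactM mulVg gact1.
have Ew : w' = w * (w^-1 * w') by rewrite mulgA mulgV mul1g.
have := mw' _ (parabolicV Jz); rewrite {1}Ew (ell_min_repM mw Jz).
rewrite invgM invgK mulgA mulgV mul1g => le.
have /ell_eq0 z1 : ell (w^-1 * w') = 0%N by lia.
by rewrite Ew z1 mulg1.
Qed.

(** The exceptional case [s i * w = w * s k] with k in J is excluded: it would make i fix
    [gact w x0], whereas i changes the sign of the positive number [f i]. *)
Lemma min_rep_fire w i : min_rep J w -> (0 < f i (gact w x0))%R ->
  min_rep J (s i * w) /\ ell (s i * w) = (ell w).+1.
Proof.
move=> mw fi; case: (ell_gen_mul i w) => E; last first.
  have lt : (ell (s i * w) < ell w)%N by rewrite E.
  by have := gact_nonpos x0_ge0 lt; rewrite leNgt fi.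
split=> //; apply: min_rep_gen_mul => // [|k Jk Es]; first by rewrite E.
have := congr1 (fun z => f i (gact z x0)) Es.
rewrite !gactM !gact_gen (act_fix (eqP Jk)) f_act_self.
by move: fi; lia.
Qed.

Lemma min_rep_fire_conv w i : min_rep J w -> min_rep J (s i * w) ->
  (ell w < ell (s i * w))%N -> (0 < f i (gact w x0))%R.
Proof.
move=> mw msw lt; rewrite lt_neqAle (gact_nonneg x0_ge0 lt) andbT eq_sym.
apply/eqP => fi; have := @gact_min_rep_inj (s i * w) w msw mw.
rewrite gactM gact_gen act_fix // => /(_ erefl) E.
by move: lt; rewrite E ltnn.
Qed.

(** The product of a lies in the coset of w, so it is above w, and it is below [wp u] as a subword
    product. This reduces Bruhat relations to comparing points. *)
Lemma bruhat_of_point u a w : subseq a u -> size u = ell (wp u) ->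
  min_rep J w -> gact w x0 = foldr act x0 a -> bruhat w (wp u).
Proof.
move=> au red mw E; apply: (@bruhat_trans _ _ _ (wp a)); last exact: subword_bruhat.
have Ea : wp a = w * (w^-1 * wp a) by rewrite mulgA mulgV mul1g.
rewrite Ea; apply: bruhat_coset mw _; apply: gact_stab.
by rewrite gactM gact_wprod -E -gactM mulVg gact1.
Qed.

End NumbersGame.

(** The guard postpones a condition that itself contains a conditional, so inner conditions are
    decided first. *)
Ltac decide_ifs := repeat match goal with
  | |- context [if ?b then _ else _] =>
    lazymatch b with context [if _ then _ else _] => fail | _ => idtac end;
    first [ have -> : b = true by lia | have -> : b = false by lia
          | case: (boolP b) => ? ]
  end.

(** [lia] treats each [x a] as an atom, so arithmetically equal indices are made syntactically equal
    first. *)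
Ltac merge_args x := repeat match goal with
  | |- context [x ?a] => match goal with
    | |- context [x ?b] => lazymatch a with b => fail | _ => idtac end;
      have -> : x a = x b by (congr (x _); lia)
    end
  end.

(** * The affine group of type B acting on Z^n *)

Section AffineBAction.
Import Order.TTheory GRing.Theory Num.Theory.
Local Open Scope ring_scope.
Variable n : nat.
Hypothesis n_ge3 : (2 < n)%N.
Implicit Types (N : int) (x : nat -> int) (i j k : nat).

(* The affine Weyl group acts on Z^n, with coordinates numbered from 0, by the
   reflections in the walls [wall N i] of an alcove dilated by N. *)
Definition point_act N i x : nat -> int := fun k =>
  if i == 0%N then
    (if k == 0%N then N - x 1%N else if k == 1%N then N - x 0%N else x k)
  else if (i < n)%N then
    (if k == i.-1 then x i else if k == i then x i.-1 else x k)
  else (if k == n.-1 then - x n.-1 else x k).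

Definition wall N i x : int :=
  if i == 0%N then N - x 0%N - x 1%N
  else if (i < n)%N then x i.-1 - x i else x n.-1.

(** The negated Cartan integers of the diagram. The 2 sits at i = n: wall n is the last coordinate
    itself, and changing its sign moves wall n-1 by twice its value. *)
Definition wall_coef k i : int :=
  if k == i then - 2%:Z
  else let b := affB_bond n (minn k i) (maxn k i) in
    if b == 2%N then 0 else if (b == 4%N) && (i == n) then 2%:Z else 1.

Lemma wall_act N k i x : (k <= n)%N -> (i <= n)%N ->
  wall N k (point_act N i x) = wall N k x + wall_coef k i * wall N i x.
Proof.
move=> kn inn; rewrite /wall_coef /affB_bond.
have [->|ne] := eqVneq k i.
  by rewrite /wall /point_act; decide_ifs; merge_args x; lia.
have [lt|ge] := ltnP k i.
  rewrite /wall /point_act; decide_ifs; rewrite ?mul0r ?mul1r;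
  merge_args x; lia.
rewrite /wall /point_act; decide_ifs; rewrite ?mul0r ?mul1r;
  merge_args x; lia.
Qed.

Lemma point_act_out N i x k : (i <= n)%N -> (n <= k)%N -> point_act N i x k = x k.
Proof. by move=> i_n nk; rewrite /point_act; decide_ifs. Qed.

Lemma point_act_fix N i x : (i <= n)%N -> wall N i x = 0 -> point_act N i x = x.
Proof.
move=> i_n; rewrite /wall => E; apply/funext => k; move: E.
rewrite /point_act; decide_ifs; move=> E; first [done | move: E; merge_args x; lia].
Qed.

Lemma wall_inj N (x y : nat -> int) :
  (forall i, (i <= n)%N -> wall N i x = wall N i y) ->
  (forall k, (n <= k)%N -> x k = y k) -> x = y.
Proof.
move=> wxy oxy; apply/funext => k; have [|nk] := leqP n k; first exact: oxy.
have [d] := ubnP (n - k)%N; elim: d k nk => // d IH k nk lt.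
have := wxy k.+1; rewrite /wall /= => /(_ nk).
case: ltnP => [lt1|ge1 E].
  have E1 : x k.+1 = y k.+1 by apply: IH; lia.
  by rewrite E1 => /addIr.
by have -> : k = n.-1 by lia.
Qed.

Definition ord_act N (i : 'I_n.+1) x := point_act N i x.
Definition ord_wall N (i : 'I_n.+1) x := wall N i x.
Definition ord_coef (k i : 'I_n.+1) := wall_coef k i.

Lemma ord_wall_act N (k i : 'I_n.+1) x :
  ord_wall N k (ord_act N i x) = ord_wall N k x + ord_coef k i * ord_wall N i x.
Proof. by apply: wall_act; rewrite -ltnS. Qed.

Lemma ord_coef_diag (i : 'I_n.+1) : ord_coef i i = - 2%:Z.
Proof. by rewrite /ord_coef /wall_coef eqxx. Qed.

Lemma ord_coef_bond (i j : 'I_n.+1) : i != j ->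
  [\/ [/\ affB_mat n i j = 2, ord_coef i j = 0 & ord_coef j i = 0],
      [/\ affB_mat n i j = 3, ord_coef i j = 1 & ord_coef j i = 1] |
      [/\ affB_mat n i j = 4, 0 < ord_coef i j, 0 < ord_coef j i &
          ord_coef i j * ord_coef j i = 2%:Z]].
Proof.
move=> ij; have ij' : (i : nat) != j by [].
rewrite /ord_coef /wall_coef /= /affB_m (negPf ij) ?(negPf ij') ?[(j : nat) == i]eq_sym ?(negPf ij').
rewrite (minnC j) (maxnC j) /affB_bond.
case: (i : nat) (ltn_ord i) ij' => {i ij} [|i] li; case: (j : nat) (ltn_ord j) => {j} [|j] lj ij';
rewrite ?minn0 ?min0n ?maxn0 ?max0n;
decide_ifs; (try by constructor 1); (try by constructor 2); constructor 3; split => //; decide_ifs; lia.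
Qed.

Lemma ord_act_relator N (i j : 'I_n.+1) x :
  iter (affB_mat n i j) (ord_act N i \o ord_act N j) x = x.
Proof.
have out : forall k, (n <= k)%N ->
    iter (affB_mat n i j) (ord_act N i \o ord_act N j) x k = x k.
  move=> k nk; elim: (affB_mat n i j) => //= r IH.
  by rewrite /ord_act !point_act_out // -ltnS.
apply: (@wall_inj N) => // k kn.
rewrite -[k]/(nat_of_ord (Ordinal (kn : k < n.+1)%N)) -!/(ord_wall N _ _).
set k' := Ordinal _; have [<-|ij] := eqVneq i j.
  by rewrite cox_diag /= !ord_wall_act !ord_coef_diag; ring.
case: (ord_coef_bond ij) => [[-> cij cji]|[-> cij cji]|[-> cij0 cji0 cc]] /=.
- by rewrite !ord_wall_act ?cij ?cji !ord_coef_diag; ring.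
- by rewrite !ord_wall_act ?cij ?cji !ord_coef_diag; ring.
(* For the bond of order 4, D applied twice is a half turn: it negates walls i and j and adds to any
   other wall a fixed combination of these two, which the second half turn removes again. *)
pose D y := ord_act N i (ord_act N j y).
have cases : (ord_coef i j = 1 /\ ord_coef j i = 2%:Z) \/
             (ord_coef i j = 2%:Z /\ ord_coef j i = 1) by nia.
have Di y : ord_wall N i (D (D y)) = - ord_wall N i y.
  by rewrite /D !ord_wall_act !ord_coef_diag; case: cases => [[-> ->]|[-> ->]]; ring.
have Dj y : ord_wall N j (D (D y)) = - ord_wall N j y.
  by rewrite /D !ord_wall_act !ord_coef_diag; case: cases => [[-> ->]|[-> ->]]; ring.
have [A [B Dk]] : exists A B, forall y, ord_wall N k' (D (D y)) =
    ord_wall N k' y + A * ord_wall N i y + B * ord_wall N j y.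
  pose a := ord_coef k' i; pose b := ord_coef k' j.
  have [[E1 E2]|[E1 E2]] := cases.
    exists (2%:Z * a + 2%:Z * b), (2%:Z * b + a) => y.
    by rewrite /D !ord_wall_act !ord_coef_diag E1 E2 -/a -/b; ring.
  exists (2%:Z * a + b), (2%:Z * b + 2%:Z * a) => y.
  by rewrite /D !ord_wall_act !ord_coef_diag E1 E2 -/a -/b; ring.
by rewrite -!/(D _) !Dk Di Dj; ring.
Qed.

End AffineBAction.

(** * The diagram automorphism and the action of segments *)

Section Segments.
Import Order.TTheory GRing.Theory Num.Theory.
Local Open Scope ring_scope.
Implicit Types (N : int) (x y z : nat -> int) (i j k : nat) (b : bool) (c : seq nat).

(** The reflection of the first coordinate that realizes the diagram automorphism: it exchanges
    walls 0 and 1 and leaves the others unchanged. *)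
Definition flip N x : nat -> int := fun k => if k == 0%N then N - x 0%N else x k.

Lemma flipK N : involutive (flip N).
Proof. by move=> x; apply/funext => k; rewrite /flip; decide_ifs => //; merge_args x; lia. Qed.

Definition twist N b x := if b then x else flip N x.

Lemma twistK N b : involutive (twist N b).
Proof. by case: b => // x; apply: flipK. Qed.

Lemma twist_twistN N b x : twist N b (twist N (~~ b) x) = flip N x.
Proof. by case: b. Qed.

Variable n : nat.
Hypothesis n_ge3 : (2 < n)%N.

Definition relabel b k : nat := if k == 1%N then b : nat else k.

Definition bword b c : seq 'I_n.+1 := [seq inord (relabel b k) | k <- c].

Lemma segmentE b j : segment n b j = wprod (affB_mat n) (bword b (segment_word n j)).
Proof. by []. Qed.

Lemma relabel_le b k : (1 <= k <= n)%N -> (relabel b k <= n)%N.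
Proof. by rewrite /relabel; case: b => /=; decide_ifs; lia. Qed.

Lemma flip_act1 N x : point_act n N 0 x = flip N (point_act n N 1 (flip N x)).
Proof.
by apply/funext => k; rewrite /point_act /flip; decide_ifs => //; merge_args x; lia.
Qed.

Lemma flip_act N x k : (1 < k <= n)%N ->
  flip N (point_act n N k (flip N x)) = point_act n N k x.
Proof.
move=> lek; apply/funext => l; rewrite /point_act /flip; decide_ifs => //.
all: merge_args x; lia.
Qed.

Lemma relabel_act N b x k : (1 <= k <= n)%N ->
  point_act n N (relabel b k) x = twist N b (point_act n N k (twist N b x)).
Proof.
move=> lek; case: b => /=; rewrite /relabel.
  by case: eqP => // ->.
have [->|ne] := eqVneq k 1%N; first exact: flip_act1.
by rewrite flip_act //; lia.
Qed.

Lemma foldr_bword N b x c : all (fun k => 1 <= k <= n)%N c ->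
  foldr (@ord_act n N) x (bword b c) =
  twist N b (foldr (point_act n N) (twist N b x) c).
Proof.
elim: c => [|k c IH] /=; first by rewrite twistK.
move=> /andP[lek /IH->]; rewrite /ord_act inordK ?ltnS ?relabel_le //.
by rewrite relabel_act // twistK.
Qed.

Lemma wall_twist N b x k : (1 <= k <= n)%N ->
  wall n N (relabel b k) (twist N b x) = wall n N k x.
Proof.
move=> lek; case: b; rewrite /relabel /twist.
  by case: eqP => // ->.
by rewrite /wall /flip /=; decide_ifs => //; merge_args x; lia.
Qed.

Lemma wall_twistN N b x : wall n N (~~ b) (twist N b x) = wall n N 0 x.
Proof. by case: b => //=; rewrite /wall /flip /=; decide_ifs; lia. Qed.

Definition seg_letter j := (if j <= n then j else 2 * n - j)%N.

Lemma segment_wordS j : (j.+1 < 2 * n)%N ->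
  segment_word n j.+1 = seg_letter j.+1 :: segment_word n j.
Proof.
move=> lt; rewrite /segment_word /seg_letter.
have [le|gt] := leqP j.+1 n.
  have -> : iota 1 j.+1 = rcons (iota 1 j) j.+1.
    by rewrite -cats1 -[in LHS](addn1 j) iotaD add1n.
  by rewrite (ltnW le) rev_rcons.
have [le|gt'] := leqP j n.
  have -> : (j = n)%N by lia.
  by have -> : (n.+1 - n = 1)%N by lia.
have -> : (j.+1 - n = (j - n).+1)%N by lia.
by rewrite /=; have -> : ((2 * n - j.+1).+1 = 2 * n - j)%N by lia.
Qed.

Lemma size_segment_word j : (j < 2 * n)%N -> size (segment_word n j) = j.
Proof. by elim: j => // j IH lt; rewrite segment_wordS //= IH //; lia. Qed.

Lemma segment_word_bounds j : (j < 2 * n)%N ->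
  all (fun k => 1 <= k <= n)%N (segment_word n j).
Proof.
elim: j => // j IH lt; rewrite segment_wordS //= IH ?andbT; last by lia.
by rewrite /seg_letter; case: ifP; lia.
Qed.

(** The coordinate to which the segment word of length j carries the first entry. The entry travels
    right to n-1, changes sign there at step n, and travels back. *)
Definition seg_pos j := (if j < n then j else 2 * n - j.+1)%N.

Lemma segment_act N j x : (j < 2 * n)%N ->
  foldr (point_act n N) x (segment_word n j) = fun k =>
    if (k < seg_pos j)%N then x k.+1
    else if k == seg_pos j then (if (j < n)%N then x 0%N else - x 0%N) else x k.
Proof.
elim: j => [|j IH] lt.
  by apply/funext => k; rewrite /seg_pos /=; decide_ifs => //; congr x; lia.
rewrite segment_wordS //= IH; last by lia.
apply/funext => k; rewrite /point_act /seg_letter /seg_pos.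
by decide_ifs => //; merge_args x; lia.
Qed.

Lemma segment_act_rev N j z : (j < 2 * n)%N ->
  foldr (point_act n N) z (rev (segment_word n j)) = fun k =>
    if k == 0%N then (if (j < n)%N then z (seg_pos j) else - z (seg_pos j))
    else if (k <= seg_pos j)%N then z k.-1 else z k.
Proof.
elim: j z => [|j IH] z lt.
  by apply/funext => k; rewrite /seg_pos /=; decide_ifs => //; congr z; lia.
rewrite segment_wordS // rev_cons foldr_rcons IH; last by lia.
apply/funext => k; rewrite /point_act /seg_letter /seg_pos.
by decide_ifs => //; merge_args z; lia.
Qed.

Definition origin : nat -> int := fun=> 0.
(** The vertex of the alcove N = 1 that lies on every wall except b: the origin for b = false, (1,
    0, ..., 0) for b = true. *)
Definition base b := twist 1 (~~ b) origin.

Lemma segment_base b j : (j < 2 * n)%N ->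
  foldr (@ord_act n 1) (base b) (bword b (segment_word n j)) =
  twist 1 b (fun k => if k == seg_pos j then (if (j < n)%N then 1 else - 1) else 0).
Proof.
move=> lt; rewrite foldr_bword ?segment_word_bounds // twist_twistN segment_act //.
congr twist; apply/funext => k; rewrite /flip /origin /seg_pos.
by decide_ifs => //; lia.
Qed.

(** At each stage at most one of the walls 1, ..., n is positive, so the game played with these
    nodes is a chain. This is why the minimal representatives inside the parabolic are exactly the
    segments. *)
Lemma segment_wall j k : (j < 2 * n)%N -> (1 <= k <= n)%N ->
  (0 < wall n 1 k (fun k => if k == seg_pos j then (if (j < n)%N then 1 else - 1) else 0))
  = (j.+1 < 2 * n)%N && (k == seg_letter j.+1).
Proof.
by move=> lt lek; rewrite /wall /seg_pos /seg_letter; decide_ifs => //; lia.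
Qed.

End Segments.

(** * Alternating parabolic factorization and shapes *)

Section Factorization.
Import Order.TTheory GRing.Theory Num.Theory.
Local Open Scope ring_scope.
Variable n : nat.
Hypothesis n_ge3 : (2 < n)%N.
Implicit Types (b : bool) (u v w : affB n).
Local Notation s := (gen (affB_mat n)).
Local Notation wp := (wprod (affB_mat n)).
Local Notation bact N := (@gact _ (affB_mat n) _ (@ord_act n N)).

Lemma base_wall b (i : 'I_n.+1) : ord_wall 1 i (base b) = ((i : nat) == b)%:R.
Proof.
rewrite /ord_wall /base /twist /flip /origin /wall.
by case: b => /=; case: (i : nat) (ltn_ord i) => [|[|k]] //= lt; decide_ifs.
Qed.

Lemma base_wall_ge0 b (i : 'I_n.+1) : 0 <= ord_wall 1 i (base b).
Proof. by rewrite base_wall; case: (nat_of_ord i == b). Qed.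

Lemma base_stab b : (fun i : 'I_n.+1 => ord_wall 1 i (base b) == 0) =1 omit b.
Proof. by move=> i; rewrite base_wall /omit; case: (nat_of_ord i == b). Qed.

Lemma ord_act_fix N (i : 'I_n.+1) x : ord_wall N i x = 0 -> ord_act N i x = x.
Proof. by apply: point_act_fix; rewrite // -ltnS. Qed.

Lemma min_rep_base b w : min_rep (fun i : 'I_n.+1 => ord_wall 1 i (base b) == 0) w <->
  min_rep (omit b) w.
Proof. by split; apply: min_repW => i; rewrite base_stab. Qed.

(** With N = 2n all walls take the value 1 at this point; for wall 0 this is 2n - n - (n-1) = 1,
    which explains the dilation. *)
Definition tilt : nat -> int := fun k => (n - k)%N%:Z.

Lemma tilt_wall (i : 'I_n.+1) : 0 < ord_wall (2 * n)%N%:Z i tilt.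
Proof.
by rewrite /ord_wall /tilt /wall; have := ltn_ord i; decide_ifs; lia.
Qed.

Lemma ascent_wall w (i : 'I_n.+1) :
  (0 < ord_wall (2 * n)%N%:Z i (bact (2 * n)%N%:Z w^-1%g tilt)) =
  (ell w < ell (w * s i)%g)%N.
Proof.
exact: (gact_regular_right (ord_wall_act n_ge3 (2 * n)%N%:Z) (@ord_coef_diag n)
  (ord_coef_bond n_ge3) (ord_act_relator n_ge3 _) tilt_wall).
Qed.

Lemma affB_gen_inj : injective s.
Proof.
exact: (gen_inj (ord_wall_act n_ge3 (2 * n)%N%:Z) (@ord_coef_diag n)
  (ord_coef_bond n_ge3) (ord_act_relator n_ge3 _) tilt_wall).
Qed.

Lemma bact_word N (u : seq 'I_n.+1) x : bact N (wp u) x = foldr (@ord_act n N) x u.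
Proof. exact/gact_wprod/ord_act_relator. Qed.

Lemma bactM N u v x : bact N (u * v)%g x = bact N u (bact N v x).
Proof. exact/gactM/ord_act_relator. Qed.

Lemma fire b w (i : 'I_n.+1) : min_rep (omit b) w ->
  0 < ord_wall 1 i (bact 1 w (base b)) ->
  min_rep (omit b) (s i * w)%g /\ ell (s i * w)%g = (ell w).+1.
Proof.
move=> /min_rep_base mw fi; rewrite -min_rep_base.
exact: (min_rep_fire (ord_wall_act n_ge3 1) (@ord_coef_diag n)
  (ord_coef_bond n_ge3) (ord_act_relator n_ge3 _) (@base_wall_ge0 b) (@ord_act_fix 1) mw fi).
Qed.

Lemma fire_conv b w (i : 'I_n.+1) : min_rep (omit b) w -> min_rep (omit b) (s i * w)%g ->
  (ell w < ell (s i * w)%g)%N -> 0 < ord_wall 1 i (bact 1 w (base b)).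
Proof.
move=> /min_rep_base mw /min_rep_base msw lt.
exact: (min_rep_fire_conv (ord_wall_act n_ge3 1) (@ord_coef_diag n)
  (ord_coef_bond n_ge3) (ord_act_relator n_ge3 _) (@base_wall_ge0 b) (@ord_act_fix 1) mw msw lt).
Qed.

Lemma point_inj b w w' : min_rep (omit b) w -> min_rep (omit b) w' ->
  bact 1 w (base b) = bact 1 w' (base b) -> w = w'.
Proof.
move=> /min_rep_base mw /min_rep_base mw'.
exact: (gact_min_rep_inj (ord_wall_act n_ge3 1) (@ord_coef_diag n)
  (ord_coef_bond n_ge3) (ord_act_relator n_ge3 _) (@base_wall_ge0 b) (@ord_act_fix 1) mw mw').
Qed.

Lemma bruhat_point b (u a : seq 'I_n.+1) w : subseq a u -> size u = ell (wp u) ->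
  min_rep (omit b) w -> bact 1 w (base b) = foldr (@ord_act n 1) (base b) a ->
  bruhat w (wp u).
Proof.
move=> au red /min_rep_base mw.
exact: (bruhat_of_point (ord_wall_act n_ge3 1) (@ord_coef_diag n)
  (ord_coef_bond n_ge3) (ord_act_relator n_ge3 _) (@base_wall_ge0 b) (@ord_act_fix 1) au red mw).
Qed.

Lemma seg_letter_bounds j : (j.+1 < 2 * n)%N -> (1 <= seg_letter n j.+1 <= n)%N.
Proof. by rewrite /seg_letter; case: ifP; lia. Qed.

Lemma segmentS b j : (j.+1 < 2 * n)%N ->
  segment n b j.+1 = (s (inord (relabel b (seg_letter n j.+1))) * segment n b j)%g.
Proof. by move=> lt; rewrite !segmentE segment_wordS // wprod_cons. Qed.

Lemma ord_wall_segment b j k : (j < 2 * n)%N -> (1 <= k <= n)%N ->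
  (0 < ord_wall 1 (inord (relabel b k) : 'I_n.+1) (bact 1 (segment n b j) (base b))) =
  (j.+1 < 2 * n)%N && (k == seg_letter n j.+1).
Proof.
move=> lt lek; rewrite segmentE bact_word segment_base //.
by rewrite /ord_wall inordK ?ltnS ?relabel_le // wall_twist // segment_wall.
Qed.

Lemma segment_min_rep b j : (j < 2 * n)%N ->
  min_rep (omit b) (segment n b j) /\ ell (segment n b j) = j.
Proof.
elim: j => [|j IH] lt.
  by rewrite segmentE wprod_nil ell1; split => //; apply: min_rep1.
have [mj ej] := IH (ltnW lt); rewrite segmentS //.
have [] := @fire b (segment n b j) (inord (relabel b (seg_letter n j.+1))) mj.
  by rewrite ord_wall_segment ?seg_letter_bounds ?lt ?eqxx // ltnW.
by rewrite ej.
Qed.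

Lemma segment_parabolic b j : (j < 2 * n)%N ->
  parabolic (omit (~~ b)) (segment n b j).
Proof.
move=> lt; apply: parabolic_wprod; rewrite all_map.
apply/allP => k kin; have /= lek := allP (segment_word_bounds n_ge3 lt) k kin.
rewrite /omit inordK ?ltnS ?relabel_le // /relabel.
by case: b; case: k lek {kin} => [|[|k]].
Qed.

Lemma omit_relabel b (i : 'I_n.+1) : omit (~~ b) i ->
  exists2 k, (1 <= k <= n)%N & i = inord (relabel b k).
Proof.
rewrite /omit => ne; have lt := ltn_ord i; exists (if (i : nat) == b then 1 else i)%N.
  by case: b ne => /=; case: (nat_of_ord i) lt => [|[|k]] //=; lia.
apply: val_inj; rewrite /= inordK /relabel.
  by case: b ne; case: (nat_of_ord i) lt => [|[|k]].
by case: b ne; case: (nat_of_ord i) lt => [|[|k]] //=; lia.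
Qed.

Lemma parabolic_min_segment b v : min_rep (omit b) v -> parabolic (omit (~~ b)) v ->
  exists2 j, (j < 2 * n)%N & v = segment n b j.
Proof.
move=> mv /parabolic_reduced[a [Ja Ea sa]]; rewrite -{}Ea in mv sa *.
elim: a Ja mv sa => [|i a IH] /=.
  by exists 0%N; [lia | rewrite segmentE].
case/andP=> oi Ja; rewrite wprod_cons => mv sa.
have ea : size a = ell (wp a).
  apply/eqP; rewrite eqn_leq ell_wprod andbT.
  by have := ellM (s i) (wp a); rewrite ell_gen -sa add1n ltnS.
have ma : min_rep (omit b) (wp a).
  by apply: min_rep_right_factor mv _; rewrite ell_gen -sa ea.
have [j lt Ej] := IH Ja ma ea.
have [k lek Ei] := omit_relabel oi.
have := fire_conv ma mv; rewrite -sa ea ltnS leqnn => /(_ isT).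
rewrite Ej Ei ord_wall_segment // => /andP[lt' /eqP->].
by exists j.+1 => //; rewrite segmentS.
Qed.

Definition part_rel (a c : nat) := ((c < a) || ((a == c) && (n <= a)))%N.

Lemma bact_segmentV N b j x : (j < 2 * n)%N ->
  bact N (segment n b j)^-1%g x =
  twist N b (foldr (point_act n N) (twist N b x) (rev (segment_word n j))).
Proof.
move=> lt; rewrite segmentE -wprod_rev bact_word /bword -map_rev foldr_bword //.
by rewrite all_rev segment_word_bounds.
Qed.

(** The other generators in [omit b] lie in the parabolic containing the segment, where lengths add
    and the segment is minimal. Only the node [~~ b] is left to test. *)
Lemma min_rep_segment_ascent b u j : (j < 2 * n)%N -> min_rep (omit (~~ b)) u ->
  min_rep (omit b) (u * segment n b j)%g <->
  (ell (u * segment n b j)%g < ell (u * segment n b j * s (inord (~~ b)))%g)%N.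
Proof.
move=> lt mu; have [mj ej] := segment_min_rep b lt; have pj := segment_parabolic b lt.
split=> [mw|asc].
  by apply: min_rep_ascent mw _; rewrite /omit inordK; case: b {mj ej pj mu}; lia.
apply: min_rep_of_ascents => i oi.
have [/eqP Ei|oi'] := boolP ((i : nat) == ~~ b).
  suff -> : i = inord (~~ b) by [].
  by apply: val_inj; rewrite /= inordK -Ei.
rewrite -monoid.mulgA (ell_min_repM mu pj) (ell_min_repM mu); last first.
  by apply: parabolicM pj _; apply: parabolic_gen.
by rewrite ltn_add2l; apply: min_rep_ascent mj _.
Qed.

(** After undoing the twist, [u^-1] sends [tilt] to a vector Y that is positive and strictly
    decreasing, by minimality of u. The ascent to be tested is wall 0 after two inverse segments
    separated by a flip. Except when j = 2n-1, the two shifts by N cancel and a comparison of two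
    signed entries of Y remains, decided by their positions. *)
Lemma min_rep_segment2 b u i j : (0 < i < 2 * n)%N -> (0 < j < 2 * n)%N ->
  min_rep (omit b) u -> min_rep (omit (~~ b)) (u * segment n (~~ b) i)%g ->
  min_rep (omit b) (u * segment n (~~ b) i * segment n b j)%g <-> part_rel j i.
Proof.
move=> /andP[i0 lti] /andP[j0 ltj] mu mui; rewrite (min_rep_segment_ascent ltj mui).
rewrite -ascent_wall !monoid.invgM !bactM.
set N := (2 * n)%N%:Z; set y := bact N u^-1%g _.
rewrite bact_segmentV // (@bact_segmentV N (~~ b)) //.
have bn : (~~ b < n.+1)%N by case: (b); lia.
have bn' : (b < n.+1)%N by case: (b); lia.
rewrite /ord_wall inordK // wall_twistN // twist_twistN.
set Y := twist N (~~ b) y.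
have Ywall k : (0 < k <= n)%N -> 0 < wall n N k Y.
  move=> lek; have /(min_rep_ascent mu) : omit b (inord (relabel (~~ b) k) : 'I_n.+1).
    rewrite /omit inordK ?ltnS ?relabel_le // /relabel.
    by case: (b); case: k lek => [|[|k]].
  rewrite -ascent_wall -/N -/y /ord_wall inordK ?ltnS ?relabel_le //.
  by rewrite -(wall_twist n_ge3 N (~~ b) Y lek) /Y twistK.
have Y0 : 0 < Y n.-1 by have := Ywall n; rewrite /wall; decide_ifs; apply; lia.
have Ydec k l : (k < l < n)%N -> Y l < Y k.
  elim: l => // l IH /andP[]; rewrite ltnS leq_eqVlt => /orP[/eqP->|lt] ln.
    have := Ywall l.+1; rewrite /wall; decide_ifs; rewrite /= subr_gt0; apply; lia.
  apply: lt_trans (IH _); last by lia.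
  have := Ywall l.+1; rewrite /wall; decide_ifs; rewrite /= subr_gt0; apply; lia.
have Ypos k : (k < n)%N -> 0 < Y k.
  move=> kn; have [->//|ne] := eqVneq k n.-1.
  by apply: lt_trans Y0 (Ydec _ _ _); lia.
(* Minimality of the first two factors bounds entries of Y in terms of N; this settles j = 2n-1,
   where the shifts by N do not cancel. *)
have Z0 : 0 < wall n N 0 (foldr (point_act n N) Y (rev (segment_word n i))).
  have /(min_rep_ascent mui) : omit (~~ b) (inord b : 'I_n.+1).
    by rewrite /omit inordK //; case: (b).
  rewrite -ascent_wall monoid.invgM bactM -/N -/y bact_segmentV // /ord_wall inordK // -/Y.
  by rewrite -{1}(negbK b) wall_twistN.
move: Z0; rewrite !segment_act_rev // /part_rel.
rewrite /wall /flip /seg_pos.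
have N0 : 0 < N by rewrite /N; lia.
have [jn|nj] := ltnP j n; have [in_|ni] := ltnP i n; decide_ifs => Z0;
(* Collects positivity and the mutual order of all entries of Y in the goal, so that [lia] can treat
   them as atoms. *)
repeat match goal with |- context [Y ?k] =>
  lazymatch goal with H : is_true (0 < Y k) |- _ => fail | _ =>
    have ? : 0 < Y k by (apply: Ypos; lia) end end;
repeat match goal with |- context [Y ?k] => match goal with |- context [Y ?l] =>
  lazymatch k with l => fail | _ => idtac end;
  lazymatch goal with H : is_true (Y l < Y k) |- _ => fail | H : is_true (Y k < Y l) |- _ => fail
  | _ => idtac end;
  first [ have ? : Y l < Y k by (apply: Ydec; lia) | have ? : Y k < Y l by (apply: Ydec; lia)
        | have -> : Y k = Y l by (congr (Y _); lia) ] end end;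
lia.
Qed.

Fixpoint shape_word b (la : seq nat) : seq 'I_n.+1 :=
  if la is j :: la' then shape_word (~~ b) la' ++ bword n b (segment_word n j) else [::].

(* The shapes of minimal coset representatives, followed by any number of zeros:
   parts below n are distinct, parts from n on may repeat. *)
Definition padded_rel (a c : nat) := ((c < a) || ((a == c) && ((n <= a) || (a == 0))))%N.

Definition padded_shape (la : seq nat) :=
  sorted padded_rel la && all (fun j => j < 2 * n)%N la.

Lemma padded_shape_cons j la : padded_shape (j :: la) ->
  padded_shape la /\ (j < 2 * n)%N.
Proof. by case/andP => /path_sorted so /= /andP[-> al]; rewrite /padded_shape so. Qed.

Lemma padded_shape0 la : padded_shape (0%N :: la) -> la = nseq (size la) 0%N.
Proof.
case/andP => /= + _; elim: la => //= j la IH /andP[+ p].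
rewrite /padded_rel ltn0 /= => /andP[/eqP Ej _]; rewrite -Ej in p *.
by rewrite {1}(IH p).
Qed.

Lemma shape_word0 b k : shape_word b (nseq k 0%N) = [::].
Proof. by elim: k b => //= k IH b; rewrite IH. Qed.

Lemma shape_word_cat0 b la k : shape_word b (la ++ nseq k 0%N) = shape_word b la.
Proof. by elim: la b => [|j la IH] b /=; rewrite ?shape_word0 ?IH. Qed.

Lemma wprod_shape_cons b j la :
  wp (shape_word b (j :: la)) = (wp (shape_word (~~ b) la) * segment n b j)%g.
Proof. by rewrite /= wprod_cat. Qed.

Lemma size_shape_word b la : padded_shape la -> size (shape_word b la) = sumn la.
Proof.
elim: la b => //= j la IH b /padded_shape_cons[v lt].
by rewrite size_cat IH // size_map size_segment_word // addnC.
Qed.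

Lemma padded_shape_min_rep b la : padded_shape la ->
  min_rep (omit b) (wp (shape_word b la)) /\ ell (wp (shape_word b la)) = sumn la.
Proof.
(* The criterion for a part involves the tails after one and after two parts, so the induction is on
   the number of parts. *)
have [k] := ubnP (size la); elim: k la b => // k IH la b; rewrite ltnS.
case: la => [|j la] /=; first by rewrite wprod_nil ell1; split=> //; apply: min_rep1.
move=> lek v; have [v' ltj] := padded_shape_cons v.
have [mu eu] := IH la (~~ b) lek v'; have [mj ej] := segment_min_rep b ltj.
have pj := segment_parabolic b ltj.
rewrite wprod_cat -segmentE (ell_min_repM mu pj) ej eu addnC; split=> //.
case: la lek v v' mu eu => [|i la] lek v v' mu eu.
  by rewrite wprod_nil monoid.mul1g.
have [i0|i0] := posnP i.
  rewrite i0 in v'; rewrite i0 (padded_shape0 v') -[0%N :: _]/(nseq (size la).+1 0%N).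
  by rewrite shape_word0 wprod_nil monoid.mul1g.
have [v'' lti] := padded_shape_cons v'.
have j0 : (0 < j)%N by case/andP: v => /= /andP[+ _] _; rewrite /padded_rel; lia.
move: mu; rewrite wprod_shape_cons negbK => mu.
have [mla _] := IH la b (ltnW lek) v''.
apply/(min_rep_segment2 _ _ mla mu); rewrite ?i0 ?j0 //.
by case/andP: v => /= /andP[+ _] _; rewrite /padded_rel /part_rel; lia.
Qed.

(** Trailing zeros do not change the word, so lists can only be recovered once their sizes agree. *)
Lemma padded_shape_inj b la mu : size la = size mu -> padded_shape la -> padded_shape mu ->
  wp (shape_word b la) = wp (shape_word b mu) -> la = mu.
Proof.
elim: la mu b => [|j la IH] [|i mu] //= b [sz] v1 v2.
have [v1' lt1] := padded_shape_cons v1; have [v2' lt2] := padded_shape_cons v2.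
rewrite !wprod_cat -!segmentE.
have [m1 _] := padded_shape_min_rep (~~ b) v1'.
have [m2 _] := padded_shape_min_rep (~~ b) v2'.
case/(min_rep_factor_uniq m1 m2 (segment_parabolic b lt1) (segment_parabolic b lt2)).
move=> /(IH _ _ sz v1' v2')-> E; congr (_ :: _).
have [_ <-] := segment_min_rep b lt1; have [_ <-] := segment_min_rep b lt2.
by rewrite E.
Qed.

Lemma affB_shape_padded b w la : affB_shape b w la ->
  [/\ padded_shape la, all (fun j => 0 < j)%N la & w = wp (shape_word b la)].
Proof.
elim=> {b w la} [b|b w u j la _ mw mu pj lej Ew _ sh [v al Eu]].
  by rewrite wprod_nil.
have ltj : (j < 2 * n)%N by lia.
split; rewrite ?wprod_shape_cons -?Eu //=; last by rewrite al; lia.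
have [so al'] := andP v; rewrite /padded_shape /= al' ltj andbT.
case: la sh v al Eu so al' => [|i la] //= sh v /andP[i0 al] Eu -> /andP[lti _].
rewrite andbT.
have [v' _] := padded_shape_cons v.
have [mla _] := padded_shape_min_rep b v'.
move: mw mu; rewrite Ew Eu wprod_shape_cons negbK => mw mu.
have lti' : (0 < i < 2 * n)%N by rewrite i0.
have ltj' : (0 < j < 2 * n)%N by lia.
have := min_rep_segment2 lti' ltj' mla mu; rewrite /part_rel /padded_rel => -[/(_ mw)].
lia.
Qed.

Lemma affB_shape_exists b w : min_rep (omit b) w -> exists la, affB_shape b w la.
Proof.
have [k] := ubnP (ell w); elim: k w b => // k IH w b; rewrite ltnS => lek mw.
have [->|w1] := eqVneq w 1%g; first by exists [::]; apply: affB_shape_nil.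
have [u [v [mu pv Ew]]] := min_rep_factor (omit (~~ b)) w.
have el := ell_min_repM mu pv.
have mv : min_rep (omit b) v by apply: (@min_rep_right_factor _ _ _ u); rewrite -?Ew // Ew.
have [j lt Ev] := parabolic_min_segment mv pv.
have [mj ej] := segment_min_rep b lt.
(* If v were trivial, w would be minimal with respect to both omitted nodes, so every generator
   would lengthen it; testing minimality on [w^-1] then gives w = 1. *)
have j0 : (0 < j)%N.
  rewrite lt0n; apply: contraNneq w1 => j0; apply/eqP.
  have v1 : v = 1%g by rewrite Ev j0 segmentE wprod_nil.
  have mw' : min_rep (omit (~~ b)) w by rewrite Ew v1 monoid.mulg1.
  have : min_rep xpredT w.
    apply: min_rep_of_ascents => i _; have [o|] := boolP (omit b i).
      exact: min_rep_ascent mw o.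
    rewrite /omit negbK => /eqP Ei; apply: min_rep_ascent mw' _.
    by rewrite /omit Ei; case: (b).
  have [a [Ea _]] := reduced_word w.
  move=> /(_ w^-1%g); rewrite monoid.mulgV ell1 leqn0 => H; apply: ell_eq0.
  by apply/eqP/H; apply: parabolicV; exists a => //; apply: all_predT.
have [|la sh] := IH u (~~ b) _ mu.
  by apply: leq_trans lek; rewrite Ew el Ev ej; lia.
exists (j :: la); apply: (affB_shape_cons (u := u)) => //; rewrite -?Ev //.
- exact/eqP.
- lia.
by rewrite Ew.
Qed.

End Factorization.

(** * Coefficients of the Poincare polynomial as counts *)

Section PoincareCoefficients.
Variables (I : finType) (m : coxmat I) (J : pred I).
Implicit Types v w : coxeter m.

Definition ideal_count w i :=
  count (fun v => ell v == i) (fset_set (lower_ideal J w)).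

Lemma coef_poincare w i : ((poincare J w)`_i = (ideal_count w i)%:R)%R.
Proof.
rewrite /poincare fsbig_finite /=; last exact: finite_lower_ideal.
rewrite /ideal_count coef_sum -sum1_count GRing.Theory.natr_sum [RHS]big_mkcond /=.
by apply: eq_bigr => v _; rewrite coefXn eq_sym; case: eqP.
Qed.

Lemma palindromicE w : palindromic J w <->
  forall i, i <= ell w -> ideal_count w i = ideal_count w (ell w - i).
Proof.
split=> pal i le; last by rewrite !coef_poincare pal.
have := pal i le; rewrite !coef_poincare => /eqP.
by rewrite Num.Theory.eqr_nat => /eqP.
Qed.

Lemma mem_lower_ideal v w :
  (v \in fset_set (lower_ideal J w)) = `[< min_rep J v /\ bruhat v w >].
Proof.
rewrite in_fset_set; last exact: finite_lower_ideal.
by apply/idP/asboolP => [/set_mem|H]; last exact/mem_set.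
Qed.

Lemma ideal_count_ge w i (L : seq (coxeter m)) : uniq L ->
  (forall v, v \in L -> [/\ min_rep J v, bruhat v w & ell v = i]) ->
  size L <= ideal_count w i.
Proof.
move=> uL HL; rewrite /ideal_count -size_filter; apply: uniq_leq_size => // v /HL[mv bv ev].
by rewrite mem_filter ev eqxx mem_lower_ideal; apply/asboolP.
Qed.

Lemma ideal_count_le w i (L : seq (coxeter m)) :
  (forall v, min_rep J v -> bruhat v w -> ell v = i -> v \in L) ->
  ideal_count w i <= size L.
Proof.
move=> HL; rewrite /ideal_count -size_filter; apply: uniq_leq_size.
  by rewrite filter_uniq // fset_uniq.
move=> v; rewrite mem_filter mem_lower_ideal => /andP[/eqP ev /asboolP[mv bv]].
exact: HL.
Qed.

End PoincareCoefficients.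

(** * Subwords and states of the alternating words *)

Section States.
Import Order.TTheory GRing.Theory Num.Theory.
Local Open Scope ring_scope.
Variable n : nat.
Hypothesis n_ge3 : (2 < n)%N.
Implicit Types (b : bool) (la mu : seq nat) (cs : seq (seq nat)) (A B C D L : seq int).
Local Notation wp := (wprod (affB_mat n)).
Local Notation wsh la := (wp (shape_word n false la)).
Local Notation segw := (segment_word n).

Fixpoint general_word b cs : seq 'I_n.+1 :=
  if cs is c :: cs' then general_word (~~ b) cs' ++ bword n b c else [::].

Lemma shape_wordE b la : shape_word n b la = general_word b (map segw la).
Proof. by elim: la b => //= j la IH b; rewrite IH. Qed.

(* Conjugation by [flip] exchanges s_0 and s_1, so that reading a row of a shape
   becomes the same operation for both colours. *)
Definition pass (x : nat -> int) (c : seq nat) := foldr (point_act n 1) (flip 1 x) c.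

(** Each row contributes one flip, so rows of both colours act through the same map [pass]. The
    leftover twist depends only on the number of rows. *)
Lemma foldr_general_word b x cs : all (all (fun k => 1 <= k <= n)%N) cs ->
  foldr (@ord_act n 1) (twist 1 (~~ b) x) (general_word b cs) =
  twist 1 (iter (size cs) negb (~~ b)) (foldl pass x cs).
Proof.
elim: cs b x => //= c cs IH b x /andP[Hc Hcs].
rewrite foldr_cat foldr_bword // twist_twistN -/(pass x c).
by have := IH (~~ b) (pass x c) Hcs; rewrite negbK => ->; rewrite -iterS iterSr negbK.
Qed.

Lemma subseq_general_word b cs cs' : all2 (fun c' c => subseq c' c) cs' cs ->
  subseq (general_word b cs') (general_word b cs).
Proof.
elim: cs' cs b => [|c' cs' IH] [|c cs] //= b /andP[Hc Hcs].
by apply: cat_subseq; [apply: IH | apply: map_subseq].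
Qed.

Lemma segment_word_subseq i j : (i <= j)%N -> (j < 2 * n)%N -> subseq (segw i) (segw j).
Proof.
move=> lij ltj; rewrite -(subnKC lij) in ltj *.
elim: (j - i)%N ltj => [|k IH] lt; first by rewrite addn0.
rewrite addnS segment_wordS // -addnS //.
by apply: subseq_trans (subseq_cons _ _); apply: IH; lia.
Qed.

Definition below la mu := bruhat (wsh mu) (wsh la).

Lemma below_contained la mu : padded_shape n la -> padded_shape n mu ->
  all2 leq mu la -> below la mu.
Proof.
move=> vla vmu le; have [_ ela] := padded_shape_min_rep n_ge3 false vla.
apply: subword_bruhat; last by rewrite ela size_shape_word.
rewrite !shape_wordE; apply: subseq_general_word.
case/andP: vla => _; elim: mu la le {vmu ela} => [|i mu IH] [|j la] //= /andP[lij le] /andP[lt al].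
by rewrite segment_word_subseq // IH.
Qed.

Definition states la := foldl pass origin (map segw la).

(** [cs] lists what remains of the rows of [la] after deleting letters. Equal numbers of rows make
    the leftover twists agree, which is the reason for padding shapes with zeros. *)
Lemma below_states la mu cs : padded_shape n la -> padded_shape n mu ->
  size mu = size la -> all2 (fun c' c => subseq c' c) cs (map segw la) ->
  foldl pass origin cs = states mu -> below la mu.
Proof.
move=> vla vmu sz sub E; have [_ ela] := padded_shape_min_rep n_ge3 false vla.
have [mmu _] := padded_shape_min_rep n_ge3 false vmu.
have szcs : size cs = size la by move: sub; rewrite all2E size_map => /andP[/eqP].
have bnd la' : padded_shape n la' -> all (all (fun k => 1 <= k <= n)%N) (map segw la').
  by case/andP=> _ al; rewrite all_map; apply: sub_all al => j /= lt; apply: segment_word_bounds.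
have bcs : all (all (fun k => 1 <= k <= n)%N) cs.
  have := bnd _ vla; elim: cs (map segw la) sub {E szcs} => [|c cs IH] [|d ds] //= /andP[cd sub].
  case/andP=> Hd Hds; rewrite (IH _ sub Hds) andbT.
  by apply/allP => k /(mem_subseq cd); apply: (allP Hd).
apply: (@bruhat_point _ n_ge3 false _ (general_word false cs)) => //.
- by rewrite shape_wordE; apply: subseq_general_word.
- by rewrite ela size_shape_word.
rewrite bact_word // shape_wordE /base !foldr_general_word // ?bnd //.
by rewrite E size_map szcs sz.
Qed.

Definition pt L : nat -> int := fun k => nth 0 L k.
Local Arguments pt : simpl never.

Lemma origin_pt : origin = pt (nseq n 0).
Proof. by apply/funext => k; rewrite /pt nth_nseq; case: ifP. Qed.

(** A row shorter than n moves the first entry a behind A and turns it into 1 - a. A row of length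
    at least n also crosses the sign change at the end, so a becomes a - 1 instead, as in
    [pass_hi]. *)
Lemma pass_lo (a : int) A B : (size A + size B).+1 = n ->
  pass (pt (a :: A ++ B)) (segw (size A)) = pt (A ++ (1 - a) :: B).
Proof.
move=> sz; rewrite /pass segment_act //; last by lia.
apply/funext => k; rewrite /seg_pos /flip /pt /=.
have [lt|gt|->] := ltngtP k (size A); decide_ifs => //.
- by rewrite !nth_cat lt.
- by case: k gt => // k gt; rewrite /= !nth_cat; decide_ifs; rewrite subSn.
- by rewrite nth_cat ltnn subnn.
Qed.

Lemma pass_hi (a : int) A B : (size A + size B).+1 = n ->
  pass (pt (a :: A ++ B)) (segw (2 * n - (size A).+1)) = pt (A ++ (a - 1) :: B).
Proof.
move=> sz; rewrite /pass segment_act //; last by lia.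
apply/funext => k; rewrite /seg_pos /flip /pt /=.
have -> : (2 * n - (2 * n - (size A).+1).+1 = size A)%N by lia.
have -> : (2 * n - (size A).+1 < n)%N = false by lia.
have [lt|gt|->] := ltngtP k (size A); decide_ifs => //.
- by rewrite !nth_cat lt.
- by case: k gt => // k gt; rewrite /= !nth_cat; decide_ifs; rewrite subSn.
- by rewrite nth_cat ltnn subnn /=; lia.
Qed.

Lemma pt_catr A L d : pt (A ++ L) (size A + d) = pt L d.
Proof. by rewrite /pt nth_cat ltnNge leq_addr addKn. Qed.

Lemma act_swap A (x y : int) B : (size A + size B).+2 = n ->
  point_act n 1 (size A).+1 (pt (A ++ x :: y :: B)) = pt (A ++ y :: x :: B).
Proof.
move=> sz; apply/funext => k; rewrite /point_act.
have lt2 : ((size A).+1 < n)%N by lia.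
have E0 : pt (A ++ x :: y :: B) (size A) = x by rewrite -(addn0 (size A)) pt_catr.
have E1 : pt (A ++ x :: y :: B) (size A).+1 = y by rewrite -addn1 pt_catr.
rewrite /= lt2 E0 E1.
have [lt|ge] := ltnP k (size A).
  by decide_ifs; rewrite /pt !nth_cat lt.
have [[|[|d]] ->] : exists d, k = (size A + d)%N by exists (k - size A)%N; lia.
all: by rewrite !pt_catr; decide_ifs.
Qed.

Lemma act_rot A (x : int) B C : (size A + size B + size C).+1 = n ->
  foldr (point_act n 1) (pt (A ++ x :: B ++ C)) (rev (iota (size A).+1 (size B)))
  = pt (A ++ B ++ x :: C).
Proof.
elim: B A => [|y B IH] A /= sz //.
rewrite rev_cons foldr_rcons act_swap; last by rewrite size_cat; lia.
have := IH (rcons A y); rewrite size_rcons !cat_rcons => -> //=; lia.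
Qed.

Lemma iota_rcons k l : iota k l.+1 = rcons (iota k l) (k + l)%N.
Proof. by rewrite -addn1 iotaD cats1. Qed.

Lemma foldl_passes_hi A B C : (size A + size B + size C)%N = n -> (0 < size (A ++ B))%N ->
  foldl pass (pt (A ++ B ++ C)) (nseq (size A) (segw (n + size C))) =
  pt (B ++ map (fun a => a - 1) A ++ C).
Proof.
elim: A B => [|a A IH] B //= sz _.
have -> : pass (pt (a :: A ++ B ++ C)) (segw (n + size C)) = pt (A ++ rcons B (a - 1) ++ C).
  have := @pass_hi a (A ++ B) C; rewrite size_cat.
  have -> : (2 * n - (size A + size B).+1 = n + size C)%N by lia.
  by rewrite -!catA cat_rcons; apply; lia.
by rewrite IH ?size_cat ?size_rcons ?cat_rcons //; lia.
Qed.

Lemma foldl_passes_nn q L : size L = n ->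
  foldl pass (pt L) (nseq (q * n) (segw n)) = pt (map (fun a => a - q%:Z) L).
Proof.
move=> sz; elim: q => [|q IH].
  by rewrite mul0n /=; congr pt; rewrite -[LHS]map_id; apply: eq_map => a; rewrite subr0.
rewrite mulSnr nseqD foldl_cat IH.
have := @foldl_passes_hi (map (fun a => a - q%:Z) L) [::] [::].
rewrite !cats0 size_map !addn0 sz => -> //=; last by lia.
rewrite -map_comp; congr pt.
by apply: eq_map => a /=; lia.
Qed.

Lemma foldl_passes_desc A D B : (size A + size D + size B)%N = n ->
  foldl pass (pt (A ++ D ++ B)) (map segw (rev (iota (size D) (size A)))) =
  pt (D ++ rev (map (fun a => 1 - a) A) ++ B).
Proof.
elim: A B => [|a A IH] B //= sz.
rewrite -/(iota (size D) (size A).+1) iota_rcons rev_rcons /=.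
have -> : pass (pt (a :: A ++ D ++ B)) (segw (size D + size A)) = pt (A ++ D ++ (1 - a) :: B).
  have := @pass_lo a (A ++ D) B; rewrite size_cat -!catA (addnC (size D)); apply.
  by lia.
rewrite IH /=; last by lia.
by rewrite rev_cons cat_rcons.
Qed.

Lemma flip_pt (a : int) L : flip 1 (pt (a :: L)) = pt (1 - a :: L).
Proof. by apply/funext => -[|k]. Qed.

Lemma pass0K x : pass (pass x (segw 0)) (segw 0) = x.
Proof. exact: flipK. Qed.

End States.

(** * Non-palindromic shapes *)

Section NotPalindromic.
Variable n : nat.
Hypothesis n_ge3 : 2 < n.
Implicit Types (la mu l : seq nat) (a c p k : nat).
Local Notation wp := (wprod (affB_mat n)).
Local Notation wsh la := (wp (shape_word n false la)).
Local Notation pal la := (palindromic (@omit n false) (wsh la)).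
Local Notation padded := (padded_shape n).

Lemma min_rep_shape (v : affB n) : min_rep (omit false) v ->
  exists la, [/\ padded la, all (fun j => 0 < j) la & v = wsh la].
Proof.
by case/(affB_shape_exists n_ge3) => la /(affB_shape_padded n_ge3)[H1 H2 H3]; exists la.
Qed.

(** Rank k is bounded above by all shapes of size k, whether below [la] or not; corank k is bounded
    below by M. The members of M have the size of [la], so they represent distinct elements. *)
Lemma not_palindromic la k (M K : seq (seq nat)) : padded la -> k <= sumn la ->
  uniq M ->
  (forall mu, mu \in M -> [/\ padded mu, size mu = size la, sumn mu + k = sumn la & below n la mu]) ->
  (forall mu, padded mu -> all (fun j => 0 < j) mu -> sumn mu = k -> mu \in K) ->
  size K < size M -> ~ pal la.
Proof.
move=> vla lek uM HM HK lt /palindromicE/(_ k).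
have [mla ela] := padded_shape_min_rep n_ge3 false vla.
rewrite ela => /(_ lek) E.
have le1 : ideal_count (omit false) (wsh la) k <= size K.
  rewrite -(size_map (fun mu => wsh mu)); apply: ideal_count_le => v mv _ ev.
  have [mu [vmu pmu Ev]] := min_rep_shape mv; rewrite Ev; apply: map_f; apply: HK => //.
  by have [_ <-] := padded_shape_min_rep n_ge3 false vmu; rewrite -Ev.
have le2 : size M <= ideal_count (omit false) (wsh la) (sumn la - k).
  rewrite -(size_map (fun mu => wsh mu)); apply: ideal_count_ge.
    rewrite map_inj_in_uniq // => mu mu' /HM[v1 s1 _ _] /HM[v2 s2 _ _].
    by apply: (padded_shape_inj n_ge3) => //; rewrite s1 s2.
  move=> v /mapP[mu /HM[vmu _ su bmu] ->].
  have [mmu emu] := padded_shape_min_rep n_ge3 false vmu; split=> //.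
  by rewrite emu; lia.
by move: lt; rewrite ltnNge; apply/negP/negPn; lia.
Qed.

Lemma sumn0_pos mu : all (fun j => 0 < j) mu -> sumn mu = 0 -> mu = [::].
Proof. by case: mu => //= a mu /andP[]; lia. Qed.

Lemma shapes_of_1 mu : padded mu -> all (fun j => 0 < j) mu -> sumn mu = 1 ->
  mu \in [:: [:: 1]].
Proof.
move=> _; case: mu => //= a mu /andP[a0 pos] E.
have -> : a = 1 by lia.
by rewrite (sumn0_pos pos) //; lia.
Qed.

Lemma shapes_of_2 mu : padded mu -> all (fun j => 0 < j) mu -> sumn mu = 2 ->
  mu \in [:: [:: 2]].
Proof.
case: mu => //= a mu /andP[/= so _] /andP[a0 pos] E.
case: mu so pos E => [|c mu] /=; first by rewrite addn0 => _ _ ->.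
by rewrite /padded_rel => /andP[r _] /andP[c0 _] E; lia.
Qed.

Lemma shapes_of_4 mu : 3 < n -> padded mu -> all (fun j => 0 < j) mu -> sumn mu = 4 ->
  mu \in [:: [:: 4]; [:: 3; 1]].
Proof.
move=> n4; case: mu => //= a mu /andP[/= so _] /andP[a0 pos] E.
case: mu so pos E => [|c mu] /=; first by rewrite addn0 => _ _ ->.
rewrite /padded_rel => /andP[r so] /andP[c0 pos] E.
case: mu so pos E => [|d mu] /=.
  by move=> _ _ E; have [-> ->] : a = 3 /\ c = 1 by lia.
by rewrite /padded_rel => /andP[r' _] /andP[d0 _] E; lia.
Qed.

Lemma two_coatoms la mu mu' : padded la -> mu != mu' ->
  (forall nu, nu \in [:: mu; mu'] ->
     [/\ padded nu, size nu = size la, sumn nu + 1 = sumn la & below n la nu]) ->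
  ~ pal la.
Proof.
move=> vla ne H; apply: (@not_palindromic la 1 [:: mu; mu'] [:: [:: 1]]) => //.
- by have [_ _ <- _] := H mu (mem_head _ _); lia.
- by rewrite /= inE ne.
exact: shapes_of_1.
Qed.

Lemma two_corank2 la mu mu' : padded la -> mu != mu' ->
  (forall nu, nu \in [:: mu; mu'] ->
     [/\ padded nu, size nu = size la, sumn nu + 2 = sumn la & below n la nu]) ->
  ~ pal la.
Proof.
move=> vla ne H; apply: (@not_palindromic la 2 [:: mu; mu'] [:: [:: 2]]) => //.
- by have [_ _ <- _] := H mu (mem_head _ _); lia.
- by rewrite /= inE ne.
exact: shapes_of_2.
Qed.

Lemma sorted_cat_cons_split (e : rel nat) l a l' :
  sorted e (l ++ a :: l') = sorted e (rcons l a) && path e a l'.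
Proof. by case: l => //= x l; rewrite cat_path rcons_path /= andbA. Qed.

Lemma padded_rcons_lt l a c : c < a -> padded (rcons l a) -> padded (rcons l c).
Proof.
move=> lt /andP[so al]; apply/andP; split.
  case: l so {al} => //= x l; rewrite !rcons_path => /andP[-> ]; rewrite /padded_rel; lia.
by move: al; rewrite !all_rcons => /andP[lta ->]; rewrite andbT; lia.
Qed.

Lemma all2_leq_refl l : all2 leq l l.
Proof. by elim: l => //= a l ->; rewrite leqnn. Qed.

Lemma all2_leq_cat l l' mu mu' : all2 leq l l' -> all2 leq mu mu' ->
  all2 leq (l ++ mu) (l' ++ mu').
Proof. by elim: l l' => [|x l IH] [|y l'] //= /andP[-> le] /(IH _ le)->. Qed.

Lemma sumn_rcons l a : sumn (rcons l a) = sumn l + a.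
Proof. by rewrite -cats1 sumn_cat /= addn0. Qed.

Lemma padded_cat_cons l a l' : padded (l ++ a :: l') =
  padded (rcons l a) && padded (a :: l').
Proof.
rewrite /padded_shape sorted_cat_cons_split all_cat all_rcons /=.
by case: sorted; case: path; case: (a < _); case: all; case: all.
Qed.

(* Consecutive parts a, c such that lowering a by one violates the shape condition. *)
Definition tight_rel a c := ((a == c) && (n <= c)) || ((a == c.+1) && (a <= n)).

Lemma not_sorted_split la : ~~ sorted tight_rel la ->
  exists l a c l', la = l ++ [:: a, c & l'] /\ ~~ tight_rel a c.
Proof.
case: la => //= x la; elim: la x => //= y la IH x; rewrite negb_and.
case/orP=> [ne|/IH[l [a [c [l' [E ne]]]]]]; first by exists [::], x, y, la.
by exists (x :: l), a, c, l'; rewrite E.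
Qed.

(** The first part of a non-tight pair can be lowered, and so can the last part. The two coatoms
    differ in their last part. *)
Lemma not_tight_not_palindromic la : padded la -> all (fun j => 0 < j) la ->
  ~~ sorted tight_rel la -> ~ pal la.
Proof.
move=> vla pos /not_sorted_split[l [a [c [l' [Ela ne]]]]].
have [h [p Ehp]] : exists h p, la = rcons h p.
  by case/lastP: la Ela {vla pos} => [|h p] E; [case: l E | exists h, p].
have p0 : 0 < p by move: pos; rewrite Ehp all_rcons => /andP[].
have a0 : 0 < a by move: pos; rewrite Ela all_cat /= => /and3P[].
have v1 : padded (l ++ [:: a.-1, c & l']).
  move: vla; rewrite Ela !padded_cat_cons => /andP[v1 v2].
  apply/andP; split; first by apply: padded_rcons_lt v1; lia.
  case/andP: v2 => /= /andP[r so] /and3P[l1 l2 l3].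
  rewrite /padded_shape /= so l2 l3 !andbT; apply/andP; split; last by lia.
  by move: ne r; rewrite /padded_rel /tight_rel; lia.
have v2 : padded (rcons h p.-1).
  by apply: (@padded_rcons_lt _ p); rewrite -?Ehp //; lia.
apply: (@two_coatoms la (l ++ [:: a.-1, c & l']) (rcons h p.-1)) => //.
  apply/eqP => /(congr1 (last 0)); rewrite last_rcons last_cat /= => E.
  have := congr1 (last 0) Ela; rewrite Ehp last_rcons last_cat /=; lia.
move=> nu; rewrite !inE => /orP[]/eqP->; split=> //.
- by rewrite Ela !size_cat.
- by rewrite Ela !sumn_cat /=; lia.
- apply: below_contained => //; rewrite Ela; apply: all2_leq_cat; first exact: all2_leq_refl.
  by rewrite /= leq_pred leqnn all2_leq_refl.
- by rewrite Ehp !size_rcons.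
- by rewrite Ehp !sumn_rcons; lia.
apply: below_contained => //; rewrite Ehp -!cats1; apply: all2_leq_cat; first exact: all2_leq_refl.
by rewrite /= leq_pred.
Qed.

(** Either the last part is lowered by two, or the last two parts by one each. For a = p = n the
    second choice would repeat the part n-1, which shapes do not allow. *)
Lemma tight_corank2_not_palindromic l a p : padded (rcons (rcons l a) p) ->
  tight_rel a p -> 1 < p -> ~~ ((a == n) && (p == n)) -> ~ pal (rcons (rcons l a) p).
Proof.
move=> v r p1 ne.
have v1 : padded (rcons (rcons l a) (p - 2)) by apply: padded_rcons_lt v; lia.
have v2 : padded (rcons (rcons l a.-1) p.-1).
  move: v; rewrite -!cats1 -!catA /= !padded_cat_cons => /andP[w1 /andP[_ /= w2]].
  apply/andP; split; first by apply: padded_rcons_lt w1; move: r; rewrite /tight_rel; lia.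
  rewrite /padded_shape /= !andbT; move: r w2; rewrite /tight_rel /padded_rel; lia.
apply: (two_corank2 v) (_ : rcons (rcons l a) (p - 2) != rcons (rcons l a.-1) p.-1) _.
  by apply/eqP => /(congr1 (last 0)); rewrite !last_rcons; lia.
have a0 : 0 < a by move: r; rewrite /tight_rel; lia.
move=> nu; rewrite !inE => /orP[]/eqP->; split=> //; rewrite ?size_rcons ?sumn_rcons //; try lia.
- apply: below_contained => //; rewrite -!cats1; apply: all2_leq_cat; first exact: all2_leq_refl.
  by rewrite /= leq_subr.
apply: below_contained => //; rewrite -!cats1 -!catA; apply: all2_leq_cat; first exact: all2_leq_refl.
by rewrite /= !leq_pred.
Qed.

Lemma tight_end_n l : sorted tight_rel (rcons l n) -> rcons l n = nseq (size l).+1 n.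
Proof.
elim/last_ind: l => // l y IH so0.
have [so r] : sorted tight_rel (rcons l y) /\ tight_rel y n.
  by move: so0; rewrite -cats1 cat_rcons sorted_cat_cons_split /= => /and3P[].
have Ey : y = n by move: r; rewrite /tight_rel; lia.
rewrite Ey size_rcons in so *; rewrite IH //.
by elim: (size l).+1 => //= k ->.
Qed.

(** Read from the right, tight parts below n increase by one until they reach n, and only n can
    precede n. *)
Lemma tight_end l p : 0 < p < n -> sorted tight_rel (rcons l p) ->
  (exists2 k, p <= k < n & rcons l p = rev (iota p (k - p).+1)) \/
  (exists2 m, 0 < m & rcons l p = nseq m n ++ rev (iota p (n - p))).
Proof.
elim/last_ind: l p => [|l y IH] p /andP[p0 pn].
  by move=> _; left; exists p; rewrite ?leqnn // subnn.
rewrite -cats1 cat_rcons sorted_cat_cons_split /= => /and3P[so r _].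
have [Ey yn] : y = p.+1 /\ y <= n by move: r; rewrite /tight_rel; lia.
have En : l ++ [:: y; p] = rcons (rcons l y) p by rewrite -!cats1 -catA.
rewrite En; have [Eyn|ne] := eqVneq y n.
  right; exists (size l).+1 => //; rewrite Eyn in so *; rewrite tight_end_n //.
  by rewrite -cats1; have -> : n - p = 1 by lia.
have [|[k lek E]|[m m0 E]] := IH y _ so; first by lia.
  left; exists k; first by lia.
  rewrite E Ey; have -> : k - p = (k - p.+1).+1 by lia.
  by rewrite -rev_cons.
right; exists m => //; rewrite E Ey; have -> : n - p = (n - p.+1).+1 by lia.
by rewrite rcons_cat -rev_cons.
Qed.

End NotPalindromic.

(** * Rectangles of width n, alone or followed by a staircase *)

Ltac size_lia :=
  do 3 rewrite ?size_cat ?size_nseq ?size_map ?size_rev ?size_iota /=; lia.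

Section Families.
Import Order.TTheory GRing.Theory Num.Theory.
Variable n : nat.
Hypothesis n_ge3 : 2 < n.
Implicit Types (la mu l : seq nat) (A B C L : seq int).
Local Notation wp := (wprod (affB_mat n)).
Local Notation wsh la := (wp (shape_word n false la)).
Local Notation pal la := (palindromic (@omit n false) (wsh la)).
Local Notation padded := (padded_shape n).
Local Notation segw := (segment_word n).
Local Notation passes := (foldl (pass n)).

Lemma nseq_split (T : Type) a b k (x : T) : k = a + b -> nseq k x = nseq a x ++ nseq b x.
Proof. by move->; rewrite nseqD. Qed.

Lemma padded_cat t l l' : padded l -> padded l' ->
  all (fun x => t < x) l -> all (fun y => y <= t) l' -> padded (l ++ l').
Proof.
case: l' => [|y l']; first by rewrite cats0.
move=> v v' al al'; rewrite padded_cat_cons v' andbT.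
case/andP: v => so bd; case/andP: v' => _ /= /andP[lty _].
rewrite /padded_shape all_rcons lty bd andbT.
case: l so al {bd} => //= x l so al; rewrite rcons_path so /=.
have {}al : t < last x l by apply: (allP (al : all _ (x :: l))); rewrite mem_last.
by case/andP: al' => le _; rewrite /padded_rel; lia.
Qed.

Lemma padded_nseq k a : n <= a < 2 * n -> padded (nseq k a).
Proof.
move=> /andP[na a2]; rewrite /padded_shape all_nseq a2 orbT andbT.
by case: k => //=; elim=> //= k ->; rewrite /padded_rel eqxx na !orbT.
Qed.

Lemma padded_zeros k : padded (nseq k 0).
Proof.
rewrite /padded_shape all_nseq muln_gt0 (leq_trans _ n_ge3) // orbT andbT.
by case: k => //=; elim=> //= k ->; rewrite /padded_rel eqxx !orbT.
Qed.

Lemma padded_desc p k : p + k <= 2 * n -> padded (rev (iota p k)).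
Proof.
move=> le; apply/andP; split.
  rewrite rev_sorted; apply: sub_sorted (iota_ltn_sorted p k) => x y /=.
  by rewrite /padded_rel => ->.
by rewrite all_rev; apply/allP => x; rewrite mem_iota; lia.
Qed.

Lemma all_rev_iota (P : pred nat) p k : (forall x, p <= x < p + k -> P x) ->
  all P (rev (iota p k)).
Proof. by move=> H; rewrite all_rev; apply/allP => x; rewrite mem_iota; apply: H. Qed.

Lemma all_nseqP (P : pred nat) k a : P a -> all P (nseq k a).
Proof. by move=> Pa; rewrite all_nseq Pa orbT. Qed.

Lemma passes_hi L L' A B C k j : (j = n + size C) -> k = size A ->
  (size A + size B + size C = n) -> (0 < size (A ++ B)) ->
  L = A ++ B ++ C -> L' = B ++ map (fun a => a - 1)%R A ++ C ->
  passes (pt L) (nseq k (segw j)) = pt L'.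
Proof. by move=> -> -> sz pos -> ->; apply: foldl_passes_hi. Qed.

Lemma passes_nn L L' q k : k = q * n -> size L = n ->
  L' = map (fun a => a - q%:Z)%R L -> passes (pt L) (nseq k (segw n)) = pt L'.
Proof. by move=> -> sz ->; apply: foldl_passes_nn. Qed.

Lemma passes_desc L L' A D B p k : p = size D -> k = size A ->
  (size A + size D + size B = n) -> L = A ++ D ++ B ->
  L' = D ++ rev (map (fun a => 1 - a)%R A) ++ B ->
  passes (pt L) (map segw (rev (iota p k))) = pt L'.
Proof. by move=> -> -> sz -> ->; apply: foldl_passes_desc. Qed.

Lemma pass_lo_at L L' (a : int) A B j : j = size A -> (size A + size B).+1 = n ->
  L = a :: A ++ B -> L' = (A ++ (1 - a) :: B)%R ->
  pass n (pt L) (segw j) = pt L'.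
Proof. by move=> -> sz -> ->; apply: pass_lo. Qed.

Lemma passes_origin q r k : k = q * n + r -> r <= n ->
  passes origin (nseq k (segw n)) =
  pt (nseq (n - r) (- q%:Z)%R ++ nseq r (- q%:Z - 1)%R).
Proof.
move=> -> le; rewrite nseqD foldl_cat (origin_pt n).
rewrite (@passes_nn _ (nseq n (- q%:Z)%R) q) ?size_nseq //; last first.
  by rewrite map_nseq sub0r.
case: (posnP r) => [->|r0]; first by rewrite subn0 cats0.
apply: (@passes_hi _ _ (nseq r (- q%:Z)%R) (nseq (n - r) (- q%:Z)%R) [::]);
  rewrite ?size_cat ?size_nseq ?addn0 //; try lia.
- by rewrite cats0; apply: nseq_split; lia.
by rewrite cats0 map_nseq.
Qed.

Lemma subseq_rev_iota p k p' k' : p' <= p -> p + k <= p' + k' ->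
  subseq (rev (iota p k)) (rev (iota p' k')).
Proof.
move=> le1 le2; rewrite subseq_rev.
have -> : k' = (p - p') + (k + (p' + k' - (p + k))) by lia.
rewrite iotaD iotaD subnKC // -[X in subseq X _]cat0s.
apply: cat_subseq; first exact: sub0seq.
exact: prefix_subseq.
Qed.

Lemma all2_subseq_refl (ds : seq (seq nat)) : all2 (fun c' c => subseq c' c) ds ds.
Proof. by elim: ds => //= d ds ->; rewrite subseq_refl. Qed.

Lemma all2_subseq_cat (ds ds' es es' : seq (seq nat)) :
  all2 (fun c' c => subseq c' c) ds ds' -> all2 (fun c' c => subseq c' c) es es' ->
  all2 (fun c' c => subseq c' c) (ds ++ es) (ds' ++ es').
Proof. by elim: ds ds' => [|x l IH] [|y l'] //= /andP[-> le] /(IH _ le)->. Qed.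

Lemma map_nseq_segw k j : map segw (nseq k j) = nseq k (segw j).
Proof. exact: map_nseq. Qed.

Lemma segw_lo j : j <= n -> segw j = rev (iota 1 j).
Proof. by rewrite /segment_word => ->. Qed.

Lemma power_drop_last m d : 0 < d <= n -> padded (nseq m n ++ [:: n - d]) /\
  below n (nseq m.+1 n) (nseq m n ++ [:: n - d]).
Proof.
move=> /andP[d0 dn]; have v : padded (nseq m n ++ [:: n - d]).
  apply: (@padded_cat (n - d)); rewrite ?padded_nseq //=; try lia.
  - by rewrite /padded_shape /=; lia.
  - by apply: all_nseqP; lia.
split=> //; apply: below_contained => //; first by apply: padded_nseq; lia.
rewrite (@nseq_split _ m 1 m.+1) ?addn1 //.
by apply: all2_leq_cat; rewrite ?all2_leq_refl //= leq_subr.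
Qed.

(* Deleting s_n and s_{n-m-1} from the last row lets the letters in between commute
   past it, where each of them lengthens one of the other rows. *)
Lemma power_small m : 0 < m -> m.+1 < n -> ~ pal (nseq m.+1 n).
Proof.
move=> m0 mn; pose e := n - 2 - m; have En : n = e + m + 2 by rewrite /e; lia.
pose mu := nseq m n.+1 ++ [:: e].
have vla : padded (nseq m.+1 n) by apply: padded_nseq; lia.
have vmu : padded mu.
  apply: (@padded_cat e); rewrite ?padded_nseq //=; try lia.
  - by rewrite /padded_shape /=; lia.
  - by apply: all_nseqP; lia.
have [v1 b1] := @power_drop_last m 2 (ltnW n_ge3).
apply: (@two_corank2 _ n_ge3 _ (nseq m n ++ [:: n - 2]) mu) => //.
  by rewrite /mu -(prednK m0) /= eqseq_cons; lia.
move=> nu; rewrite !inE => /orP[]/eqP->; split=> //.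
- by rewrite size_cat !size_nseq addn1.
- by rewrite sumn_cat !sumn_nseq /=; lia.
- by rewrite size_cat !size_nseq addn1.
- by rewrite sumn_cat !sumn_nseq /=; lia.
(* The last row without its letters n and n-m-1 = e+1. *)
pose c := rev (iota (n - m) m) ++ rev (iota 1 e).
apply: (@below_states _ n_ge3 _ _ (nseq m (segw n) ++ [:: c])) => //.
- by rewrite size_cat !size_nseq addn1.
- rewrite (@nseq_split _ m 1 m.+1) ?addn1 // map_cat map_nseq_segw.
  apply: all2_subseq_cat; first exact: all2_subseq_refl.
  rewrite /= andbT segw_lo // /c -rev_cat subseq_rev.
  have -> : n = e + ((1 + m) + 1) by lia.
  rewrite iotaD; apply: cat_subseq => //; rewrite [iota (1 + e) _]iotaD.
  apply: subseq_trans (prefix_subseq _ _); rewrite iotaD /=.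
  have -> : e + (1 + m + 1) - m = 1 + e + 1 by lia.
  exact: subseq_cons.
have -> : states n mu = pt (nseq e 0%R ++ 1%R :: nseq m (- 1)%R ++ [:: 0%R]).
  rewrite /states /mu map_cat map_nseq_segw foldl_cat (origin_pt n).
  rewrite (@passes_hi _ (nseq e.+1 0%R ++ nseq m (- 1)%R ++ [:: 0%R])
             (nseq m 0%R) (nseq e.+1 0%R) [:: 0%R]); rewrite ?size_cat ?size_nseq ?addn1 //=; try lia.
  - by apply: (@pass_lo_at _ _ 0%R (nseq e 0%R) (nseq m (- 1)%R ++ [:: 0%R]));
      rewrite ?size_cat ?size_nseq //=; lia.
  - by rewrite (nseq_split _ (_ : n = m + (e.+1 + 1))) ?nseqD //; lia.
  - by rewrite map_nseq.
rewrite foldl_cat (@passes_origin 0 m) //=; last by lia.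
rewrite {1}/pass /c foldr_cat -segw_lo; last by lia.
rewrite -/(pass n _ _) (@pass_lo_at _ (nseq e 0%R ++ [:: 1%R, 0%R & nseq m (- 1)%R]) 0%R (nseq e 0%R) (0%R :: nseq m (- 1)%R)) ?size_cat ?size_nseq //=; try lia.
- rewrite (_ : nseq e 0%R ++ _ = (nseq e 0%R ++ [:: 1%R]) ++ 0%R :: nseq m (- 1)%R ++ [::]); last by rewrite -catA cats0.
  have := @act_rot n n_ge3 (nseq e 0%R ++ [:: 1%R]) 0%R (nseq m (- 1)%R) [::].
  rewrite size_cat !size_nseq /= (_ : (e + 1).+1 = n - m); last by lia.
  by move=> ->; [rewrite -catA | lia].
- by rewrite size_nseq; lia.
rewrite (nseq_split _ (_ : n - m = (1 + e) + 1)); last by lia.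
by rewrite nseqD -!catA.
Qed.

(** Since m > 0, the evident coatom, which lowers the last row, still has first row n; the condition
    on [head] separates [mu] from it. *)
Lemma power_second_coatom m mu : 0 < m -> padded mu -> size mu = m.+1 ->
  sumn mu + 1 = n * m.+1 -> head 0 mu != n -> below n (nseq m.+1 n) mu ->
  ~ pal (nseq m.+1 n).
Proof.
move=> m0 vmu sz su hd b.
have vla : padded (nseq m.+1 n) by apply: padded_nseq; lia.
have [|v1 b1] := @power_drop_last m 1; first by lia.
apply: (@two_coatoms _ n_ge3 _ (nseq m n ++ [:: n - 1]) mu) => //.
  by apply: contraNneq hd => <-; rewrite -(prednK m0).
move=> nu; rewrite !inE => /orP[]/eqP->; split=> //.
- by size_lia.
- by rewrite sumn_cat !sumn_nseq /=; lia.
- by rewrite sz size_nseq.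
by rewrite sumn_nseq.
Qed.

Lemma power_second_corank2 m mu : 0 < m -> padded mu -> size mu = m.+1 ->
  sumn mu + 2 = n * m.+1 -> head 0 mu != n -> below n (nseq m.+1 n) mu ->
  ~ pal (nseq m.+1 n).
Proof.
move=> m0 vmu sz su hd b.
have vla : padded (nseq m.+1 n) by apply: padded_nseq; lia.
have [|v1 b1] := @power_drop_last m 2; first by lia.
apply: (@two_corank2 _ n_ge3 _ (nseq m n ++ [:: n - 2]) mu) => //.
  by apply: contraNneq hd => <-; rewrite -(prednK m0).
move=> nu; rewrite !inE => /orP[]/eqP->; split=> //.
- by size_lia.
- by rewrite sumn_cat !sumn_nseq /=; lia.
- by rewrite sz size_nseq.
by rewrite sumn_nseq.
Qed.

(* Deleting the letter s_n of row [q.+1 * n] rearranges into a coatom with r rows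
   of length n+1. *)
Lemma power_residue q r : 0 < r < n -> ~ pal (nseq (q.+1 * n + r) n).
Proof.
case/andP=> r0 rn; pose e := n - 1 - r; have En : n = e + r + 1 by rewrite /e; lia.
(* The row that loses s_n comes after k full rows, when the first coordinate is -q and all the
   others are -q-1; the short row turns this -q into 1+q. *)
pose k := q * n + (n - 1).
have Em : q.+1 * n + r = (k + r).+1 by rewrite /k mulSn; lia.
pose mu := nseq r n.+1 ++ nseq k n ++ [:: e].
rewrite Em; apply: (@power_second_coatom _ mu).
- by rewrite /k; lia.
- apply: (@padded_cat n); rewrite ?padded_nseq //; try lia.
  + apply: (@padded_cat e); rewrite ?padded_nseq //=; try lia.
    * by rewrite /padded_shape /=; lia.
    * by apply: all_nseqP; lia.
  + by apply: all_nseqP.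
  + by rewrite all_cat all_nseqP //=; lia.
- by rewrite /mu; size_lia.
- by rewrite /mu !sumn_cat !sumn_nseq /=; lia.
- by rewrite /mu -(prednK r0) /=; lia.
apply: (@below_states _ n_ge3 _ _ (nseq k (segw n) ++ segw (n - 1) :: nseq r (segw n))).
- by apply: padded_nseq; lia.
- apply: (@padded_cat n); rewrite ?padded_nseq //; try lia.
  + apply: (@padded_cat e); rewrite ?padded_nseq //=; try lia.
    * by rewrite /padded_shape /=; lia.
    * by apply: all_nseqP; lia.
  + by apply: all_nseqP.
  + by rewrite all_cat all_nseqP //=; lia.
- by rewrite /mu; size_lia.
- rewrite (@nseq_split _ k r.+1 (k + r).+1) ?addnS // map_cat !map_nseq_segw.
  apply: all2_subseq_cat; first exact: all2_subseq_refl.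
  by rewrite /= all2_subseq_refl andbT segment_word_subseq //; lia.
have -> : passes origin (nseq k (segw n) ++ segw (n - 1) :: nseq r (segw n)) =
    pt (nseq e (- q%:Z - 1)%R ++ (1 + q%:Z)%R :: nseq r (- q%:Z - 2%:Z)%R).
  rewrite foldl_cat (@passes_origin q (n - 1)) //=; last by lia.
  rewrite (@pass_lo_at _ (nseq (n - 1) (- q%:Z - 1)%R ++ [:: (1 + q%:Z)%R])
     (- q%:Z)%R (nseq (n - 1) (- q%:Z - 1)%R) [::]).
  + apply: (@passes_hi _ _ (nseq r (- q%:Z - 1)%R) (nseq e (- q%:Z - 1)%R ++ [:: (1 + q%:Z)%R]) [::]).
    * by rewrite addn0.
    * by size_lia.
    * by size_lia.
    * by size_lia.
    * by rewrite cats0 catA -nseqD; congr (nseq _ _ ++ _); lia.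
    * by rewrite cats0 map_nseq -catA /=; congr (_ ++ _ :: nseq _ _); lia.
  + by size_lia.
  + by size_lia.
  + by rewrite cats0 (_ : n - (n - 1) = 1) //; lia.
  + by congr (_ ++ [:: _]); lia.
rewrite /states /mu !map_cat !map_nseq_segw !foldl_cat (origin_pt n).
rewrite (@passes_hi _ (nseq e 0%R ++ nseq r (- 1)%R ++ [:: 0%R])
             (nseq r 0%R) (nseq e 0%R) [:: 0%R]); last first.
- by rewrite map_nseq.
- by rewrite (nseq_split _ (_ : n = r + (e + 1))) ?nseqD //; lia.
- by size_lia.
- by size_lia.
- by size_lia.
- by rewrite addn1.
rewrite /k nseqD foldl_cat.
rewrite (@passes_nn _ (nseq e (- q%:Z)%R ++ nseq r (- q%:Z - 1)%R ++ [:: (- q%:Z)%R]) q) //; last first.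
- by rewrite !map_cat !map_nseq /= sub0r; congr (_ ++ nseq _ _ ++ _); lia.
- by size_lia.
rewrite (@passes_hi _ ((- q%:Z)%R :: nseq e (- q%:Z - 1)%R ++ nseq r (- q%:Z - 2%:Z)%R)
             (nseq e (- q%:Z)%R ++ nseq r (- q%:Z - 1)%R) [:: (- q%:Z)%R] [::]); last first.
- by rewrite cats0 map_cat !map_nseq /=; congr (_ :: _ ++ nseq _ _); lia.
- by rewrite cats0 -catA.
- by size_lia.
- by size_lia.
- by size_lia.
- by rewrite addn0.
rewrite /=; symmetry.
apply: (@pass_lo_at _ _ (- q%:Z)%R (nseq e (- q%:Z - 1)%R) (nseq r (- q%:Z - 2%:Z)%R)) => //.
- by size_lia.
- by size_lia.
by congr (_ ++ _ :: _); lia.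
Qed.

(** Deleting s_n from two rows at distance n, the later one being the last, gives the point of a
    shape with 2(n-1) rows of length n+1 and two empty rows. It has corank 2 as 2(n-1)(n+1) = 2n^2 -
    2. *)
Lemma power_multiple q : ~ pal (nseq (q.+2 * n) n).
Proof.
pose k := q * n + (n - 1).
have Em : q.+2 * n = (k + n).+1 by rewrite /k !mulSn; lia.
pose mu := nseq (n - 1) n.+1 ++ nseq (n - 1) n.+1 ++ nseq (q * n) n ++ [:: 0; 0].
have vmu : padded mu.
  rewrite /mu catA -nseqD; apply: (@padded_cat n); rewrite ?padded_nseq //; try lia.
  - apply: (@padded_cat 0); rewrite ?padded_nseq //=; try lia.
    + exact: (padded_zeros 2).
    + by apply: all_nseqP; lia.
  - by apply: all_nseqP.
  by rewrite all_cat all_nseqP.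
rewrite Em; apply: (@power_second_corank2 _ mu) => //.
- by lia.
- by rewrite /mu /k; size_lia.
- by rewrite /mu !sumn_cat !sumn_nseq /=; nia.
- by rewrite /mu (_ : n - 1 = (n - 2).+1) /=; lia.
apply: (@below_states _ n_ge3 _ _ (nseq k (segw n) ++ segw (n - 1) :: nseq (n - 1) (segw n) ++ [:: segw (n - 1)])) => //.
- by apply: padded_nseq; lia.
- by rewrite /mu /k; size_lia.
- rewrite (@nseq_split _ k (1 + ((n - 1) + 1)) (k + n).+1); last by lia.
  rewrite map_cat !map_nseq_segw nseqD (nseqD (n - 1)).
  apply: all2_subseq_cat; first exact: all2_subseq_refl.
  apply: (@all2_subseq_cat [:: _]); first by rewrite /= andbT segment_word_subseq //; lia.
  apply: all2_subseq_cat; first exact: all2_subseq_refl.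
  by rewrite /= andbT segment_word_subseq //; lia.
have -> : passes origin (nseq k (segw n) ++ segw (n - 1) :: nseq (n - 1) (segw n) ++ [:: segw (n - 1)]) =
    pt (nseq (n - 1) (- q%:Z - 2%:Z)%R ++ [:: - q%:Z]%R).
  rewrite foldl_cat (@passes_origin q (n - 1)) //=; last by lia.
  rewrite foldl_cat (@pass_lo_at _ (nseq (n - 1) (- q%:Z - 1)%R ++ [:: (1 + q%:Z)%R])
     (- q%:Z)%R (nseq (n - 1) (- q%:Z - 1)%R) [::]).
  + rewrite (@passes_hi _ ((1 + q%:Z)%R :: nseq (n - 1) (- q%:Z - 2%:Z)%R) (nseq (n - 1) (- q%:Z - 1)%R) [:: (1 + q%:Z)%R] [::]) //=.
    * apply: (@pass_lo_at _ _ (1 + q%:Z)%R (nseq (n - 1) (- q%:Z - 2%:Z)%R) [::]); rewrite ?cats0 //.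
      - by size_lia.
      - by size_lia.
      - by congr (_ ++ [:: _]); lia.
    * by rewrite addn0.
    * by size_lia.
    * by size_lia.
    * by size_lia.
    * by rewrite cats0 map_nseq; congr (_ :: nseq _ _); lia.
  + by size_lia.
  + by size_lia.
  + by rewrite cats0 (_ : n - (n - 1) = 1) //; lia.
  + by congr (_ ++ [:: _]); lia.
rewrite /states /mu !map_cat !map_nseq_segw !foldl_cat (origin_pt n).
have step (z : int) : passes (pt (nseq (n - 1) z ++ [:: 0%R])) (nseq (n - 1) (segw n.+1)) =
    pt (nseq (n - 1) (z - 1)%R ++ [:: 0%R]).
  apply: (@passes_hi _ _ (nseq (n - 1) z) [::] [:: 0%R]).
  - by rewrite addn1.
  - by size_lia.
  - by size_lia.
  - by size_lia.
  - by [].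
  by rewrite map_nseq.
rewrite (nseq_split _ (_ : n = n - 1 + 1)) ?step /= ?step; last by lia.
rewrite (@passes_nn _ (nseq (n - 1) (- q%:Z - 2%:Z)%R ++ [:: - q%:Z]%R) q) ?pass0K //.
- by rewrite flipK.
- by size_lia.
by rewrite map_cat map_nseq /=; congr (nseq _ _ ++ [:: _]); lia.
Qed.

(* Here coranks 1, 2 and 3 agree with ranks 1, 2 and 3: the first asymmetry is three
   elements of corank 4 against the two shapes (4) and (3,1) of rank 4. *)
Lemma power_square : 3 < n -> ~ pal (nseq n n).
Proof.
move=> n4; have vla : padded (nseq n n) by apply: padded_nseq; lia.
pose mu1 := nseq (n - 2) n ++ [:: n; n - 4].
pose mu2 := nseq (n - 2) n ++ [:: n - 1; n - 3].
pose mu3 := nseq (n - 2) n.+2 ++ [:: 0; 0].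
have Ela : nseq n n = nseq (n - 2) n ++ [:: n; n].
  by rewrite {1}(nseq_split _ (_ : n = n - 2 + 2)) //; lia.
have Emu1 : mu1 = nseq (n - 1) n ++ [:: n - 4].
  by rewrite /mu1 (nseq_split _ (_ : n - 1 = n - 2 + 1)) -?catA //; lia.
have v1 : padded mu1.
  rewrite Emu1; apply: (@padded_cat (n - 4)); rewrite ?padded_nseq //=; try lia.
  - by rewrite /padded_shape /=; lia.
  by apply: all_nseqP; lia.
have v2 : padded mu2.
  apply: (@padded_cat (n - 1)); rewrite ?padded_nseq //=; try lia.
  - by rewrite /padded_shape /padded_rel /=; lia.
  by apply: all_nseqP; lia.
have v3 : padded mu3.
  apply: (@padded_cat 0); rewrite ?padded_nseq //=; try lia.
  - exact: (padded_zeros 2).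
  by apply: all_nseqP; lia.
apply: (@not_palindromic _ n_ge3 _ 4 [:: mu1; mu2; mu3] [:: [:: 4]; [:: 3; 1]]) => //.
- by rewrite sumn_nseq; nia.
- have hd a l : head 0 (nseq (n - 2) a ++ l) = a by rewrite (_ : n - 2 = (n - 3).+1) //; lia.
  rewrite /= !inE negb_or !andbT; apply/andP; split.
    apply/andP; split; last by apply/eqP => /(congr1 (head 0)); rewrite !hd; lia.
    by rewrite eqseq_cat // eqxx /= eqseq_cons; lia.
  by apply/eqP => /(congr1 (head 0)); rewrite !hd; lia.
- move=> nu; rewrite !inE => /or3P[]/eqP->; split=> //.
  + by rewrite /mu1; size_lia.
  + by rewrite /mu1 Ela !sumn_cat /=; lia.
  + apply: below_contained => //; rewrite Ela; apply: all2_leq_cat; first exact: all2_leq_refl.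
    by rewrite /= leq_subr leqnn.
  + by rewrite /mu2; size_lia.
  + by rewrite /mu2 Ela !sumn_cat /=; lia.
  + apply: below_contained => //; rewrite Ela; apply: all2_leq_cat; first exact: all2_leq_refl.
    by rewrite /= !leq_subr.
  + by rewrite /mu3; size_lia.
  + by rewrite /mu3 Ela !sumn_cat !sumn_nseq /=; nia.
  (* Four letters are deleted: s_n and the final letter in the last row but one, s_n and s_{n-1} in
     the last row. *)
  apply: (@below_states _ n_ge3 _ _ (nseq (n - 2) (segw n) ++ [:: rev (iota 2 (n - 2)); segw (n - 2)])) => //.
  + by rewrite /mu3; size_lia.
  + rewrite Ela map_cat map_nseq_segw.
    apply: all2_subseq_cat; first exact: all2_subseq_refl.
    rewrite /= andbT segment_word_subseq ?andbT //; try lia.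
    by rewrite segw_lo // subseq_rev_iota //; lia.
  have -> : states n mu3 = pt (nseq (n - 2) (- 1)%R ++ [:: 0; 0]%R).
    rewrite /states /mu3 map_cat map_nseq_segw foldl_cat (origin_pt n).
    rewrite (@passes_hi _ (nseq (n - 2) (- 1)%R ++ [:: 0; 0]%R) (nseq (n - 2) 0%R) [::] [:: 0; 0]%R) /= ?flipK //.
    * by rewrite addn2.
    * by size_lia.
    * by size_lia.
    * by size_lia.
    * by rewrite {1}(nseq_split _ (_ : n = n - 2 + 2)) //; lia.
    * by rewrite map_nseq.
  rewrite foldl_cat (@passes_origin 0 (n - 2)) //=; last by lia.
  have -> : n - (n - 2) = 2 by lia.
  have -> : pass n (pt (nseq 2 (- 0%:Z)%R ++ nseq (n - 2) (- 0%:Z - 1)%R)) (rev (iota 2 (n - 2))) =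
      pt ([:: 1%R] ++ nseq (n - 2) (- 1)%R ++ [:: 0%R]).
    rewrite /pass flip_pt.
    have := @act_rot n n_ge3 [:: 1%R] 0%R (nseq (n - 2) (- 1)%R) [::].
    by rewrite !size_nseq /= cats0; apply; lia.
  apply: (@pass_lo_at _ _ 1%R (nseq (n - 2) (- 1)%R) [:: 0%R]) => //.
  + by size_lia.
  by size_lia.
by move=> mu; apply: shapes_of_4.
Qed.

Lemma stair_second_coatom m mu : 0 < m -> padded mu -> size mu = m + (n - 1) ->
  sumn mu + 1 = sumn (nseq m n ++ rev (iota 1 (n - 1))) -> head 0 mu != n ->
  below n (nseq m n ++ rev (iota 1 (n - 1))) mu ->
  ~ pal (nseq m n ++ rev (iota 1 (n - 1))).
Proof.
move=> m0 vmu sz su hd b; set la := nseq m n ++ _ in su b *.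
have vla : padded la.
  apply: (@padded_cat (n - 1)); rewrite ?padded_nseq ?padded_desc //; try lia.
  - by apply: all_nseqP; lia.
  by apply: all_rev_iota; lia.
pose mu1 := nseq m n ++ rev (iota 2 (n - 2)) ++ [:: 0].
have Ela : la = nseq m n ++ rev (iota 2 (n - 2)) ++ [:: 1].
  by rewrite /la (_ : n - 1 = 1 + (n - 2)) ?iotaD ?rev_cat //; lia.
have v1 : padded mu1.
  apply: (@padded_cat (n - 1)); rewrite ?padded_nseq //; try lia.
  - apply: (@padded_cat 0); rewrite ?padded_desc //; try lia.
    + exact: (padded_zeros 1).
    + by apply: all_rev_iota; lia.
  - by apply: all_nseqP; lia.
  by rewrite all_cat all_rev_iota //=; lia.
apply: (@two_coatoms _ n_ge3 _ mu1 mu) => //.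
  by apply: contraNneq hd => <-; rewrite /mu1 -(prednK m0).
move=> nu; rewrite !inE => /orP[]/eqP->; split=> //.
- by rewrite Ela /mu1; size_lia.
- by rewrite Ela /mu1 !sumn_cat /=; lia.
- apply: below_contained => //; rewrite Ela; apply: all2_leq_cat; first exact: all2_leq_refl.
  by apply: all2_leq_cat; first exact: all2_leq_refl.
by rewrite sz /la; size_lia.
Qed.

Lemma padded_stair m : padded (nseq m n ++ rev (iota 1 (n - 1))).
Proof.
apply: (@padded_cat (n - 1)); rewrite ?padded_nseq ?padded_desc //; try lia.
- by apply: all_nseqP; lia.
by apply: all_rev_iota; lia.
Qed.

(* The second coatom comes from deleting the first letter of the row of length r+1. *)
Lemma stair_residue q r : 0 < r -> r.+1 < n ->
  ~ pal (nseq (q * n + r.+1) n ++ rev (iota 1 (n - 1))).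
Proof.
move=> r0 rn; pose e := n - 2 - r; have En : n = r + e + 2 by rewrite /e; lia.
pose mu := nseq r n.+1 ++ nseq (q * n).+1 n ++ rev (iota r.+2 e) ++ rev (iota 1 r) ++ [:: 0].
have Ela : nseq (q * n + r.+1) n ++ rev (iota 1 (n - 1)) =
    nseq (q * n + r) n ++ n :: rev (iota r.+2 e) ++ r.+1 :: rev (iota 1 r).
  rewrite (nseq_split _ (_ : q * n + r.+1 = (q * n + r) + 1)); last by lia.
  rewrite -catA (_ : n - 1 = r + (1 + e)) ?iotaD ?rev_cat /= -?catA ?addn1 //; last by lia.
have vmu : padded mu.
  apply: (@padded_cat n); rewrite ?padded_nseq //; try lia.
  - apply: (@padded_cat (n - 1)); rewrite ?padded_nseq //; try lia.
    + apply: (@padded_cat r); rewrite ?padded_desc //; try lia.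
      * apply: (@padded_cat 0); rewrite ?padded_desc //; try lia.
        - exact: (padded_zeros 1).
        - by apply: all_rev_iota; lia.
      * by apply: all_rev_iota; lia.
      * by rewrite all_cat all_rev_iota //=; lia.
    + by apply: all_nseqP; lia.
    + by rewrite !all_cat !all_rev_iota //=; lia.
  - by apply: all_nseqP; lia.
  by rewrite !all_cat all_nseqP ?all_rev_iota //=; lia.
apply: (@stair_second_coatom _ mu) => //.
- by lia.
- by rewrite /mu; size_lia.
- by rewrite Ela /mu !sumn_cat !sumn_nseq /= !sumn_cat /=; nia.
- by rewrite /mu -(prednK r0) /=; lia.
apply: (@below_states _ n_ge3 _ _ (nseq (q * n + r) (segw n) ++
    segw n :: map segw (rev (iota r.+2 e)) ++ segw r :: map segw (rev (iota 1 r)))) => //.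
- exact: padded_stair.
- by rewrite Ela /mu; size_lia.
- rewrite Ela map_cat map_nseq_segw /= map_cat /=.
  apply: all2_subseq_cat; first exact: all2_subseq_refl.
  rewrite /= subseq_refl; apply: all2_subseq_cat; first exact: all2_subseq_refl.
  by rewrite /= all2_subseq_refl andbT segment_word_subseq //; lia.
have -> : passes origin (nseq (q * n + r) (segw n) ++
    segw n :: map segw (rev (iota r.+2 e)) ++ segw r :: map segw (rev (iota 1 r))) =
    pt ((1 + q%:Z)%R :: nseq r (2%:Z + q%:Z)%R ++ (- q%:Z - 1)%R :: nseq e (1 + q%:Z)%R).
  rewrite foldl_cat (@passes_origin q r) //=; last by lia.
  have -> : pass n (pt (nseq (n - r) (- q%:Z)%R ++ nseq r (- q%:Z - 1)%R)) (segw n) =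
      pt (nseq e (- q%:Z)%R ++ ((- q%:Z)%R :: nseq r (- q%:Z - 1)%R ++ [:: (- q%:Z - 1)%R])).
    apply: (@passes_hi _ _ [:: (- q%:Z)%R] (nseq e (- q%:Z)%R ++ (- q%:Z)%R :: nseq r (- q%:Z - 1)%R) [::] 1).
    - by rewrite addn0.
    - by [].
    - by size_lia.
    - by size_lia.
    - rewrite (nseq_split _ (_ : n - r = 1 + (e + 1))) ?nseqD ?cats0 -?catA //; last by lia.
    - by rewrite -catA.
  rewrite foldl_cat (@passes_desc _ ((- q%:Z)%R :: nseq r (- q%:Z - 1)%R ++ [:: (- q%:Z - 1)%R] ++ nseq e (1 + q%:Z)%R)
     (nseq e (- q%:Z)%R) ((- q%:Z)%R :: nseq r (- q%:Z - 1)%R ++ [:: (- q%:Z - 1)%R]) [::]); last first.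
  - by rewrite cats0 map_nseq rev_nseq /= -catA; congr (_ :: _ ++ _ :: nseq _ _); lia.
  - by rewrite cats0.
  - by size_lia.
  - by size_lia.
  - by size_lia.
  rewrite /= (@pass_lo_at _ (nseq r (- q%:Z - 1)%R ++ [:: 1 + q%:Z, - q%:Z - 1 & nseq e (1 + q%:Z)]%R)
    (- q%:Z)%R (nseq r (- q%:Z - 1)%R) ((- q%:Z - 1)%R :: nseq e (1 + q%:Z)%R)) //; last first.
  - by congr (_ ++ _ :: _); lia.
  - by size_lia.
  - by size_lia.
  apply: (@passes_desc _ _ (nseq r (- q%:Z - 1)%R) [:: (1 + q%:Z)%R] ((- q%:Z - 1)%R :: nseq e (1 + q%:Z)%R)) => //.
  - by size_lia.
  - by size_lia.
  by rewrite map_nseq rev_nseq /=; congr (_ :: nseq _ _ ++ _); lia.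
rewrite /states /mu !map_cat !map_nseq_segw !foldl_cat (origin_pt n).
rewrite (@passes_hi _ (nseq e.+1 0%R ++ nseq r (- 1)%R ++ [:: 0%R])
             (nseq r 0%R) (nseq e.+1 0%R) [:: 0%R]); last first.
- by rewrite map_nseq.
- by rewrite (nseq_split _ (_ : n = r + (e.+1 + 1))) ?nseqD //; lia.
- by size_lia.
- by size_lia.
- by size_lia.
- by rewrite addn1.
rewrite -(addn1 (q * n)) nseqD foldl_cat.
rewrite (@passes_nn _ (nseq e.+1 (- q%:Z)%R ++ nseq r (- q%:Z - 1)%R ++ [:: (- q%:Z)%R]) q) //; last first.
- by rewrite !map_cat !map_nseq /= sub0r; congr (_ :: _ ++ nseq _ _ ++ _); lia.
- by size_lia.
rewrite (@passes_hi _ (nseq e (- q%:Z)%R ++ nseq r (- q%:Z - 1)%R ++ [:: - q%:Z; - q%:Z - 1]%R)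
             [:: (- q%:Z)%R] (nseq e (- q%:Z)%R ++ nseq r (- q%:Z - 1)%R ++ [:: (- q%:Z)%R]) [::] 1); last first.
- by rewrite -!catA.
- by rewrite cats0.
- by size_lia.
- by size_lia.
- by [].
- by rewrite addn0.
rewrite (@passes_desc _ (nseq r (- q%:Z - 1)%R ++ [:: - q%:Z, - q%:Z - 1 & nseq e (1 + q%:Z)]%R)
     (nseq e (- q%:Z)%R) (nseq r (- q%:Z - 1)%R ++ [:: - q%:Z; - q%:Z - 1]%R) [::]); last first.
- by rewrite cats0 map_nseq rev_nseq /= -catA; congr (_ ++ [:: _, _ & nseq _ _]); lia.
- by rewrite cats0.
- by size_lia.
- by size_lia.
- by size_lia.
rewrite (@passes_desc _ ((- q%:Z)%R :: nseq r (2%:Z + q%:Z)%R ++ (- q%:Z - 1)%R :: nseq e (1 + q%:Z)%R)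
     (nseq r (- q%:Z - 1)%R) [:: (- q%:Z)%R] ((- q%:Z - 1)%R :: nseq e (1 + q%:Z)%R)) //=; last first.
- by rewrite map_nseq rev_nseq; congr (_ :: nseq _ _ ++ _); lia.
- by size_lia.
- by size_lia.
by rewrite flip_pt; congr (pt (_ :: _)); lia.
Qed.

(** Deleting s_n from the last row of length n leaves two rows of length n-1. The resulting point
    belongs to a shape in which n-1 rows have grown to n+1 and the last row is empty. *)
Lemma stair_multiple q : ~ pal (nseq (q.+1 * n) n ++ rev (iota 1 (n - 1))).
Proof.
pose k := q * n + (n - 1); have Em : q.+1 * n = k + 1 by rewrite /k mulSn; lia.
pose mu := nseq (n - 1) n.+1 ++ nseq (q * n) n ++ rev (iota 1 (n - 1)) ++ [:: 0].
have Ela : nseq (q.+1 * n) n ++ rev (iota 1 (n - 1)) = nseq k n ++ n :: rev (iota 1 (n - 1)).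
  by rewrite Em nseqD -catA.
have vmu : padded mu.
  apply: (@padded_cat n); rewrite ?padded_nseq //; try lia.
  - apply: (@padded_cat (n - 1)); rewrite ?padded_nseq //; try lia.
    + apply: (@padded_cat 0); rewrite ?padded_desc //; try lia.
      * exact: (padded_zeros 1).
      * by apply: all_rev_iota; lia.
    + by apply: all_nseqP; lia.
    + by rewrite !all_cat !all_rev_iota //=; lia.
  - by apply: all_nseqP; lia.
  by rewrite !all_cat all_nseqP ?all_rev_iota //=; lia.
apply: (@stair_second_coatom _ mu) => //.
- by lia.
- by rewrite Em /mu /k; size_lia.
- by rewrite Ela /mu /k !sumn_cat !sumn_nseq /=; nia.
- by rewrite /mu (_ : n - 1 = (n - 2).+1) /=; lia.
apply: (@below_states _ n_ge3 _ _ (nseq k (segw n) ++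
    segw (n - 1) :: map segw (rev (iota 1 (n - 1))))) => //.
- exact: padded_stair.
- by rewrite Ela /mu /k; size_lia.
- rewrite Ela map_cat map_nseq_segw /=.
  apply: all2_subseq_cat; first exact: all2_subseq_refl.
  by rewrite /= all2_subseq_refl andbT segment_word_subseq //; lia.
have -> : passes origin (nseq k (segw n) ++ segw (n - 1) :: map segw (rev (iota 1 (n - 1)))) =
    pt ((1 + q%:Z)%R :: nseq (n - 1) (2%:Z + q%:Z)%R).
  rewrite foldl_cat (@passes_origin q (n - 1)) //=; last by lia.
  rewrite (@pass_lo_at _ (nseq (n - 1) (- q%:Z - 1)%R ++ [:: (1 + q%:Z)%R])
     (- q%:Z)%R (nseq (n - 1) (- q%:Z - 1)%R) [::]).
  + apply: (@passes_desc _ _ (nseq (n - 1) (- q%:Z - 1)%R) [:: (1 + q%:Z)%R] [::]) => //.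
    * by size_lia.
    * by size_lia.
    * by rewrite cats0 map_nseq rev_nseq /=; congr (_ :: nseq _ _); lia.
  + by size_lia.
  + by size_lia.
  + by rewrite cats0 (_ : n - (n - 1) = 1) //; lia.
  + by congr (_ ++ [:: _]); lia.
rewrite /states /mu !map_cat !map_nseq_segw !foldl_cat (origin_pt n).
rewrite (@passes_hi _ (nseq (n - 1) (- 1)%R ++ [:: 0%R]) (nseq (n - 1) 0%R) [::] [:: 0%R]); last first.
- by rewrite map_nseq.
- by rewrite {1}(nseq_split _ (_ : n = n - 1 + 1)) //; lia.
- by size_lia.
- by size_lia.
- by size_lia.
- by rewrite addn1.
rewrite (@passes_nn _ (nseq (n - 1) (- q%:Z - 1)%R ++ [:: (- q%:Z)%R]) q) //; last first.
- by rewrite !map_cat !map_nseq /= sub0r; congr (nseq _ _ ++ _); lia.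
- by size_lia.
rewrite (@passes_desc _ ((- q%:Z)%R :: nseq (n - 1) (2%:Z + q%:Z)%R)
     (nseq (n - 1) (- q%:Z - 1)%R) [:: (- q%:Z)%R] [::]) //=; last first.
- by rewrite cats0 map_nseq rev_nseq; congr (_ :: nseq _ _); lia.
- by size_lia.
- by size_lia.
by rewrite flip_pt; congr (pt (_ :: _)); lia.
Qed.

(** Here s_n is deleted from the last but one row of length n. The point reached is that of a shape
    with n rows of length n+1, in which the rows 1 and 0 at the end have become 0 and 0. *)
Lemma stair_residue1 q : ~ pal (nseq (q.+1 * n + 1) n ++ rev (iota 1 (n - 1))).
Proof.
pose k := q * n + (n - 1); have Em : q.+1 * n + 1 = k + 2 by rewrite /k mulSn; lia.
(* The n rows of length n+1 are split because a batch handled by [passes_hi] has at most n-1 of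
   them. *)
pose mu := nseq (n - 1) n.+1 ++ nseq 1 n.+1 ++ nseq (q * n) n ++ rev (iota 2 (n - 2)) ++ [:: 0; 0].
have Ela : nseq (q.+1 * n + 1) n ++ rev (iota 1 (n - 1)) = nseq k n ++ [:: n, n & rev (iota 1 (n - 1))].
  by rewrite Em nseqD -catA.
have vmu : padded mu.
  rewrite /mu catA -nseqD; apply: (@padded_cat n); rewrite ?padded_nseq //; try lia.
  - apply: (@padded_cat (n - 1)); rewrite ?padded_nseq //; try lia.
    + apply: (@padded_cat 0); rewrite ?padded_desc //; try lia.
      * exact: (padded_zeros 2).
      * by apply: all_rev_iota; lia.
    + by apply: all_nseqP; lia.
    + by rewrite !all_cat !all_rev_iota //=; lia.
  - by apply: all_nseqP; lia.
  by rewrite !all_cat all_nseqP ?all_rev_iota //=; lia.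
have Esum : sumn (rev (iota 1 (n - 1))) = sumn (rev (iota 2 (n - 2))) + 1.
  by rewrite (_ : n - 1 = 1 + (n - 2)) ?iotaD ?rev_cat ?sumn_cat //; lia.
apply: (@stair_second_coatom _ mu) => //.
- by lia.
- by rewrite Em /mu /k; size_lia.
- by rewrite Ela /mu /k !sumn_cat !sumn_nseq /= Esum; nia.
- by rewrite /mu (_ : n - 1 = (n - 2).+1) /=; lia.
apply: (@below_states _ n_ge3 _ _ (nseq k (segw n) ++
    [:: segw (n - 1), segw n & map segw (rev (iota 1 (n - 1)))])) => //.
- exact: padded_stair.
- by rewrite Ela /mu /k; size_lia.
- rewrite Ela map_cat map_nseq_segw /=.
  apply: all2_subseq_cat; first exact: all2_subseq_refl.
  by rewrite /= all2_subseq_refl subseq_refl !andbT segment_word_subseq //; lia.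
have -> : passes origin (nseq k (segw n) ++ [:: segw (n - 1), segw n & map segw (rev (iota 1 (n - 1)))]) =
    pt [:: - q%:Z - 2%:Z, - q%:Z & nseq (n - 2) (2%:Z + q%:Z)]%R.
  rewrite foldl_cat (@passes_origin q (n - 1)) //=; last by lia.
  rewrite (@pass_lo_at _ (nseq (n - 1) (- q%:Z - 1)%R ++ [:: (1 + q%:Z)%R])
     (- q%:Z)%R (nseq (n - 1) (- q%:Z - 1)%R) [::]); last first.
  + by congr (_ ++ [:: _]); lia.
  + by rewrite cats0 (_ : n - (n - 1) = 1) //; lia.
  + by size_lia.
  + by size_lia.
  have -> : pass n (pt (nseq (n - 1) (- q%:Z - 1)%R ++ [:: (1 + q%:Z)%R])) (segw n) =
      pt (nseq (n - 2) (- q%:Z - 1)%R ++ [:: 1 + q%:Z; - q%:Z - 2%:Z]%R).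
    apply: (@passes_hi _ _ [:: (- q%:Z - 1)%R] (nseq (n - 2) (- q%:Z - 1)%R ++ [:: (1 + q%:Z)%R]) [::] 1) => //.
    * by rewrite addn0.
    * by size_lia.
    * by rewrite cats0 {1}(nseq_split _ (_ : n - 1 = 1 + (n - 2))) //; lia.
    * by rewrite -catA /=; congr (_ ++ [:: _; _]); lia.
  apply: (@passes_desc _ _ (nseq (n - 2) (- q%:Z - 1)%R ++ [:: (1 + q%:Z)%R]) [:: (- q%:Z - 2%:Z)%R] [::]) => //.
  + by size_lia.
  + by size_lia.
  + by rewrite cats0 -catA.
  by rewrite cats0 map_cat rev_cat map_nseq rev_nseq /=; congr [:: _, _ & nseq _ _]; lia.
rewrite /states /mu !map_cat !map_nseq_segw !foldl_cat (origin_pt n).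
rewrite (@passes_hi _ (nseq (n - 1) (- 1)%R ++ [:: 0%R]) (nseq (n - 1) 0%R) [::] [:: 0%R]); last first.
- by rewrite map_nseq.
- by rewrite {1}(nseq_split _ (_ : n = n - 1 + 1)) //; lia.
- by size_lia.
- by size_lia.
- by size_lia.
- by rewrite addn1.
rewrite (@passes_hi _ (nseq (n - 2) (- 1)%R ++ [:: - 2%:Z; 0]%R) [:: (- 1)%R] (nseq (n - 2) (- 1)%R) [:: 0%R]) //; last first.
- by rewrite {1}(nseq_split _ (_ : n - 1 = 1 + (n - 2))) //; lia.
- by size_lia.
- by size_lia.
rewrite (@passes_nn _ (nseq (n - 2) (- q%:Z - 1)%R ++ [:: - q%:Z - 2%:Z; - q%:Z]%R) q) //; last first.
- by rewrite !map_cat !map_nseq /= sub0r; congr (nseq _ _ ++ [:: _; _]); lia.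
- by size_lia.
rewrite (@passes_desc _ [:: - q%:Z - 2%:Z, - q%:Z & nseq (n - 2) (2%:Z + q%:Z)]%R
     (nseq (n - 2) (- q%:Z - 1)%R) [:: - q%:Z - 2%:Z; - q%:Z]%R [::]) //=; last first.
- by rewrite cats0 map_nseq rev_nseq; congr [:: _, _ & nseq _ _]; lia.
- by size_lia.
- by size_lia.
by rewrite flipK.
Qed.

(** With a single row of length n the letter to delete is the final letter of the row of length 2.
    The first row of the resulting shape grows to n+2, and the rows 2 and 1 disappear. *)
Lemma stair_single : ~ pal (nseq 1 n ++ rev (iota 1 (n - 1))).
Proof.
pose mu := nseq 1 n.+2 ++ rev (iota 3 (n - 3)) ++ [:: 0; 0].
have Ela : nseq 1 n ++ rev (iota 1 (n - 1)) = n :: rev (iota 3 (n - 3)) ++ [:: 2; 1].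
  by rewrite (_ : n - 1 = 2 + (n - 3)) ?iotaD ?rev_cat //; lia.
have vmu : padded mu.
  apply: (@padded_cat n); rewrite ?padded_nseq //; try lia.
  - apply: (@padded_cat 0); rewrite ?padded_desc //; try lia.
    + exact: (padded_zeros 2).
    + by apply: all_rev_iota; lia.
  - by rewrite /= leqnSn.
  by rewrite !all_cat all_rev_iota //=; lia.
apply: (@stair_second_coatom _ mu) => //.
- by rewrite /mu; size_lia.
- by rewrite Ela /mu /= !sumn_cat /=; lia.
- by rewrite /mu /=; lia.
apply: (@below_states _ n_ge3 _ _ (segw n :: map segw (rev (iota 3 (n - 3))) ++ [:: [:: 2]; [:: 1]])) => //.
- exact: padded_stair.
- by rewrite Ela /mu; size_lia.
- rewrite Ela /= map_cat subseq_refl.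
  apply: all2_subseq_cat; first exact: all2_subseq_refl.
  by rewrite /= !segw_lo //; lia.
have -> : states n mu = pt ([:: - 1; 0; 0]%R ++ nseq (n - 3) 1%R).
  rewrite /states /mu !map_cat !map_nseq_segw !foldl_cat (origin_pt n).
  rewrite (@passes_hi _ (nseq (n - 3) 0%R ++ [:: - 1; 0; 0]%R) [:: 0%R] (nseq (n - 3) 0%R) [:: 0; 0]%R) //; last first.
  - by rewrite {1}(nseq_split _ (_ : n = 1 + (n - 3 + 2))) ?nseqD //; lia.
  - by size_lia.
  - by size_lia.
  rewrite (@passes_desc _ ([:: - 1; 0; 0]%R ++ nseq (n - 3) 1%R)
     (nseq (n - 3) 0%R) [:: - 1; 0; 0]%R [::]) //=; last first.
  - by rewrite cats0 map_nseq rev_nseq.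
  - by size_lia.
  - by size_lia.
  by rewrite flipK.
rewrite /= foldl_cat (origin_pt n).
have -> : pass n (pt (nseq n 0%R)) (segw n) = pt (nseq (n - 1) 0%R ++ [:: (- 1)%R]).
  apply: (@passes_hi _ _ [:: 0%R] (nseq (n - 1) 0%R) [::] 1) => //.
  - by rewrite addn0.
  - by size_lia.
  - by rewrite cats0 {1}(nseq_split _ (_ : n = 1 + (n - 1))) //; lia.
rewrite (@passes_desc _ ([:: 0; 0; - 1]%R ++ nseq (n - 3) 1%R)
     (nseq (n - 3) 0%R) [:: 0; 0; - 1]%R [::]) //; last first.
- by rewrite cats0 map_nseq rev_nseq.
- by rewrite cats0 (nseq_split _ (_ : n - 1 = n - 3 + 2)) -?catA //; lia.
- by size_lia.
- by size_lia.
rewrite -[LHS]/(pass n (pass n (pt [:: 0, 0, - 1 & nseq (n - 3) 1]%R) [:: 2]) [:: 1]).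
have -> : pass n (pt [:: 0, 0, - 1 & nseq (n - 3) 1]%R) [:: 2] = pt [:: 1, - 1, 0 & nseq (n - 3) 1]%R.
  rewrite /pass flip_pt.
  have := @act_rot n n_ge3 [:: 1%R] 0%R [:: - 1]%R (nseq (n - 3) 1%R).
  by rewrite size_nseq /=; apply; lia.
rewrite -[[:: 1]]/(rev (iota 1 1)) -segw_lo; last by lia.
apply: (@pass_lo_at _ _ 1%R [:: (- 1)%R] (0%R :: nseq (n - 3) 1%R)) => //.
by size_lia.
Qed.

End Families.

(** * Classification *)

Section Classification.
Variable n : nat.
Hypothesis n_ge3 : 2 < n.
Implicit Types (la mu l : seq nat) (v w : affB n).
Local Notation wp := (wprod (affB_mat n)).
Local Notation wsh la := (wp (shape_word n false la)).
Local Notation pal la := (palindromic (@omit n false) (wsh la)).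
Local Notation padded := (padded_shape n).
Local Notation segw := (segment_word n).

Lemma power_palindromic m : 1 < m -> pal (nseq m n) -> n = 3 /\ m = 3.
Proof.
move=> m1 pa; have E := divn_eq m n; have lt := ltn_pmod m (leq_trans (ltn0Sn 1) (ltnW n_ge3)).
move: E lt; set q := m %/ n; set r := m %% n => E lt.
have [r0|r0] := posnP r; last first.
  case: q E => [|q] E; last by case: (@power_residue n n_ge3 q r); rewrite -?E // r0.
  case: (@power_small n n_ge3 m.-1); rewrite ?prednK //; lia.
case: q E => [|[|q]] E; rewrite r0 addn0 in E; first by lia.
  have Em : m = n by lia.
  have [n4|] := ltnP 3 n; last by lia.
  by rewrite Em in pa; case: (power_square n_ge3 n4 pa).
by case: (power_multiple n_ge3 (q := q)); rewrite -E.
Qed.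

Lemma stair_not_palindromic m : 0 < m -> ~ pal (nseq m n ++ rev (iota 1 (n - 1))).
Proof.
move=> m0; have E := divn_eq m n; have lt := ltn_pmod m (leq_trans (ltn0Sn 1) (ltnW n_ge3)).
move: E lt; set q := m %/ n; set r := m %% n => E lt.
case: r E lt => [|[|r]] E lt.
- case: q E => [|q] E; first by lia.
  by rewrite E addn0; apply: stair_multiple.
- case: q E => [|q] E; last by rewrite E; apply: stair_residue1.
  by rewrite E; apply: stair_single.
by rewrite E; apply: stair_residue.
Qed.

Lemma palindromic_shape la : padded la -> all (fun j => 0 < j) la -> pal la ->
  [\/ exists2 j, j < 2 * n & la = one_row j,
      exists2 k, 1 < k < n & la = staircase k |
      n = 3 /\ la = [:: 3; 3; 3]].
Proof.
move=> vla pos pa.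
have [so|ns] := boolP (sorted (tight_rel n) la); last first.
  by case: (not_tight_not_palindromic n_ge3 vla pos ns).
case/lastP: la vla pos pa so => [|l p]; first by constructor 1; exists 0; [lia|].
case/lastP: l => [|l a] vla pos pa so.
  constructor 1; exists p; first by case/andP: vla => _ /= /andP[].
  by rewrite /one_row; case: eqP pos => //= ->.
have r : tight_rel n a p.
  by move: so; rewrite -cats1 cat_rcons sorted_cat_cons_split /= => /and3P[].
have p0 : 0 < p by move: pos; rewrite all_rcons => /andP[].
have [p1|p1] := ltnP 1 p.
  have [/andP[/eqP Ea /eqP Ep]|ne] := boolP ((a == n) && (p == n)); last first.
    by case: (tight_corank2_not_palindromic n_ge3 vla r p1 ne).
  constructor 3; rewrite Ep in so pa *; rewrite (tight_end_n n_ge3 so) in pa *.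
  have [] := power_palindromic _ pa; first by rewrite size_rcons.
  by move=> En ->; rewrite En.
have Ep : p = 1 by lia.
have [|[k lek E]|[m m0 E]] := @tight_end n n_ge3 (rcons l a) p _ so.
- by lia.
- constructor 2; exists k; last by rewrite E Ep /staircase; congr (rev (iota _ _)); lia.
  have := congr1 size E; rewrite !size_rcons size_rev size_iota; lia.
by case: (stair_not_palindromic m0); rewrite E Ep in pa.
Qed.

(** Elements below a segment stay in its parabolic, where a minimal representative is a segment,
    hence determined by its length. So every rank contains exactly one element. *)
Lemma segment_palindromic j : j < 2 * n -> palindromic (@omit n false) (segment n false j).
Proof.
move=> lt; have [mj ej] := segment_min_rep n_ge3 false lt.
suff cnt i : i <= j -> ideal_count (omit false) (segment n false j) i = 1.
  by apply/palindromicE => i; rewrite ej => le; rewrite !cnt // leq_subr.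
move=> le; have lti := leq_ltn_trans le lt; have [mi ei] := segment_min_rep n_ge3 false lti.
apply/eqP; rewrite eqn_leq; apply/andP; split.
  apply: (@ideal_count_le _ _ _ _ _ [:: segment n false i]) => v mv bv ev.
  have pv : parabolic (omit (~~ false)) v.
    have [a Ja Ea] := segment_parabolic n_ge3 false lt.
    have [a' sa' <-] := bruhat_subword bv Ea.
    by apply: parabolic_wprod; apply/allP => k /(mem_subseq sa')/(allP Ja).
  have [i' lti' Ev] := parabolic_min_segment n_ge3 mv pv.
  by have [_ ei'] := segment_min_rep n_ge3 false lti'; rewrite inE Ev -ev Ev ei'.
apply: (@ideal_count_ge _ _ _ _ _ [:: segment n false i]) => // v; rewrite inE => /eqP->.
split=> //; rewrite !segmentE; apply: subword_bruhat.
  by apply: map_subseq; apply: segment_word_subseq.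
by rewrite size_map size_segment_word // -segmentE.
Qed.

Lemma one_row_palindromic j : j < 2 * n -> pal (one_row j).
Proof.
move=> lt; rewrite /one_row; case: posnP => [j0|_] /=.
  by apply: (@segment_palindromic 0); lia.
exact: segment_palindromic.
Qed.

Lemma gtn_trans : transitive gtn.
Proof. by move=> y x z /= yx zy; apply: ltn_trans zy yx. Qed.

(** * Staircases and subsets of an interval *)

Section Staircase.
Variable k : nat.
Hypothesis k_bounds : 0 < k < n.
Local Notation la := (staircase k).

Lemma gtn_sorted_padded l : sorted gtn l -> all (fun j => j <= k) l -> padded l.
Proof.
move=> so al; apply/andP; split; first by apply: sub_sorted so => x y /=; rewrite /padded_rel => ->.
by apply: sub_all al => j /=; lia.
Qed.

Lemma staircase_sorted : sorted gtn la.
Proof. by rewrite /staircase rev_sorted iota_ltn_sorted. Qed.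

Lemma gtn_sorted_contained r l : sorted gtn l -> all (fun j => 0 < j <= r) l ->
  size l <= r /\ all2 leq (l ++ nseq (r - size l) 0) (staircase r).
Proof.
have E i : staircase i.+1 = i.+1 :: staircase i by rewrite /staircase iota_rcons rev_rcons.
elim: r l => [|r IH] [|a l] //=; first by rewrite andbC; lia.
  by move=> _ _; split=> //; rewrite E /=; have [] := IH [::] isT isT; rewrite subn0.
move=> so /andP[lea al]; have [|le le2] := IH l (path_sorted so).
  apply/allP => j jl; have := allP al j jl; have /= := allP (order_path_min gtn_trans so) j jl.
  by lia.
by split=> //; rewrite E /= subSS le2 andbT; lia.
Qed.

Lemma staircase_subseq mu : subseq mu la ->
  [/\ sorted gtn mu, all (fun j => 0 < j <= k) mu & padded mu].
Proof.
move=> sub; have so : sorted gtn mu.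
  exact: (subseq_sorted gtn_trans sub staircase_sorted).
have al : all (fun j => 0 < j <= k) mu.
  by apply/allP => j /(mem_subseq sub); rewrite mem_rev mem_iota; lia.
by split=> //; apply: gtn_sorted_padded => //; apply: sub_all al => j /andP[].
Qed.

Lemma subseq_staircase mu : sorted gtn mu -> all (fun j => 0 < j <= k) mu -> subseq mu la.
Proof.
move=> so al; have <- : [seq j <- la | j \in mu] = mu; last exact: filter_subseq.
apply: (irr_sorted_eq gtn_trans ltnn) => //.
  exact: (sorted_filter gtn_trans _ staircase_sorted).
move=> j; rewrite mem_filter mem_rev mem_iota; case jmu : (j \in mu) => //=.
by have := allP al j jmu; lia.
Qed.

Lemma padded_zeros_cat mu r : subseq mu la -> padded (mu ++ nseq r 0).
Proof.
move=> sub; have [_ al vmu] := staircase_subseq sub.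
apply: (@padded_cat _ n_ge3 0) => //; first exact: padded_zeros.
  by apply: sub_all al => j /andP[].
by rewrite all_nseq orbT.
Qed.

Lemma below_staircase mu : subseq mu la -> bruhat (wsh mu) (wsh la).
Proof.
move=> sub; have [so al vmu] := staircase_subseq sub.
have [le le2] := gtn_sorted_contained so al.
rewrite -(shape_word_cat0 n false mu (k - size mu)); apply: below_contained => //.
  by have [] := staircase_subseq (subseq_refl la).
exact: padded_zeros_cat.
Qed.

(** An element below the staircase lies in the parabolic of the nodes 0, ..., k, so its reduced word
    uses only these. This bounds the parts by k, and parts below n are distinct. *)
Lemma staircase_support mu : padded mu -> all (fun j => 0 < j) mu ->
  bruhat (wsh mu) (wsh la) -> subseq mu la.
Proof.
move=> vmu pos b; pose K (i : 'I_n.+1) := (i : nat) <= k.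
have Kla b' l : all (fun j => j <= k) l -> all K (shape_word n b' l).
  elim: l b' => //= j l IH b' /andP[lej al]; rewrite all_cat IH //= all_map.
  apply/allP => i; rewrite /= /K segw_lo; last by lia.
  rewrite mem_rev mem_iota => lei; rewrite inordK /relabel; case: ifP => _; case: b' => //=; lia.
have Pmu : parabolic K (wsh mu).
  have [a' sa' <-] := bruhat_subword b erefl; apply: parabolic_wprod.
  have [_ al _] := staircase_subseq (subseq_refl la).
  have /allP Kl := Kla false la (sub_all (fun j => @proj2 _ _ \o andP) al).
  by apply/allP => i /(mem_subseq sa')/Kl.
have [_ emu] := padded_shape_min_rep n_ge3 false vmu.
have /(_ (affB_gen_inj n_ge3)) := @reduced_word_support _ (affB_mat n) K (shape_word n false mu).
rewrite emu size_shape_word // => /(_ Pmu erefl) Kmu.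
(* A larger part would contain the letter k+1, which is at least 2 and thus unaffected by
   [relabel]. *)
have lek : all (fun j => j <= k) mu.
  case/andP: vmu => _; elim: mu false Kmu {pos b Pmu emu} => //= j mu IH b'.
  rewrite all_cat => /andP[Kmu Kj] /andP[ltj bd]; rewrite (IH _ Kmu bd) andbT leqNgt.
  apply/negP => lt; move: Kj; rewrite all_map => /allP /(_ k.+1).
  have -> : k.+1 \in segw j.
    apply: (mem_subseq (segment_word_subseq n_ge3 lt ltj)).
    by rewrite segw_lo ?mem_rev ?mem_iota; lia.
  by move=> /(_ isT); rewrite /= /K inordK /relabel; case: eqP; lia.
apply: subseq_staircase; last first.
  by apply/allP => j jmu; rewrite (allP pos j jmu) (allP lek j jmu).
case/andP: vmu => so _; case: mu so pos lek {b Kla Pmu emu Kmu} => //= a mu.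
elim: mu a => //= c mu IH a /andP[r so] /andP[a0 pos] /andP[lea lek].
by rewrite IH // andbT; move: r; rewrite /padded_rel; lia.
Qed.

Lemma mask_uniq_inj (T : eqType) (s : seq T) (m m' : bitseq) : uniq s ->
  size m = size s -> size m' = size s -> mask m s = mask m' s -> m = m'.
Proof.
move=> us; suff rec p : size p = size s -> p = [seq x \in mask p s | x <- s].
  by move=> sm sm' E; rewrite (rec m) // (rec m') // E.
elim: s us p => [|x s IH] /= => [_ [|]//|/andP[xs us] [|b p] //= [sp]].
have xm : x \in mask p s = false by apply: contraNF xs => /mem_mask.
rewrite {1}(IH us p sp); congr (_ :: _); first by case: b; rewrite /= ?inE ?eqxx ?xm.
apply/eq_in_map => y ys; case: b => //=; rewrite inE.
by case: eqP ys xs => // -> ->.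
Qed.

(** Masks of fixed length encode the subsets, so that complementation is entrywise negation; as the
    parts of the staircase are distinct, the mask is determined by the subset. *)
Definition sub_staircases i := [set m : k.-tuple bool | sumn (mask m la) == i].

Lemma ideal_count_staircase i : ideal_count (omit false) (wsh la) i = #|sub_staircases i|.
Proof.
have szla : size la = k by rewrite size_rev size_iota.
pose L := [seq wsh (mask m la) | m : k.-tuple bool <- enum (sub_staircases i)].
have szL : size L = #|sub_staircases i| by rewrite size_map -cardE.
have ok (m : k.-tuple bool) : padded (mask m la) by have [] := staircase_subseq (mask_subseq m la).
rewrite -szL; apply/eqP; rewrite eqn_leq; apply/andP; split.
  apply: ideal_count_le => v mv bv ev.
  have [mu [vmu pos Ev]] := min_rep_shape n_ge3 mv; rewrite Ev in bv ev *.
  have /subseqP[m sm Em] := staircase_support vmu pos bv.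
  have smk : size m == k by rewrite sm szla.
  apply/mapP; exists (Tuple smk); last by rewrite /= -Em.
  rewrite mem_enum inE /= -Em.
  by have [_ emu] := padded_shape_min_rep n_ge3 false vmu; rewrite -emu ev.
apply: ideal_count_ge; last first.
  move=> v /mapP[m]; rewrite mem_enum inE => /eqP Em ->.
  have [mm em] := padded_shape_min_rep n_ge3 false (ok m); split=> //; last by rewrite em.
  exact/below_staircase/mask_subseq.
rewrite map_inj_uniq ?enum_uniq // => m m' E; apply: val_inj.
apply: (@mask_uniq_inj _ la); rewrite ?size_tuple ?rev_uniq ?iota_uniq //.
(* Subsets of different sizes give lists of different lengths. Padding to k rows makes
   [padded_shape_inj] applicable, and removing the zeros recovers the list. *)
have pad (p : k.-tuple bool) : exists r, [/\ padded (mask p la ++ nseq r 0), size (mask p la ++ nseq r 0) = k &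
    [seq j <- mask p la ++ nseq r 0 | 0 < j] = mask p la].
  have [so al _] := staircase_subseq (mask_subseq p la).
  have [le le2] := gtn_sorted_contained so al.
  exists (k - size (mask p la)); split; last 1 first.
  - rewrite filter_cat (all_filterP _) ?(sub_all _ al) //; last by move=> j /andP[].
    by rewrite (@eq_in_filter _ _ pred0) ?filter_pred0 ?cats0 // => j /nseqP[->].
  - exact/padded_zeros_cat/mask_subseq.
  by rewrite size_cat size_nseq subnKC.
have [r [v1 s1 <-]] := pad m; have [r' [v2 s2 <-]] := pad m'.
rewrite (@padded_shape_inj n n_ge3 false (mask m la ++ nseq r 0) (mask m' la ++ nseq r' 0)) ?s1 ?s2 //.
by rewrite !shape_word_cat0.
Qed.

Lemma sumn_mask_negb (s : seq nat) (m : bitseq) : size m = size s ->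
  sumn (mask m s) + sumn (mask (map negb m) s) = sumn s.
Proof.
elim: s m => [|x s IH] [|b m] //= [sm]; have := IH m sm.
by case: b => /=; lia.
Qed.

Lemma staircase_palindromic : pal la.
Proof.
have [_ _ vla] := staircase_subseq (subseq_refl la).
have [_ ela] := padded_shape_min_rep n_ge3 false vla.
apply/palindromicE => i; rewrite ela => le; rewrite !ideal_count_staircase.
pose neg (m : k.-tuple bool) : k.-tuple bool := [tuple of map negb m].
have negK : involutive neg.
  move=> m; apply: val_inj => /=; rewrite -map_comp -[RHS]map_id.
  by apply: eq_map => b /=; rewrite negbK.
rewrite -(card_imset (mem (sub_staircases i)) (inv_inj negK)); apply: eq_card => m.
have szla : size la = k by rewrite size_rev size_iota.
have Esum (p : k.-tuple bool) := @sumn_mask_negb la p (eq_trans (size_tuple p) (esym szla)).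
apply/imsetP/idP => [[p]|].
  by rewrite !inE => /eqP Ep ->; have := Esum p; rewrite /= Ep; lia.
rewrite inE => /eqP Em; exists (neg m); last by rewrite negK.
by rewrite inE /=; have := Esum m; rewrite Em; lia.
Qed.

End Staircase.

End Classification.

(** * The shape (3,3,3) for n = 3 *)

Section Cube.
Local Notation wp := (wprod (affB_mat 3)).
Local Notation wsh la := (wp (shape_word 3 false la)).
Local Notation segw := (segment_word 3).

Lemma subseq_general_word_split n b (ds : seq (seq nat)) u :
  subseq u (general_word n b ds) ->
  exists2 cs, all2 (fun c' c => subseq c' c) cs ds & u = general_word n b cs.
Proof.
elim: ds b u => [|d ds IH] b u.
  by rewrite subseq0 => /eqP->; exists [::].
rewrite /= => /subseqP[m sm ->]; rewrite size_cat in sm.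
have sm1 : size (take (size (general_word n (~~ b) ds)) m) = size (general_word n (~~ b) ds).
  by rewrite size_takel // sm leq_addr.
rewrite -(cat_take_drop (size (general_word n (~~ b) ds)) m) mask_cat //.
have [cs Hcs ->] := IH _ _ (mask_subseq (take (size (general_word n (~~ b) ds)) m) (general_word n (~~ b) ds)).
exists (mask (drop (size (general_word n (~~ b) ds)) m) d :: cs).
  by rewrite /= Hcs mask_subseq.
by rewrite /= /bword map_mask.
Qed.

(* Found by enumerating the 512 subwords; rows are padded to three with zeros. *)
Definition cube_ideal : seq (seq nat) :=
  [:: [:: 0; 0; 0]; [:: 1; 0; 0]; [:: 2; 0; 0]; [:: 3; 0; 0]; [:: 2; 1; 0];
      [:: 4; 0; 0]; [:: 3; 1; 0]; [:: 3; 2; 0]; [:: 5; 0; 0]; [:: 3; 3; 0];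
      [:: 3; 2; 1]; [:: 3; 3; 1]; [:: 3; 3; 2]; [:: 3; 3; 3]].

Definition subwords3 : seq (seq nat) :=
  [:: [::]; [:: 1]; [:: 2]; [:: 3]; [:: 2; 1]; [:: 3; 1]; [:: 3; 2]; [:: 3; 2; 1]].

Definition cube_subwords : seq (seq (seq nat)) :=
  [seq c :: p | c <- subwords3, p <- [seq [:: d; e] | d <- subwords3, e <- subwords3]].

(** States are functions on all of nat, so equality is decided on the three coordinates that can
    move. *)
Definition coords (x : nat -> int) : seq int := [:: x 0; x 1; x 2].

Lemma passes_out (cs : seq (seq nat)) (x : nat -> int) k :
  all (all (fun k => 1 <= k <= 3)) cs -> 2 < k -> foldl (pass 3) x cs k = x k.
Proof.
move=> al k3; elim: cs x al => //= c cs IH x /andP[Hc Hcs]; rewrite IH // /pass.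
elim: c Hc => [|i c IHc] /=; first by rewrite /flip; case: eqP k3 => // ->.
by case/andP=> lei Hc; rewrite point_act_out ?IHc //; case/andP: lei.
Qed.

Lemma coords_inj (cs ds : seq (seq nat)) :
  all (all (fun k => 1 <= k <= 3)) cs -> all (all (fun k => 1 <= k <= 3)) ds ->
  coords (foldl (pass 3) origin cs) = coords (foldl (pass 3) origin ds) ->
  foldl (pass 3) origin cs = foldl (pass 3) origin ds.
Proof.
move=> Hcs Hds [E0 E1 E2]; apply/funext => -[|[|[|k]]] //.
by rewrite !passes_out.
Qed.

Lemma mem_subwords3 c : subseq c [:: 3; 2; 1] -> c \in subwords3.
Proof.
case/subseqP=> m sm ->.
by case: m sm => [|[] [|[] [|[] [|]]]].
Qed.

Lemma cube_subwordsP (cs : seq (seq nat)) :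
  all2 (fun c' c => subseq c' c) cs (map segw [:: 3; 3; 3]) -> cs \in cube_subwords.
Proof.
move=> sub; have sz : size cs = 3 by move: sub; rewrite all2E => /andP[/eqP].
case: cs sz sub => [|c [|d [|e [|]]]] // _ /andP[Hc /andP[Hd /andP[He _]]].
by apply: allpairs_f; rewrite ?mem_subwords3 //; apply: allpairs_f; rewrite mem_subwords3.
Qed.

Definition same_state (cs : seq (seq nat)) (g : seq nat) :=
  coords (foldl (pass 3) origin cs) == coords (states 3 g).

(** This computation and the next give the two inclusions between the ideal and the list: every
    subword ends at the point of a listed shape, and every listed shape is reached by a subword. *)
Lemma cube_subwords_states :
  all (fun cs => has (same_state cs) cube_ideal) cube_subwords.
Proof. by vm_compute. Qed.

Lemma cube_ideal_states : all (fun g =>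
  has (fun cs => all2 (fun c' c => subseq c' c) cs (map segw [:: 3; 3; 3]) && same_state cs g)
    cube_subwords) cube_ideal.
Proof. by vm_compute. Qed.

Lemma cube_ideal_padded g : g \in cube_ideal -> padded_shape 3 g /\ size g = 3.
Proof.
move=> gC; have : all (fun g => padded_shape 3 g && (size g == 3)) cube_ideal by vm_compute.
by move/allP/(_ g gC)/andP => [-> /eqP].
Qed.

Lemma segment_words_bounds (la : seq nat) : padded_shape 3 la ->
  all (all (fun k => 1 <= k <= 3)) (map segw la).
Proof.
case/andP=> _ al; rewrite all_map; apply: sub_all al => j /= lt.
exact: segment_word_bounds.
Qed.

Lemma sub_words_bounds (cs ds : seq (seq nat)) :
  all2 (fun c' c => subseq c' c) cs ds ->
  all (all (fun k => 1 <= k <= 3)) ds -> all (all (fun k => 1 <= k <= 3)) cs.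
Proof.
elim: cs ds => [|c cs IH] [|d ds] //= /andP[cd sub] /andP[Hd Hds].
rewrite (IH _ sub Hds) andbT.
by apply/allP => k /(mem_subseq cd); apply: (allP Hd).
Qed.

Lemma ideal_count_cube i :
  ideal_count (omit false) (wsh [:: 3; 3; 3]) i = count (fun g => sumn g == i) cube_ideal.
Proof.
have n3 : 2 < 3 by [].
have vla : padded_shape 3 [:: 3; 3; 3] by [].
pose L := [seq wsh g | g <- cube_ideal & sumn g == i].
have -> : count (fun g => sumn g == i) cube_ideal = size L by rewrite size_map size_filter.
apply/eqP; rewrite eqn_leq; apply/andP; split.
  apply: ideal_count_le => v mv bv ev.
  have [u] := bruhat_subword bv erefl.
  rewrite shape_wordE => /subseq_general_word_split[cs sub ->] Ev.
  have /hasP[g gC /eqP E] := allP cube_subwords_states _ (cube_subwordsP sub).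
  have [vg sg] := cube_ideal_padded gC.
  have [mg eg] := padded_shape_min_rep n3 false vg.
  have bcs := sub_words_bounds sub (segment_words_bounds vla).
  have szcs : size cs = 3 by move: sub; rewrite all2E => /andP[/eqP].
  have Evg : v = wsh g.
    apply: (point_inj n3 mv mg); rewrite -Ev !bact_word // shape_wordE /base.
    rewrite !foldr_general_word ?segment_words_bounds // size_map szcs sg.
    by congr twist; apply: coords_inj => //; apply: segment_words_bounds.
  by apply/mapP; exists g => //; rewrite mem_filter gC andbT -eg -Evg ev.
apply: ideal_count_ge.
  rewrite map_inj_in_uniq; first by rewrite filter_uniq.
  move=> g g'; rewrite !mem_filter => /andP[_ /cube_ideal_padded[v1 s1]] /andP[_ /cube_ideal_padded[v2 s2]].
  by apply: padded_shape_inj; rewrite ?s1 ?s2.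
move=> v /mapP[g]; rewrite mem_filter => /andP[/eqP sg gC] ->.
have [vg szg] := cube_ideal_padded gC.
have [mg eg] := padded_shape_min_rep n3 false vg; split=> //; last by rewrite eg.
have /hasP[cs _ /andP[sub /eqP E]] := allP cube_ideal_states _ gC.
apply: (below_states n3 vla vg szg sub).
apply: coords_inj => //; last exact: segment_words_bounds.
exact: sub_words_bounds sub (segment_words_bounds vla).
Qed.

Lemma cube_palindromic : palindromic (omit false) (wsh [:: 3; 3; 3]).
Proof.
apply/palindromicE => i; have [//|_ ->] := @padded_shape_min_rep 3 isT false [:: 3; 3; 3].
by rewrite !ideal_count_cube; do 10 (case: i => [|i] //).
Qed.

End Cube.

(** * The classification in terms of [affB_pi] *)

Lemma affB_pi_shape n (w : affB n) : 2 < n -> min_rep (omit false) w ->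
  [/\ padded_shape n (affB_pi w), all (fun j => 0 < j) (affB_pi w) &
      w = wprod (affB_mat n) (shape_word n false (affB_pi w))].
Proof.
move=> n3 mw; have [la sh] := affB_shape_exists n3 mw.
apply: (affB_shape_padded n3).
exact: (@xgetI _ [::] [set la | affB_shape false w la]%classic la sh).
Qed.

Theorem theorem5p12 (n : nat) (w : affB n) (hw : min_rep (@omit n false) w) :
  (4 <= n ->
     (palindromic (@omit n false) w <->
        (exists j : nat, j < 2 * n /\ affB_pi w = one_row j) \/
        (exists k : nat, 1 < k < n /\ affB_pi w = staircase k)))
  /\
  (n = 3 ->
     (palindromic (@omit n false) w <->
        [\/ exists j : nat, affB_pi w = one_row j,
            affB_pi w = [:: 2; 1] |
            affB_pi w = [:: 3; 3; 3]])).
Proof.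
have main (n3 : 2 < n) : palindromic (@omit n false) w <->
    [\/ exists2 j, j < 2 * n & affB_pi w = one_row j,
        exists2 k, 1 < k < n & affB_pi w = staircase k |
        n = 3 /\ affB_pi w = [:: 3; 3; 3]].
  have [v pos Ew] := affB_pi_shape n3 hw.
  split=> [pal|]; first by apply: palindromic_shape => //; rewrite -Ew.
  move=> shape; suff : palindromic (@omit n false)
      (wprod (affB_mat n) (shape_word n false (affB_pi w))) by rewrite -Ew.
  case: shape => [[j lt ->]|[k /andP[k1 kn] ->]|[En ->]].
  - exact: one_row_palindromic.
  - by apply: staircase_palindromic => //; rewrite (ltnW k1).
  - by clear -En; subst n; apply: cube_palindromic.
split=> [n4|n3].
  rewrite (main (ltnW n4)); split=> [[[j lt E]|[k lek E]|[En _]]|[[j [lt E]]|[k [lek E]]]].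
  - by left; exists j.
  - by right; exists k.
  - by rewrite En in n4.
  - by constructor 1; exists j.
  - by constructor 2; exists k.
have n3' : 2 < n by rewrite n3.
rewrite (main n3'); split=> [[[j lt E]|[k lek E]|[_ E]]|[[j E]|E|E]].
- by constructor 1; exists j.
- by constructor 2; rewrite E; have -> : k = 2 by lia.
- by constructor 3.
(* The bound j < 2n is recovered from the shape itself, as all parts of [affB_pi w] are below 2n. *)
- constructor 1; exists j => //; have [/andP[_ bd] _ _] := affB_pi_shape n3' hw.
  by move: bd; rewrite E /one_row; case: posnP => [->|_] /= => [_|/andP[]] //; lia.
- by constructor 2; exists 2; rewrite ?E // n3.
- by constructor 3.
Qed.
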